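(* Let $n\ge1$. A function $f\in\Phi(\mathbb{H}_n)$ can be reconstructed from $\varphi=R_H f$ by each of the following formulas: $$f(\zeta,\tau)=(-1)^n(4\pi)^{-2n}\,\partial_\tau^{2n}(R_H\varphi)(\zeta,\tau)$$ $$=(-1)^n(4\pi)^{-2n}\,(R_H\,\partial_t^{2n}\varphi)(\zeta,\tau)$$ $$=(-1)^n(4\pi)^{-2n}\,\partial_\tau^{n}(R_H\,\partial_t^{n}\varphi)(\zeta,\tau),\qquad(\zeta,\tau)\in\mathbb{H}_n.$$
   Context: $\mathbb{H}_n=\mathbb{C}^n\times\mathbb{R}$ (Heisenberg group), identified with $\mathbb{R}^{2n+1}$ for purposes of function spaces; $S(\mathbb{H}_n)$ is the Schwartz space. The Heisenberg Radon transform is $$(R_H f)(z,t)=\int_{\mathbb{C}^n}f\big(\zeta,\,t-\tfrac12\operatorname{Im}(z\cdot\bar\zeta)\big)\,d\zeta,\qquad z\cdot\bar\zeta=\sum_j z_j\bar\zeta_j.$$ $$\Phi(\mathbb{H}_n)=\Big\{\phi\in S(\mathbb{H}_n):\ \int_{\mathbb{R}}\phi(\zeta,\tau)\,\tau^k\,d\tau=0\ \ \forall k\in\{0,1,2,\ldots\},\ \forall\zeta\in\mathbb{C}^n\Big\}.$$ $\partial_\tau$ and $\partial_t$ denote differentiation in the last (real) variable; $\varphi=\varphi(z,t)$. *)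

(* Defs.v *)
From HB Require Import structures.
From mathcomp Require Import all_boot all_order all_algebra.
From mathcomp Require Import all_classical all_reals all_analysis.
From mathcomp.real_closed Require Import complex.

Set Implicit Arguments.
Unset Strict Implicit.
Unset Printing Implicit Defensive.
Import Order.TTheory GRing.Theory Num.Theory.
Import numFieldNormedType.Exports.

Local Open Scope classical_set_scope.
Local Open Scope ring_scope.
Local Open Scope complex_scope.

(* The library proves this only through a canonical instance that is shadowed by
   the one for products of subprobabilities. *)
Lemma sigma_finite_prod d1 d2 (T1 : measurableType d1) (T2 : measurableType d2)
    (R : realType) (m1 : {sigma_finite_measure set T1 -> \bar R})
    (m2 : {sigma_finite_measure set T2 -> \bar R}) :
  sigma_finite setT (m1 \x m2)%E.
Proof.
have /sigma_finiteP[F [TF ndF Foo]] := sigma_finiteT m1.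
have /sigma_finiteP[G [TG ndG Goo]] := sigma_finiteT m2.
exists (fun k => F k `*` G k).
  rewrite -setXTT TF TG; apply/seteqP; split=> -[x y] /=.
    move=> [[i _ Fix] [j _ Gjy]]; exists (maxn i j) => //; split.
      by move: x Fix; exact/subsetPset/ndF/leq_maxl.
    by move: y Gjy; exact/subsetPset/ndG/leq_maxr.
  by move=> [k _ [/= Fkx Gky]]; split; exists k.
move=> k; have [mFk Fkoo] := Foo k; have [mGk Gkoo] := Goo k.
split; first exact: measurableX.
by rewrite product_measure1E// lte_mul_pinfty// ge0_fin_numE.
Qed.

(* Lebesgue measure on R^n, as the n-fold product of [lebesgue_measure]. *)
Section lebesgue_Rn.
Context {R : realType}.
Local Notation Rn n := (n.-tuple (measurableTypeR R)).

Definition Rn_cons n (x : measurableTypeR R * Rn n) : Rn n.+1 :=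
  [tuple of x.1 :: x.2].

Lemma measurable_Rn_cons n : measurable_fun setT (@Rn_cons n).
Proof. exact: measurable_cons. Qed.

Section step.
Variables (n : nat) (mu : {sigma_finite_measure set (Rn n) -> \bar R}).

Definition lebesgue_Rn_step : set (Rn n.+1) -> \bar R :=
  pushforward ((@lebesgue_measure R) \x mu)%E (@Rn_cons n).

Let step0 : lebesgue_Rn_step set0 = 0%E.
Proof. by rewrite /lebesgue_Rn_step /pushforward preimage_set0 measure0. Qed.

Let step_ge0 A : (0 <= lebesgue_Rn_step A)%E.
Proof. by rewrite /lebesgue_Rn_step /pushforward measure_ge0. Qed.

Let step_sigma_additive : semi_sigma_additive lebesgue_Rn_step.
Proof.
pose m : {measure set (measurableTypeR R * Rn n) -> \bar R} :=
  ((@lebesgue_measure R) \x mu)%E.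
pose pm := measure_function_pushforward__canonical__measure_function_Measure
  m (measurable_Rn_cons (n := n)).
exact: (@measure_semi_sigma_additive _ _ _ pm).
Qed.

HB.instance Definition _ := isMeasure.Build _ _ _ lebesgue_Rn_step
  step0 step_ge0 step_sigma_additive.

Let step_sigma_finite : sigma_finite setT lebesgue_Rn_step.
Proof.
have [F FT Foo] := sigma_finite_prod (@lebesgue_measure R) mu.
pose uncons (t : Rn n.+1) : measurableTypeR R * Rn n :=
  (tnth t ord0, [tuple of behead t]).
have munc : measurable_fun setT uncons.
  apply/measurable_fun_pair; [exact: measurable_tnth|exact: measurable_behead].
have unconsK x : uncons (Rn_cons x) = x.
  by case: x => x t; congr pair; apply: val_inj.
exists (fun k => uncons @^-1` F k).
  by rewrite -preimage_bigcup -FT preimage_setT.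
move=> k; have [mFk Fkoo] := Foo k; split.
  by rewrite -[X in measurable X]setTI; exact: munc.
rewrite /lebesgue_Rn_step /pushforward -comp_preimage.
by rewrite (_ : uncons \o _ = id) ?preimage_id//; apply/funext => x /=.
Qed.

HB.instance Definition _ := Measure_isSigmaFinite.Build _ _ _ lebesgue_Rn_step
  step_sigma_finite.
End step.

Fixpoint lebesgue_Rn n : {sigma_finite_measure set (Rn n) -> \bar R} :=
  if n is m.+1 then lebesgue_Rn_step (lebesgue_Rn m)
  else \d_ ([tuple] : Rn 0).

(* Lebesgue measure on C^n = R^n x R^n, z = x + i y <-> (x, y). *)
Definition lebesgue_Cn n : set (Rn n * Rn n)%type -> \bar R :=
  (lebesgue_Rn n \x lebesgue_Rn n)%E.

HB.instance Definition _ n := Measure.copy (@lebesgue_Cn n)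
  (lebesgue_Rn n \x lebesgue_Rn n)%E.
HB.instance Definition _ n := Measure_isSigmaFinite.Build _ _ _ (@lebesgue_Cn n)
  (sigma_finite_prod (lebesgue_Rn n) (lebesgue_Rn n)).

End lebesgue_Rn.
Arguments lebesgue_Rn : clear implicits.
Arguments lebesgue_Cn : clear implicits.

(* Complex-valued functions are integrated and differentiated componentwise.
   [Cintegral] and [Cderive1n] are total operators with junk values;
   [Cintegrable] (absolute convergence) and [Cderivable1n m] (the derivatives of
   orders 1, ..., m exist everywhere) say that these values are meaningful. *)
Section complex_valued.
Context {R : realType}.

Definition Cintegral d (T : measurableType d) (mu : {measure set T -> \bar R})
    (g : T -> R[i]) : R[i] :=
  (\int[mu]_x complex.Re (g x)) +i* (\int[mu]_x complex.Im (g x)).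

Definition Cintegrable d (T : measurableType d)
    (mu : {measure set T -> \bar R}) (g : T -> R[i]) : Prop :=
  mu.-integrable setT (EFin \o (@complex.Re R \o g)) /\
  mu.-integrable setT (EFin \o (@complex.Im R \o g)).

Definition Cderive1n (m : nat) (g : R -> R[i]) (t : R) : R[i] :=
  derive1n m (@complex.Re R \o g) t +i* derive1n m (@complex.Im R \o g) t.

Definition Cderivable1n (m : nat) (g : R -> R[i]) : Prop :=
  forall (k : nat) (t : R), (k < m)%N ->
    derivable (derive1n k (@complex.Re R \o g)) t 1 /\
    derivable (derive1n k (@complex.Im R \o g)) t 1.

End complex_valued.

Section schwartz.
Context {R : realType} {N : nat}.

Definition pderiv (i : 'I_N) (F : 'rV[R]_N -> R) : 'rV[R]_N -> R :=
  fun x => 'D_(delta_mx 0 i) F x.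

(* Iterated partial derivatives are indexed by lists of coordinate directions
   rather than by multi-indices, so that [smooth] does not presuppose that they
   commute. *)
Definition pderivs (s : seq 'I_N) (F : 'rV[R]_N -> R) : 'rV[R]_N -> R :=
  foldr pderiv F s.

Definition smooth (F : 'rV[R]_N -> R) : Prop :=
  forall (s : seq 'I_N) (x : 'rV[R]_N), differentiable (pderivs s F) x.

Definition schwartz (F : 'rV[R]_N -> R) : Prop :=
  smooth F /\
  forall (a : 'I_N -> nat) (s : seq 'I_N), exists M : R,
    forall x : 'rV[R]_N, `|(\prod_(i < N) x 0 i ^+ a i) * pderivs s F x| <= M.

End schwartz.

Definition heis (R : realType) (n : nat) : Type := ('rV[R[i]]_n * R)%type.

Section heisenberg.
Context {R : realType} {n : nat}.

(* The identification of R^(2n+1) with H_n: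
   (x_1, ..., x_n, y_1, ..., y_n, t) |-> (x + i y, t). *)
Definition heis_of_row (v : 'rV[R]_(n + n).+1) : heis R n :=
  (\row_j (v 0 (widen_ord (leqnSn _) (lshift n j)) +i*
           v 0 (widen_ord (leqnSn _) (rshift n j))),
   v 0 ord_max).

Definition heis_schwartz (f : heis R n -> R[i]) : Prop :=
  schwartz (fun v => complex.Re (f (heis_of_row v))) /\
  schwartz (fun v => complex.Im (f (heis_of_row v))).

Definition heis_Phi (f : heis R n -> R[i]) : Prop :=
  heis_schwartz f /\
  forall (k : nat) (z : 'rV[R[i]]_n),
    Cintegral (@lebesgue_measure R) (fun t : R => f (z, t) * (t ^+ k)%:C) = 0.

Definition hdot (z w : 'rV[R[i]]_n) : R[i] := \sum_(j < n) z 0 j * (w 0 j)^*.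

Definition Cn_of_pair
    (xy : n.-tuple (measurableTypeR R) * n.-tuple (measurableTypeR R)) :
    'rV[R[i]]_n :=
  \row_j (tnth xy.1 j +i* tnth xy.2 j).

Definition radon_integrand (f : heis R n -> R[i]) (p : heis R n)
    (w : 'rV[R[i]]_n) : R[i] :=
  f (w, p.2 - 2^-1 * complex.Im (hdot p.1 w)).

Definition heis_radon (f : heis R n -> R[i]) (p : heis R n) : R[i] :=
  Cintegral (lebesgue_Cn R n) (radon_integrand f p \o Cn_of_pair).

Definition heis_radon_cvg (f : heis R n -> R[i]) : Prop :=
  forall p, Cintegrable (lebesgue_Cn R n) (radon_integrand f p \o Cn_of_pair).

(* [dlast m f] is the m-th derivative of f in the last (real) variable. *)
Definition dlast (m : nat) (f : heis R n -> R[i]) (p : heis R n) : R[i] :=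
  Cderive1n m (fun t => f (p.1, t)) p.2.

Definition dlast_cvg (m : nat) (f : heis R n -> R[i]) : Prop :=
  forall z, Cderivable1n m (fun t => f (z, t)).

End heisenberg.

(* Main.v *)
Require Import Defs.
(* No Fourier transform is needed. Because its moments vanish, [f] has
   [t]-antiderivatives of every order which decay rapidly together with all their
   derivatives. Integrating by parts along the coordinates of [w] in
   [g (w, t - Im (z . w^* ) / 2)] therefore gains arbitrary decay of the Radon
   transform in [z], which justifies all the integrals and derivatives involved.

   By Fubini, peeling off one complex coordinate at a time reduces the inversion
   formula to an identity in the plane: if [h] is the second [t]-derivative of [k],
   then the integral over [y] of the integral over [x] of
   [h (x, t - (y2 (x1 - a) - y1 (x2 - b)) / 2)] is [- 16 pi^2 k ((a, b), t)].
   Insert a Gaussian cutoff [g (y / K)], exchange the integrals and rescale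
   [x - (a, b)] by [2 / K]; as [K] tends to infinity the left-hand side becomes [4]
   times the integral over [(c, d)] of
   [Psi (c, d) = int int g(p) g(q) h ((a, b), t + c p + d q) dp dq].
   If [S] is defined like [Psi], with [k] in place of [h], integrating by parts
   against the Gaussians gives, along each ray,
   [d/dx S (x, v x) = (1 + v^2) x Psi (x, v x) / 2],
   so the integral of [Psi] is [- 4 pi^2 k ((a, b), t)]. *)
From HB Require Import structures.
From mathcomp Require Import all_boot all_order all_algebra.
From mathcomp Require Import all_classical all_reals all_analysis.
From mathcomp Require Import measurable_realfun.
From mathcomp.real_closed Require Import complex.
From mathcomp Require Import ring lra.
Set Implicit Arguments.
Unset Strict Implicit.
Unset Printing Implicit Defensive.
Import Order.TTheory GRing.Theory Num.Theory.
Import numFieldNormedType.Exports.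

Local Open Scope classical_set_scope.
Local Open Scope ring_scope.
Local Open Scope complex_scope.
(** * Dominated integrals of real functions *)

(** In the plane the two integrals cannot be exchanged directly: for fixed [x] the integrand has no
    decay in [y], so Fubini does not apply. This is what the Gaussian cutoff is for. It is removed
    by dominated convergence on both sides, using the decay of the inner Radon transform on one and
    the decay of [Psi] in [(c, d)] on the other; both are bought with [t]-antiderivatives.

    Majorants are built from [rho x = 1 / (1 + x ^+ 2)]: integrating by parts twice along a
    coordinate gains a factor [1 + c ^+ 2], the inverse of one [rho c], at the cost of two
    antiderivatives. Decay in [t] serves only to construct the antiderivatives; afterwards [t] is
    merely shifted, and bounds uniform in [t] suffice.

    The three formulas are one. The Radon transform commutes with the [t]-derivative, so each
    right-hand side is a constant times the double transform of the derivative of order [2 n] of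
    [f]. Each complex coordinate consumes two of these derivatives and yields the factor
    [- 16 pi ^+ 2], which the constant compensates. The transform is real, so real and imaginary
    parts are treated separately. *)

Section general_measure.
Context {R : realType} d (T : measurableType d) (mu : {measure set T -> \bar R}).
Implicit Types f g r : T -> R.

Lemma integral_EFinE f : (\int[mu]_x (f x)%:E =
  \int[mu]_x (EFin \o f)^\+ x - \int[mu]_x (EFin \o f)^\- x)%E.
Proof.
rewrite [LHS]integralE.
by congr (_ - _)%E; apply: eq_integral => y _; rewrite ?funeposE ?funenegE.
Qed.

Lemma dom_integrable f r : measurable_fun setT f ->
  mu.-integrable setT (EFin \o r) -> (forall x, `|f x| <= r x) ->
  mu.-integrable setT (EFin \o f).
Proof.
move=> mf ir fr; apply: (le_integrable _ _ _ ir) => //.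
  exact/measurable_EFinP.
by move=> x _ /=; rewrite lee_fin (le_trans (fr x))// ler_norm.
Qed.

Lemma integrableZ_fin (C : R) r : mu.-integrable setT (EFin \o r) ->
  mu.-integrable setT (EFin \o (fun x => C * r x)).
Proof. by move=> ir; have := integrableZl measurableT C ir; apply. Qed.

Lemma integrableZr_fin (C : R) r : mu.-integrable setT (EFin \o r) ->
  mu.-integrable setT (EFin \o (fun x => r x * C)).
Proof.
move=> ir; have := integrableZ_fin C ir.
by congr integrable; apply/funext => x /=; rewrite mulrC.
Qed.

Lemma le_dom_Rintegral f r : measurable_fun setT f ->
  mu.-integrable setT (EFin \o r) -> (forall x, `|f x| <= r x) ->
  `|\int[mu]_x f x| <= \int[mu]_x r x.
Proof.
move=> mf ir fr; have if_ := dom_integrable mf ir fr.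
apply: le_trans (le_normr_Rintegral measurableT if_) _.
apply: le_Rintegral => //; apply: (dom_integrable _ ir) => //.
  exact: measurableT_comp.
by move=> x; rewrite normr_id.
Qed.

Lemma Rdominated_cvg (f_ : nat -> T -> R) f r :
  (forall n, measurable_fun setT (f_ n)) -> measurable_fun setT f ->
  mu.-integrable setT (EFin \o r) -> (forall n x, `|f_ n x| <= r x) ->
  (forall x, f_ n x @[n --> \oo] --> f x) ->
  \int[mu]_x f_ n x @[n --> \oo] --> \int[mu]_x f x.
Proof.
move=> mf_ mf ir fr fc.
have mEf_ n : measurable_fun setT (EFin \o f_ n) by exact/measurable_EFinP.
have mEf : measurable_fun setT (EFin \o f) by exact/measurable_EFinP.
have cE : {ae mu, forall x, setT x -> (EFin \o f_ n) x @[n --> \oo] --> (EFin \o f) x}.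
  by apply: aeW => x _; apply: cvg_EFin; [exact: nearW|exact: fc].
have dE : {ae mu, forall x n, setT x -> (`|(EFin \o f_ n) x| <= (EFin \o r) x)%E}.
  by apply: aeW => x n _; rewrite /= lee_fin.
have [intf _ c] := dominated_convergence measurableT mEf_ mEf cE ir dE.
by apply: fine_cvg; rewrite fineK//; exact: integrable_fin_num.
Qed.

(** The majorant of the derivative is required only within distance [1] of [x], so it may depend on
    [x]; [anti_path] relies on this, its bound growing with the time variable. *)
Lemma is_derive_Rintegral (f f' : R -> T -> R) r (x : R) :
  (forall s, measurable_fun setT (f s)) ->
  (forall s, exists2 r' : T -> R, mu.-integrable setT (EFin \o r') &
     forall y, `|f s y| <= r' y) ->
  (forall (s : R) y, is_derive s 1 (f ^~ y) (f' s y)) ->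
  mu.-integrable setT (EFin \o r) -> (forall s y, `|s - x| < 1 -> `|f' s y| <= r y) ->
  is_derive x 1 (fun s => \int[mu]_y f s y) (\int[mu]_y f' x y).
Proof.
move=> mf fd fd' ir fr.
have intf s : mu.-integrable setT (EFin \o f s).
  by have [r' ir' fr'] := fd s; exact: dom_integrable (mf s) ir' fr'.
have Ix : `]x - 1, x + 1[%classic x by rewrite /= in_itv/= ltrBlDr !ltrDl ltr01.
have p1E s y : partial1of2 f s y = f' s y.
  by rewrite /partial1of2 derive1E; have /@derive_val := fd' s y.
have r0 y : 0 <= r y by rewrite (le_trans _ (fr x y _))// subrr normr0.
have ub s y : `]x - 1, x + 1[%classic s -> setT y -> `|partial1of2 f s y| <= r y.
  rewrite p1E /= in_itv/= => sx _; apply: fr.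
  by rewrite ltr_norml; apply/andP; split; lra.
have H1 : forall s y, `]x - 1, x + 1[%classic s -> setT y -> derivable (f ^~ y) s 1.
  by move=> s y _ _; exact: ex_derive.
apply: DeriveDef.
  exact: (derivable_under_integral measurableT Ix (fun s _ => intf s) H1 r0 ir ub).
rewrite -derive1E.
rewrite (differentiation_under_integral measurableT Ix (fun s _ => intf s) H1 r0 ir ub).
by apply: eq_Rintegral => y _; rewrite p1E.
Qed.

End general_measure.

(** * Fubini's theorem under product majorants *)

Section general_fubini.
Context {R : realType} d1 d2 (X : measurableType d1) (Y : measurableType d2).
Variable m1 : {sigma_finite_measure set X -> \bar R}.
Variable m2 : {sigma_finite_measure set Y -> \bar R}.
Implicit Type F : X * Y -> R.

Lemma measurable_Rintegral F : measurable_fun setT F ->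
  measurable_fun setT (fun x => \int[m2]_y F (x, y)).
Proof.
move=> mF.
have mE : measurable_fun setT (EFin \o F) by exact/measurable_EFinP.
apply: (@measurableT_comp _ _ _ _ _ _ (@fine R)) => //.
rewrite (_ : (fun x => _) = (fun x => fubini_F m2 (EFin \o F)^\+ x
    - fubini_F m2 (EFin \o F)^\- x)%E); last first.
  by apply/funext => x; rewrite integral_EFinE /fubini_F; congr (_ - _)%E;
    apply: eq_integral => y _; rewrite ?funeposE ?funenegE.
apply: emeasurable_funB; apply: measurable_fun_fubini_tonelli_F => //.
- exact: measurable_funepos.
- exact: measurable_funeneg.
Qed.

Variables (a : X -> R) (b : Y -> R).
Hypothesis ia : m1.-integrable setT (EFin \o a).
Hypothesis ib : m2.-integrable setT (EFin \o b).

(** A majorant of product form gives integrability on the product and on every single section at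
    once. The sections matter because [Rintegral] takes [fine] of each inner integral. *)
Lemma dom_integrable_prod F : measurable_fun setT F ->
  (forall x y, `|F (x, y)| <= a x * b y) ->
  (m1 \x m2)%E.-integrable setT (EFin \o F).
Proof.
move=> mF Fab; apply/integrable12ltyP; first exact/measurable_EFinP.
have ib' : m2.-integrable setT (EFin \o (fun y => `|b y|)).
  exact: integrable_norm ib.
have ia' : m1.-integrable setT (EFin \o (fun y => `|a y|)).
  exact: integrable_norm ia.
apply: (@le_lt_trans _ _ (\int[m1]_x ((`|a x| * \int[m2]_y `|b y|)%:E))%E).
  apply: ge0_le_integral => //.
  - by move=> x _; exact: integral_ge0.
  - apply: (measurable_fun_fubini_tonelli_F (abse \o (EFin \o F))) => //.
    by apply/measurableT_comp => //; exact/measurable_EFinP.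
    by move=> z /=; rewrite lee_fin.
  - apply/measurable_EFinP; apply: measurable_funM => //.
    by have /measurable_int/measurable_EFinP := ia'.
  move=> x _; rewrite EFinM /Rintegral fineK; last exact: integrable_fin_num.
  rewrite -ge0_integralZl//; last first.
    by apply: measurable_int ib'.
  apply: ge0_le_integral => //.
  - apply: measurableT_comp => //; apply/measurable_EFinP.
    by apply: measurableT_comp => //; exact: measurable_pair1.
  - apply/measurable_EFinP/measurable_funM => //.
    by have /measurable_int/measurable_EFinP := ib'.
  - move=> y _; rewrite /= lee_fin -normrM (le_trans (Fab x y))//.
    exact: ler_norm.
have /integrableP[_] := integrableZr_fin (\int[m2]_y `|b y|) ia'.
apply: le_lt_trans; apply: ge0_le_integral => //.
- move=> x _; rewrite lee_fin mulr_ge0//; exact: Rintegral_ge0.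
- apply/measurable_EFinP/measurable_funM => //.
  by have /measurable_int/measurable_EFinP := ia'.
- do 2 apply/measurableT_comp => //.
  apply/measurable_funM => //.
  by have /measurable_int/measurable_EFinP := ia'.
- by move=> x _; rewrite /= lee_fin ler_norm.
Qed.

Lemma Rfubini1 F : (m1 \x m2)%E.-integrable setT (EFin \o F) ->
  (forall x, m2.-integrable setT (EFin \o (fun y => F (x, y)))) ->
  \int[m1]_x \int[m2]_y F (x, y) = \int[(m1 \x m2)%E]_z F z.
Proof.
move=> iF iFx; congr fine; rewrite -(integral12_prod_meas1 iF).
by apply: eq_integral => x _; rewrite fineK//; exact: integrable_fin_num (iFx x).
Qed.

Lemma Rfubini2 F : (m1 \x m2)%E.-integrable setT (EFin \o F) ->
  (forall y, m1.-integrable setT (EFin \o (fun x => F (x, y)))) ->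
  \int[m2]_y \int[m1]_x F (x, y) = \int[(m1 \x m2)%E]_z F z.
Proof.
move=> iF iFx; congr fine; rewrite -(integral21_prod_meas1 iF).
by apply: eq_integral => x _; rewrite fineK//; exact: integrable_fin_num (iFx x).
Qed.

Lemma dom_Rfubini1 F : measurable_fun setT F ->
  (forall x y, `|F (x, y)| <= a x * b y) ->
  \int[m1]_x \int[m2]_y F (x, y) = \int[(m1 \x m2)%E]_z F z.
Proof.
move=> mF Fab; apply: Rfubini1 => [|x]; first exact: dom_integrable_prod.
apply: (dom_integrable _ (integrableZ_fin (a x) ib)) => //.
by apply: measurableT_comp => //; exact: measurable_pair1.
Qed.

Lemma dom_Rfubini2 F : measurable_fun setT F ->
  (forall x y, `|F (x, y)| <= a x * b y) ->
  \int[m2]_y \int[m1]_x F (x, y) = \int[(m1 \x m2)%E]_z F z.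
Proof.
move=> mF Fab; apply: Rfubini2 => [|y]; first exact: dom_integrable_prod.
apply: (dom_integrable _ (integrableZr_fin (b y) ia)) => //.
by apply: measurableT_comp => //; exact: measurable_pair2.
Qed.

Lemma dom_Rfubini F : measurable_fun setT F ->
  (forall x y, `|F (x, y)| <= a x * b y) ->
  \int[m1]_x \int[m2]_y F (x, y) = \int[m2]_y \int[m1]_x F (x, y).
Proof. by move=> mF Fab; rewrite dom_Rfubini1// dom_Rfubini2. Qed.

End general_fubini.

(** * The real line *)

Section real_line.
Context {R : realType}.
Implicit Types (f g S : R -> R) (x a b c : R).
Local Notation leb := (@lebesgue_measure R).

(** The basic majorant: its primitive is [atan], its integral is [pi], and its inverse is the factor
    that a double integration by parts produces. *)
Definition rho x : R := (oneDsqr x)^-1.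

Lemma rhoE x : rho x = (1 + x ^+ 2)^-1. Proof. by []. Qed.

Lemma oneDsqr_gt0 x : 0 < oneDsqr x.
Proof. by rewrite (lt_le_trans ltr01)// oneDsqr_ge1. Qed.

Lemma rho_gt0 x : 0 < rho x.
Proof. by rewrite invr_gt0 oneDsqr_gt0. Qed.

Lemma rho_ge0 x : 0 <= rho x. Proof. exact/ltW/rho_gt0. Qed.

Lemma rho_le1 x : rho x <= 1.
Proof. exact: oneDsqrV_le1. Qed.

Lemma rho_opp x : rho (- x) = rho x. Proof. by rewrite !rhoE sqrrN. Qed.

Lemma oneDsqrK x : (1 + x ^+ 2) * rho x = 1.
Proof. by have := oneDsqr_gt0 x; rewrite rhoE /oneDsqr => /lt0r_neq0 /divff. Qed.

Lemma continuous_rho : continuous rho.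
Proof. exact: continuous_oneDsqrV. Qed.

Lemma measurable_rho : measurable_fun setT rho.
Proof. by apply: continuous_measurable_fun; exact: continuous_rho. Qed.

Lemma is_derive_mul f g x a b : is_derive x 1 f a -> is_derive x 1 g b ->
  is_derive x 1 (fun x => f x * g x) (a * g x + f x * b).
Proof.
move=> df dg; apply: (is_derive_eq (is_deriveM df dg)).
by rewrite /GRing.scale/= addrC (mulrC (g x)).
Qed.

Lemma is_derive_affine f x a b (d : R) : is_derive (a + b * x) 1 f d ->
  is_derive x 1 (fun x => f (a + b * x)) (b * d).
Proof.
move=> df; have da : is_derive x 1 (fun x => a + b * x) b.
  have := is_deriveD (is_derive_cst a x 1) (is_deriveZ b (is_derive_id x 1)).
  by rewrite add0r /GRing.scale/= mulr1.
have := @is_derive1_comp _ f (fun x => a + b * x) x d b df da.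
by rewrite mulrC.
Qed.

Lemma is_derive_continuous f (f' : R -> R) : (forall x, is_derive x 1 f (f' x)) ->
  continuous f.
Proof.
by move=> df x; apply: differentiable_continuous; exact/derivable1_diffP/ex_derive.
Qed.

Lemma integrable_half_rho : leb.-integrable `[0, +oo[ (EFin \o rho).
Proof.
apply/integrableP; split.
  by apply/measurable_EFinP/measurable_funTS; exact: measurable_rho.
under eq_integral do rewrite gee0_abs ?lee_fin ?rho_ge0//.
by rewrite integral0y_oneDsqr ltry.
Qed.

Lemma FTC_half S (S' : R -> R) (C l : R) : (forall x, is_derive x 1 S (S' x)) ->
  continuous S' -> (forall x, `|S' x| <= C * rho x) -> S x @[x --> +oo] --> l ->
  \int[leb]_(x in `[0, +oo[) S' x = l - S 0.
Proof.
move=> dS cS' S'C Sl.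
have iC : leb.-integrable `[0, +oo[ (EFin \o (fun x => C * rho x)).
  by apply: (integrableZl _ C integrable_half_rho).
have iS' : leb.-integrable `[0, +oo[ (EFin \o S').
  apply: (le_integrable _ _ _ iC) => //.
    by apply/measurable_EFinP/measurable_funTS; apply: continuous_measurable_fun.
  by move=> x _ /=; rewrite lee_fin (le_trans (S'C x))// ler_norm.
(* Adding [C * rho], the derivative of [C * atan], makes the integrand nonnegative, as
   [ge0_continuous_FTC2y] requires; the surplus [C * (pi / 2)] is subtracted again at the end. *)
pose F x := S x + C * atan x.
have dF x : is_derive x 1 F (S' x + C * rho x).
  exact: (is_deriveD (dS x) (is_deriveZ C (is_derive1_atan x))).
have cSC : continuous (fun x => S' x + C * rho x).
  move=> x; apply: cvgD; first exact: cS'.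
  by apply: cvgM; [exact: cvg_cst|exact: continuous_rho].
have E : (\int[leb]_(x in `[0%R, +oo[) (S' x + C * rho x)%:E =
    (l + C * (pi / 2))%:E - (F 0)%:E)%E.
  apply: ge0_continuous_FTC2y.
  - by move=> x _; have := S'C x; rewrite ler_norml => /andP[]; lra.
  - exact: continuous_subspaceT.
  - by apply: cvgD => //; apply: cvgM; [exact: cvg_cst|exact: cvgy_atan].
  - by move=> x _; exact: ex_derive.
  - apply: cvg_at_right_filter; exact: (is_derive_continuous dF).
  - by move=> x _; rewrite derive1E; apply: derive_val.
have E2 : \int[leb]_(x in `[0%R, +oo[) (S' x + C * rho x) = l + C * (pi / 2) - F 0.
  by rewrite /Rintegral E.
move: E2; rewrite RintegralD// RintegralZl//; last exact: integrable_half_rho.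
have -> : \int[leb]_(x in `[0%R, +oo[) rho x = pi / 2.
  by rewrite /Rintegral integral0y_oneDsqr.
by rewrite /F atan0 mulr0; lra.
Qed.

Lemma measurable_affine a b :
  measurable_fun [set: measurableTypeR R]
    ((fun x => a * x + b) : measurableTypeR R -> measurableTypeR R).
Proof. by apply: measurable_funD => //; exact: measurable_funM. Qed.

(** By uniqueness of Lebesgue measure: the right-hand side is a scaled image measure, and it has the
    correct value on half-open intervals. *)
Lemma lebesgue_affine a b (A : set R) : a != 0 -> measurable A ->
  (leb A = `|a|%:E * leb ((fun x => a * x + b)%R @^-1` A))%E.
Proof.
move=> a0 mA.
have mphi := measurable_affine a b.
pose phi (x : measurableTypeR R) : measurableTypeR R := a * x + b.
pose pm := measure_function_pushforward__canonical__measure_function_Measure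
  leb mphi.
have a_ge0 : 0 <= `|a| by [].
pose m' := mscale (NngNum a_ge0) pm.
transitivity (m' A); last by [].
apply: lebesgue_measure_unique => // _ [[c d] _ <-] /=.
rewrite /m' /mscale/= /pushforward.
have [cd|dc] := ltP c d; last first.
  by rewrite set_itv_ge ?bnd_simp -?leNgt// preimage_set0 !measure0 mule0.
rewrite lebesgue_measure_itv/= lte_fin cd.
have an0 : `|a| != 0 by rewrite normr_eq0.
have [agt|alt|] := ltgtP 0 a; last by move=> e; rewrite -e eqxx in a0.
- have -> : phi @^-1` `]c, d] = `](c - b) / a, (d - b) / a]%classic.
    apply/seteqP; split => x; rewrite /phi /= !in_itv/= ltr_pdivrMr// ler_pdivlMr//;
    by move=> /andP[? ?]; apply/andP; split; lra.
  rewrite lebesgue_measure_itv/= lte_fin ltr_pM2r ?invr_gt0// ltrD2r cd.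
  by rewrite -EFinD -EFinM gtr0_norm//; congr _%:E; field.
- have -> : phi @^-1` `]c, d] = `[(d - b) / a, (c - b) / a[%classic.
    apply/seteqP; split => x; rewrite /phi /= !in_itv/= ltr_ndivlMr// ler_ndivrMr//;
    by move=> /andP[? ?]; apply/andP; split; lra.
  rewrite lebesgue_measure_itv/= lte_fin ltr_nM2r ?invr_lt0// ltrD2r cd.
  by rewrite -EFinD -EFinM ltr0_norm//; congr _%:E; field.
Qed.

Lemma ge0_integral_affine a b (f : R -> \bar R) : a != 0 ->
  measurable_fun setT f -> (forall x, 0 <= f x)%E ->
  (\int[leb]_x f x = `|a|%:E * \int[leb]_x f (a * x + b)%R)%E.
Proof.
move=> a0 mf f0.
have mphi := measurable_affine a b.
pose phi (x : measurableTypeR R) : measurableTypeR R := a * x + b.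
pose pm := measure_function_pushforward__canonical__measure_function_Measure
  leb mphi.
have a_ge0 : 0 <= `|a| by [].
have -> : (\int[leb]_x f x = \int[mscale (NngNum a_ge0) pm]_x f x)%E.
  by apply: eq_measure_integral => A mA _; exact: (lebesgue_affine b a0 mA).
rewrite ge0_integral_mscale//.
by congr (_ * _)%E; rewrite (ge0_integral_pushforward mphi)//.
Qed.

Lemma integrable_affine a b f : a != 0 -> leb.-integrable setT (EFin \o f) ->
  leb.-integrable setT (EFin \o (fun x => f (a * x + b))).
Proof.
move=> a0 /integrableP[mf]; rewrite (ge0_integral_affine b a0)//; last first.
  exact: measurableT_comp.
move=> foo; apply/integrableP; split.
  apply/measurable_EFinP; apply: measurableT_comp; first exact/measurable_EFinP.
  exact: measurable_affine.
move: foo; rewrite -ge0_fin_numE; last first.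
  by rewrite mule_ge0// ?lee_fin//; exact: integral_ge0.
move=> h; rewrite -ge0_fin_numE; last exact: integral_ge0.
move: h; set I := (\int[_]_x _)%E => h.
have I0 : (0 <= I)%E by exact: integral_ge0.
rewrite ge0_fin_numE// ltey; apply/eqP => Ioo; move: h.
by rewrite Ioo gt0_muley// lte_fin normr_gt0.
Qed.

Lemma Rintegral_affine a b f : a != 0 -> leb.-integrable setT (EFin \o f) ->
  \int[leb]_x f x = `|a| * \int[leb]_x f (a * x + b).
Proof.
move=> a0 if_; have if' := integrable_affine b a0 if_.
have mEf : measurable_fun setT (EFin \o f) by exact: measurable_int if_.
have fp := integrable_fin_num measurableT (integrable_funepos measurableT if').
have fm := integrable_fin_num measurableT (integrable_funeneg measurableT if').
have EP : (\int[leb]_x (EFin \o f)^\+ x =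
    `|a|%:E * \int[leb]_x (EFin \o (fun x => f (a * x + b)%R))^\+ x)%E.
  rewrite (ge0_integral_affine b a0); [|exact: measurable_funepos|by []].
  by congr (_ * _)%E; apply: eq_integral => x _; rewrite !funeposE.
have EN : (\int[leb]_x (EFin \o f)^\- x =
    `|a|%:E * \int[leb]_x (EFin \o (fun x => f (a * x + b)%R))^\- x)%E.
  rewrite (ge0_integral_affine b a0); [|exact: measurable_funeneg|by []].
  by congr (_ * _)%E; apply: eq_integral => x _; rewrite !funenegE.
rewrite /Rintegral !integral_EFinE EP EN.
rewrite -muleBr//; last by apply: fin_num_adde_defl; rewrite fin_numN.
by rewrite fineM// fin_numB fp fm.
Qed.

Lemma Rintegral_oppr f : leb.-integrable setT (EFin \o f) ->
  \int[leb]_x f x = \int[leb]_x f (- x).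
Proof.
move=> if_; rewrite (@Rintegral_affine (-1) 0)//.
by rewrite normrN1 mul1r; apply: eq_Rintegral => x _; rewrite addr0 mulN1r.
Qed.

Lemma rho_integrable : leb.-integrable setT (EFin \o rho).
Proof.
apply/integrableP; split; first by apply/measurable_EFinP; exact: measurable_rho.
under eq_integral do rewrite gee0_abs ?lee_fin ?rho_ge0//.
rewrite ge0_symfun_integralT//=.
- by rewrite -set_itvcy integral0y_oneDsqr -EFinM ltry.
- exact: rho_ge0.
- exact: continuous_rho.
- by move=> x /=; rewrite rho_opp.
Qed.

Lemma Rintegral_split f : leb.-integrable setT (EFin \o f) ->
  \int[leb]_x f x =
  \int[leb]_(x in `[0, +oo[) f x + \int[leb]_(x in `[0, +oo[) f (- x).
Proof.
move=> if_.
have ioo : leb.-integrable setT (EFin \o (f \_ `[0, +oo[)).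
  rewrite -restrict_EFin; apply/integrable_restrict => //=.
  by rewrite setTI; apply: integrableS if_.
have noo : leb.-integrable setT (EFin \o (f \_ `]-oo, 0[)).
  rewrite -restrict_EFin; apply/integrable_restrict => //=.
  by rewrite setTI; apply: integrableS if_.
have -> : \int[leb]_x f x = \int[leb]_x ((f \_ `[0, +oo[) x + (f \_ `]-oo, 0[) x).
  apply: eq_Rintegral => x _; rewrite !patchE !mem_setE !in_itv/= andbT.
  by case: ltP => _; rewrite ?addr0 ?add0r.
rewrite RintegralD// -!Rintegral_mkcond; congr (_ + _).
rewrite Rintegral_mkcond Rintegral_oppr//.
have -> : \int[leb]_x (f \_ `]-oo, 0[) (- x) = \int[leb]_(x in `]0, +oo[) f (- x).
  rewrite [RHS]Rintegral_mkcond; apply: eq_Rintegral => x _.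
  by rewrite !patchE !mem_setE !in_itv/= andbT oppr_lt0.
rewrite Rintegral_itv_obnd_cbnd//.
have : leb.-integrable setT (EFin \o (fun x => f (-1 * x + 0))).
  by apply: integrable_affine; rewrite ?oppr_eq0 ?oner_eq0.
move=> h; apply: (@integrableS _ _ _ _ setT) => //.
by under eq_fun do rewrite -[- _]addr0 -mulN1r.
Qed.

Lemma rho_integral : \int[leb]_x rho x = pi.
Proof.
rewrite Rintegral_split; last exact: rho_integrable.
under [X in _ + X]eq_Rintegral do rewrite rho_opp.
by rewrite /Rintegral integral0y_oneDsqr/=; field.
Qed.

Lemma integrable_rhoC (C : R) : leb.-integrable setT (EFin \o (fun x => C * rho x)).
Proof. by apply: (integrableZl _ C rho_integrable). Qed.

Lemma dom_rho_integrable f (C : R) : measurable_fun [set: measurableTypeR R] f ->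
  (forall x, `|f x| <= C * rho x) -> leb.-integrable setT (EFin \o f).
Proof. by move=> mf fC; exact: dom_integrable mf (integrable_rhoC C) fC. Qed.

Lemma dom_rho_integral f (C : R) : measurable_fun [set: measurableTypeR R] f ->
  (forall x, `|f x| <= C * rho x) -> `|\int[leb]_x f x| <= C * pi.
Proof.
move=> mf fC; rewrite -rho_integral -RintegralZl//; last exact: rho_integrable.
exact: le_dom_Rintegral mf (integrable_rhoC C) fC.
Qed.

Lemma cvg_rho (C : R) : C * rho x @[x --> +oo] --> (0 : R).
Proof.
rewrite -[X in _ --> X](mulr0 C); apply: cvgM; first exact: cvg_cst.
have : (1 + x ^+ 2) @[x --> +oo] --> (+oo : set_system R).
  apply/cvgryPge => A; near=> x; have x1 : 1 <= x by [].
  have xA : A <= x by [].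
  by rewrite (le_trans xA)// ler_wpDl// expr2 ler_peMr// (le_trans _ x1).
by move/gtr0_cvgV0; apply; near=> x; exact: oneDsqr_gt0.
Unshelve. all: by end_near. Qed.

(** The half-lines are kept apart because the ray integral weighs them with opposite signs: its
    integrand contains [|c|] where the derivative of [S] contains [c], so the boundary terms at [0]
    add up there instead of cancelling. *)
Lemma FTC_sg S (S' : R -> R) (C D : R) : (forall x, is_derive x 1 S (S' x)) ->
  continuous S' -> (forall x, `|S' x| <= C * rho x) ->
  (forall x, `|S x| <= D * rho x) ->
  \int[leb]_(x in `[0, +oo[) S' x = - S 0 /\ \int[leb]_(x in `[0, +oo[) S' (- x) = S 0.
Proof.
move=> dS cS' S'C SD.
have S0 : S x @[x --> +oo] --> (0 : R).
  apply: norm_cvg0; apply: (@squeeze_cvgr _ _ _ _ (cst 0) (fun x => D * rho x)).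
  - by near=> x; rewrite normr_ge0 SD.
  - exact: cvg_cst.
  - exact: cvg_rho.
have SN0 : S (- x) @[x --> +oo] --> (0 : R).
  apply: norm_cvg0; apply: (@squeeze_cvgr _ _ _ _ (cst 0) (fun x => D * rho x)).
  - by near=> x; rewrite normr_ge0 -rho_opp SD.
  - exact: cvg_cst.
  - exact: cvg_rho.
split; first by rewrite (FTC_half dS cS' S'C S0) sub0r.
have dN x : is_derive x 1 (fun x => - S (- x)) (S' (- x)).
  have d1 : is_derive (0 + -1 * x) 1 S (S' (- x)) by rewrite add0r mulN1r.
  have /is_deriveN := is_derive_affine d1; rewrite mulN1r opprK.
  by under [X in is_derive _ _ X]eq_fun do rewrite add0r mulN1r.
rewrite (@FTC_half (fun x => - S (- x)) (fun x => S' (- x)) C 0) ?oppr0 ?sub0r ?opprK//.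
- by move=> x; apply: continuous_comp; [exact: opp_continuous|exact: cS'].
- by move=> x; rewrite -rho_opp.
- by rewrite -oppr0; exact: cvgN.
Unshelve. all: by end_near. Qed.

Lemma Rintegral_derive0 S (S' : R -> R) (C D : R) :
  (forall x, is_derive x 1 S (S' x)) -> continuous S' ->
  (forall x, `|S' x| <= C * rho x) -> (forall x, `|S x| <= D * rho x) ->
  \int[leb]_x S' x = 0.
Proof.
move=> dS cS' S'C SD.
have [h1 h2] := FTC_sg dS cS' S'C SD.
rewrite Rintegral_split ?h1 ?h2 ?addNr//.
by apply: (dom_rho_integrable _ S'C); apply: continuous_measurable_fun.
Qed.

End real_line.

(** * The space C^n, one complex coordinate at a time *)

Notation W R n := (n.-tuple (measurableTypeR R) * n.-tuple (measurableTypeR R))%type.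

Section phase_space.
Context {R : realType}.
Local Notation leb := (@lebesgue_measure R).
Local Notation RR := (measurableTypeR R).

Definition lebesgue_plane : set (RR * RR)%type -> \bar R := (leb \x leb)%E.
HB.instance Definition _ := Measure.copy lebesgue_plane (leb \x leb)%E.
HB.instance Definition _ := Measure_isSigmaFinite.Build _ _ _ lebesgue_plane
  (sigma_finite_prod leb leb).

Definition pcons n (x : RR * RR) (w : W R n) : W R n.+1 :=
  (Rn_cons (x.1, w.1), Rn_cons (x.2, w.2)).

Definition updT n (t : n.-tuple RR) (i : 'I_n) (s : R) : n.-tuple RR :=
  [tuple if k == i then s else tnth t k | k < n].

(* Coordinates of [W R n] are indexed by [bool * 'I_n]: [(false, i)] is the real
   part and [(true, i)] the imaginary part of the [i]-th complex coordinate. *)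
Definition upd n (w : W R n) (j : bool * 'I_n) (s : R) : W R n :=
  if j.1 then (w.1, updT w.2 j.2 s) else (updT w.1 j.2 s, w.2).

Definition crd n (w : W R n) (j : bool * 'I_n) : R :=
  tnth (if j.1 then w.2 else w.1) j.2.

Lemma tnth_updT n (t : n.-tuple RR) i s k :
  tnth (updT t i s) k = if k == i then s else tnth t k.
Proof. by rewrite tnth_mktuple. Qed.

Lemma crd_upd n (w : W R n) j s k : crd (upd w j s) k = if k == j then s else crd w k.
Proof.
case: j k => [[] j] [[] k]; rewrite /crd/= ?tnth_updT ?xpair_eqE//=.
Qed.

Lemma eq_crd n (w w' : W R n) : (forall k, crd w k = crd w' k) -> w = w'.
Proof.
case: w w' => [a b] [a' b'] h; congr pair; apply: eq_from_tnth => k.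
  exact: (h (false, k)).
exact: (h (true, k)).
Qed.

Lemma crd_pcons0 n x (w : W R n) b : crd (pcons x w) (b, ord0) = if b then x.2 else x.1.
Proof. by case: b; rewrite /crd/= tnth0. Qed.

Lemma crd_pconsS n x (w : W R n) b i :
  crd (pcons x w) (b, lift ord0 i) = crd w (b, i).
Proof. by case: b; rewrite /crd/= tnthS. Qed.

Lemma upd_pcons0 n x (w : W R n) b s :
  upd (pcons x w) (b, ord0) s = pcons (if b then (x.1, s) else (s, x.2)) w.
Proof.
apply: eq_crd => -[b' k]; rewrite crd_upd.
case: (unliftP ord0 k) => [i|] ->.
  by rewrite !crd_pconsS xpair_eqE [lift _ _ == _]eq_sym (negPf (neq_lift _ _)) andbF.
by rewrite !crd_pcons0 xpair_eqE eqxx andbT; case: b b' => -[].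
Qed.

Lemma upd_pconsS n x (w : W R n) b i s :
  upd (pcons x w) (b, lift ord0 i) s = pcons x (upd w (b, i) s).
Proof.
apply: eq_crd => -[b' k]; rewrite crd_upd.
case: (unliftP ord0 k) => [i'|] ->.
  by rewrite !crd_pconsS crd_upd !xpair_eqE (inj_eq lift_inj).
by rewrite !crd_pcons0 xpair_eqE (negPf (neq_lift _ _)) andbF.
Qed.

Lemma pcons_surj n (w : W R n.+1) : exists x w', w = pcons x w'.
Proof.
exists (crd w (false, ord0), crd w (true, ord0)).
exists ([tuple of behead w.1], [tuple of behead w.2]).
case: w => a b; case/tupleP: a => x a; case/tupleP: b => y b.
by congr pair; apply: val_inj.
Qed.

Lemma W0 (w w' : W R 0) : w = w'.
Proof. by apply: eq_crd => -[b i]; case: i. Qed.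

Definition rho2 (x : RR * RR) : R := rho x.1 * rho x.2.

Definition rhoW n (w : W R n) : R := \prod_(i < n) (rho (crd w (false, i)) * rho (crd w (true, i))).

Lemma rho2_gt0 x : 0 < rho2 x. Proof. by rewrite mulr_gt0 ?rho_gt0. Qed.
Lemma rho2_ge0 x : 0 <= rho2 x. Proof. exact/ltW/rho2_gt0. Qed.
Lemma rho2_le1 x : rho2 x <= 1.
Proof. by rewrite mulr_ile1 ?rho_ge0 ?rho_le1. Qed.

Lemma rhoW_gt0 n (w : W R n) : 0 < rhoW w.
Proof. by apply: prodr_gt0 => i _; rewrite mulr_gt0 ?rho_gt0. Qed.
Lemma rhoW_ge0 n (w : W R n) : 0 <= rhoW w. Proof. exact/ltW/rhoW_gt0. Qed.

Lemma rhoW_pcons n x (w : W R n) : rhoW (pcons x w) = rho2 x * rhoW w.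
Proof.
rewrite /rhoW big_ord_recl; congr (_ * _).
by apply: eq_bigr => i _; rewrite !crd_pconsS.
Qed.

Lemma measurable_rho2 : measurable_fun setT rho2.
Proof.
by apply: measurable_funM; apply: measurableT_comp => //; exact: measurable_rho.
Qed.

Lemma measurable_crd n j : measurable_fun setT (fun w : W R n => crd w j : RR).
Proof. by case: j => -[] i; apply: (measurableT_comp (measurable_tnth i)). Qed.

Lemma measurable_rhoW n : measurable_fun setT (@rhoW n).
Proof.
by apply: measurable_prod => i _; apply: measurable_funM;
  exact: (measurableT_comp measurable_rho (measurable_crd _)).
Qed.

Lemma measurable_pcons n :
  measurable_fun setT (fun p : W R n * (RR * RR) => pcons p.2 p.1 : W R n.+1).
Proof.
apply/measurable_fun_pairP; split.
  apply: (measurable_cons (f := fun p : W R n * (RR * RR) => p.2.1)).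
    exact: (measurableT_comp measurable_fst measurable_snd).
  exact: (measurableT_comp measurable_fst measurable_fst).
apply: (measurable_cons (f := fun p : W R n * (RR * RR) => p.2.2)).
  exact: (measurableT_comp measurable_snd measurable_snd).
exact: (measurableT_comp measurable_snd measurable_fst).
Qed.

Lemma ge0_integral_Rn n (f : n.+1.-tuple RR -> \bar R) :
  measurable_fun setT f -> (forall x, 0 <= f x)%E ->
  (\int[lebesgue_Rn R n.+1]_t f t =
   \int[lebesgue_Rn R n]_t \int[leb]_x f (Rn_cons (x, t)))%E.
Proof.
move=> mf f0; rewrite [LHS](ge0_integral_pushforward (measurable_Rn_cons (n := n)))//.
rewrite preimage_setT (fubini_tonelli2 (f \o @Rn_cons R n))//.
  by apply: measurableT_comp => //; exact: measurable_Rn_cons.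
by move=> x; exact: f0.
Qed.

(** [lebesgue_Cn] places all real parts before all imaginary parts. Peeling off one complex
    coordinate is therefore a reordering of four iterated integrals, in which Tonelli moves the
    first real part [x] past the remaining imaginary parts [t2]. *)
Lemma ge0_integral_W n (F : W R n.+1 -> \bar R) :
  measurable_fun setT F -> (forall w, 0 <= F w)%E ->
  (\int[lebesgue_Cn R n.+1]_w F w =
   \int[(lebesgue_Cn R n \x lebesgue_plane)%E]_p F (pcons p.2 p.1))%E.
Proof.
move=> mF F0.
rewrite [LHS](fubini_tonelli1 (m1 := lebesgue_Rn R n.+1) (m2 := lebesgue_Rn R n.+1))//.
rewrite ge0_integral_Rn; last 2 first.
- exact: measurable_fun_fubini_tonelli_F.
- by move=> x; exact: integral_ge0.
transitivity (\int[lebesgue_Rn R n]_t1 \int[leb]_x \int[lebesgue_Rn R n]_t2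
   \int[leb]_y F (Rn_cons (x, t1), Rn_cons (y, t2)))%E.
  apply: eq_integral => t1 _; apply: eq_integral => x _.
  rewrite /fubini_F ge0_integral_Rn//.
  by apply: measurableT_comp => //; exact: measurable_pair1.
have mF' := measurableT_comp mF (measurable_pcons (n := n)).
have F0' p : (0 <= (F \o (fun p : W R n * (RR * RR) => pcons p.2 p.1)) p)%E by exact: F0.
rewrite [RHS](fubini_tonelli1 _ mF' F0').
rewrite [RHS](fubini_tonelli1 (m1 := lebesgue_Rn R n) (m2 := lebesgue_Rn R n))/=; last 2 first.
- exact: measurable_fun_fubini_tonelli_F mF' F0'.
- by move=> x; exact: integral_ge0.
apply: eq_integral => t1 _.
transitivity (\int[lebesgue_Rn R n]_t2 \int[leb]_x
   \int[leb]_y F (Rn_cons (x, t1), Rn_cons (y, t2)))%E.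
  apply: (fubini_tonelli (m1 := leb) (m2 := lebesgue_Rn R n) (fun p =>
    \int[leb]_y F (Rn_cons (p.1, t1), Rn_cons (y, p.2)))%E).
    apply: (measurable_fun_fubini_tonelli_F (m2 := leb)
      (fun q : (RR * n.-tuple RR) * RR => F (Rn_cons (q.1.1, t1), Rn_cons (q.2, q.1.2)))) => //.
    apply: measurableT_comp => //; apply/measurable_fun_pairP; split.
      apply: (measurable_cons (f := fun q : (RR * n.-tuple RR) * RR => q.1.1)
        (g := cst t1)) => //.
      exact: (measurableT_comp measurable_fst measurable_fst).
    apply: (measurable_cons (f := fun q : (RR * n.-tuple RR) * RR => q.2)
      (g := fun q : (RR * n.-tuple RR) * RR => q.1.2)) => //.
      exact: measurable_snd.
    exact: (measurableT_comp measurable_snd measurable_fst).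
  by move=> x; exact: integral_ge0.
apply: eq_integral => t2 _; rewrite /fubini_F/=.
rewrite [RHS](fubini_tonelli1 (m1 := leb) (m2 := leb))//.
exact: (measurableT_comp mF' (measurable_pair1 (t1, t2))).
Qed.

End phase_space.

(** * Majorants and iterated integrals on the plane and on C^n *)

Section phase_space_integrals.
Context {R : realType}.
Local Notation leb := (@lebesgue_measure R).
Local Notation RR := (measurableTypeR R).
Local Notation plane := (@lebesgue_plane R).
Local Notation Cn := (lebesgue_Cn R).

Lemma rho2_integrable : plane.-integrable setT (EFin \o (@rho2 R)).
Proof.
apply: (dom_integrable_prod (m1 := leb) (m2 := leb) rho_integrable rho_integrable).
  exact: measurable_rho2.
by move=> x y; rewrite ger0_norm// rho2_ge0.
Qed.

Lemma plane_fubini1 (F : RR * RR -> R) C : measurable_fun setT F ->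
  (forall x, `|F x| <= C * rho2 x) ->
  \int[plane]_x F x = \int[leb]_a \int[leb]_b F (a, b).
Proof.
move=> mF FC.
rewrite (dom_Rfubini1 (m1 := leb) (m2 := leb) (integrable_rhoC C) rho_integrable)//.
by move=> x y; rewrite -mulrA; exact: (FC (x, y)).
Qed.

Lemma plane_fubini2 (F : RR * RR -> R) C : measurable_fun setT F ->
  (forall x, `|F x| <= C * rho2 x) ->
  \int[plane]_x F x = \int[leb]_b \int[leb]_a F (a, b).
Proof.
move=> mF FC.
rewrite (dom_Rfubini2 (m1 := leb) (m2 := leb) (integrable_rhoC C) rho_integrable)//.
by move=> x y; rewrite -mulrA; exact: (FC (x, y)).
Qed.

Lemma plane_rho2 : \int[plane]_x rho2 x = pi ^+ 2.
Proof.
rewrite (@plane_fubini1 _ 1); last 2 first.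
- exact: measurable_rho2.
- by move=> x; rewrite mul1r ger0_norm// rho2_ge0.
rewrite (_ : (fun _ => _) = fun a => rho a * pi); last first.
  by apply/funext => a; rewrite /rho2/= RintegralZl ?rho_integral//; exact: rho_integrable.
by rewrite RintegralZr ?rho_integral//; exact: rho_integrable.
Qed.

Lemma rhoW_integrable n : (Cn n).-integrable setT (EFin \o (@rhoW R n)).
Proof.
have ge0 m (w : W R m) : (0 <= (rhoW w)%:E)%E by rewrite lee_fin rhoW_ge0.
suff [c E] : exists c : R, (\int[Cn n]_w (rhoW w)%:E = c%:E)%E.
  apply/integrableP; split; first by apply/measurable_EFinP; exact: measurable_rhoW.
  rewrite (eq_integral (fun w : W R n => (rhoW w)%:E)) ?E ?ltry//.
  by move=> w _; rewrite [LHS]gee0_abs//; exact: ge0.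
elim: n => [|n [c IHn]].
  exists 1.
  rewrite (eq_integral (cst 1%:E)); last by move=> w _; rewrite /rhoW big_ord0.
  rewrite integral_cst// mul1e -setXTT.
  rewrite [LHS](product_measure1E (lebesgue_Rn R 0) (lebesgue_Rn R 0))//.
  by rewrite /= !diracT mule1.
exists (c * pi ^+ 2).
rewrite ge0_integral_W//; last first.
  by apply/measurable_EFinP; exact: measurable_rhoW.
have mF : measurable_fun setT (fun p : W R n * (RR * RR) => (rhoW (pcons p.2 p.1))%:E).
  apply/measurable_EFinP.
  by apply: (measurableT_comp (@measurable_rhoW R n.+1) (measurable_pcons (n := n))).
rewrite (fubini_tonelli1 _ mF)// /fubini_F/=.
under eq_integral => w _.
  under eq_integral => x _ do rewrite rhoW_pcons mulrC EFinM.
  rewrite ge0_integralZl//; last 2 first.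
  - by apply/measurable_EFinP; exact: measurable_rho2.
  - by move=> x _; rewrite lee_fin rho2_ge0.
  over.
rewrite ge0_integralZr//; last 2 first.
- by apply/measurable_EFinP; exact: measurable_rhoW.
- by apply: integral_ge0 => x _; rewrite lee_fin rho2_ge0.
rewrite IHn EFinM -plane_rho2 /Rintegral fineK//.
by apply: integrable_fin_num => //; exact: rho2_integrable.
Qed.

Lemma integrable_rhoWC n C : (Cn n).-integrable setT (EFin \o (fun w => C * @rhoW R n w)).
Proof. by apply: integrableZ_fin; exact: rhoW_integrable. Qed.

Lemma Rintegral_W n (F : W R n.+1 -> R) : measurable_fun setT F ->
  \int[Cn n.+1]_w F w = \int[(Cn n \x plane)%E]_p F (pcons p.2 p.1).
Proof.
move=> mF; rewrite /Rintegral !integral_EFinE.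
have mE : measurable_fun setT (EFin \o F) by exact/measurable_EFinP.
rewrite !ge0_integral_W//; [|exact: measurable_funeneg|exact: measurable_funepos].
by congr (fine (_ - _)%E); apply: eq_integral => p _; rewrite ?funeposE ?funenegE.
Qed.

Section peel.
Variables (n : nat) (F : W R n.+1 -> R) (C : R).
Hypothesis mF : measurable_fun setT F.
Hypothesis FC : forall w, `|F w| <= C * rhoW w.

Let mF' : measurable_fun setT (fun p : W R n * (RR * RR) => F (pcons p.2 p.1)).
Proof. exact: (measurableT_comp mF (measurable_pcons (n := n))). Qed.

Let FC' w x : `|F (pcons x w)| <= C * rhoW w * rho2 x.
Proof. by rewrite (le_trans (FC _))// rhoW_pcons -mulrA (mulrC (rhoW w)). Qed.

Lemma peel1 : \int[Cn n.+1]_w F w = \int[Cn n]_w \int[plane]_x F (pcons x w).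
Proof.
rewrite Rintegral_W//.
by rewrite -(dom_Rfubini1 (integrable_rhoWC n C) rho2_integrable mF').
Qed.

Lemma peel2 : \int[Cn n.+1]_w F w = \int[plane]_x \int[Cn n]_w F (pcons x w).
Proof.
rewrite Rintegral_W//.
by rewrite -(dom_Rfubini2 (integrable_rhoWC n C) rho2_integrable mF').
Qed.

End peel.

(** This is how integration by parts reaches C^n: an identity of integrals need only be checked on
    the lines parallel to one axis. Complex coordinates are peeled off until [j] belongs to the
    first one. *)
Lemma Cn_vanish n (F : W R n -> R) C j : measurable_fun setT F ->
  (forall w, `|F w| <= C * rhoW w) ->
  (forall w, \int[leb]_s F (upd w j s) = 0) -> \int[Cn n]_w F w = 0.
Proof.
have int0 d (T : measurableType d) (mu : {measure set T -> \bar R}) (f : T -> R) :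
    (forall x, f x = 0) -> \int[mu]_x f x = 0.
  by move=> f0; rewrite /Rintegral integral0_eq// => x _; rewrite f0.
elim: n F C j => [|n IHn] F C [b i] mF FC F0; first by case: i F0.
case: (unliftP ord0 i) F0 => [k|] -> F0.
  rewrite (peel2 mF FC) int0// => x; apply: (IHn _ (C * rho2 x) (b, k)).
  - apply: (measurableT_comp mF); exact: (measurableT_comp (measurable_pcons (n := n)) (pair2_measurable x)).
  - by move=> w; rewrite (le_trans (FC _))// rhoW_pcons mulrA.
  - by move=> w; rewrite -[RHS](F0 (pcons x w)); apply: eq_Rintegral => s _; rewrite upd_pconsS.
rewrite (peel1 mF FC) int0// => w.
have m : measurable_fun setT (fun x : RR * RR => F (pcons x w)).
  apply: (measurableT_comp mF); exact: (measurableT_comp (measurable_pcons (n := n)) (pair1_measurable w)).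
have B x : `|F (pcons x w)| <= C * rhoW w * rho2 x.
  by rewrite (le_trans (FC _))// rhoW_pcons -mulrA (mulrC (rhoW w)).
case: b F0 => F0.
  rewrite (plane_fubini1 m B) int0// => a.
  rewrite -[RHS](F0 (pcons (a, 0) w)); apply: eq_Rintegral => s _.
  by rewrite upd_pcons0.
rewrite (plane_fubini2 m B) int0// => a.
rewrite -[RHS](F0 (pcons (0, a) w)); apply: eq_Rintegral => s _.
by rewrite upd_pcons0.
Qed.

End phase_space_integrals.

(** * Joint measurability from measurability and continuity in separate variables *)

Section caratheodory.
Context {R : realType} d (X : measurableType d).
Local Notation RR := (measurableTypeR R).

(* [f] is the pointwise limit of its discretisations in the second variable. *)
Lemma measurable_caratheodory (f : X * RR -> R) :
  (forall y, measurable_fun setT (fun x => f (x, y))) ->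
  (forall x, continuous (fun y : R => f (x, y))) ->
  measurable_fun setT f.
Proof.
move=> mf cf.
pose fl (k : nat) (y : R) : R := (Num.floor (y * k.+1%:R))%:~R / k.+1%:R.
apply: (@measurable_fun_cvg _ _ _ _ (fun k p => f (p.1, fl k p.2))) => [k|p _].
  move=> _ B mB; rewrite setTI.
  rewrite (_ : _ @^-1` B = \bigcup_m (fst @^-1` ((fun x => f (x, m%:~R / k.+1%:R)) @^-1` B)
      `&` snd @^-1` `[m%:~R / k.+1%:R, (m + 1)%:~R / k.+1%:R[%classic)); last first.
    have k0 : 0 < k.+1%:R :> R by [].
    apply/seteqP; split => [[x y] /= Bxy|[x y] /= [m _ [Bxy]]].
      exists (Num.floor (y * k.+1%:R)) => //; split => //=.
      by rewrite in_itv/= ler_pdivrMr// ltr_pdivlMr// floor_itv.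
    rewrite /= in_itv/= ler_pdivrMr// ltr_pdivlMr// => /floor_def E.
    by rewrite /= /fl E.
  apply: countable_bigcupT_measurable => // m; apply: measurableI.
    rewrite -[X in measurable X]setTI; apply: measurable_fst => //.
    by rewrite -[X in measurable X]setTI; exact: mf.
  by rewrite -[X in measurable X]setTI; exact: measurable_snd.
case: p => x y /=; apply: (@cvg_comp _ _ _ (fl^~ y) (fun y => f (x, y)) _ (nbhs y)).
  have fly k : `|y - fl k y| <= k.+1%:R^-1.
    have k0 : 0 < k.+1%:R :> R by [].
    have := floor_itv (y * k.+1%:R).
    rewrite -ler_pdivrMr// -ltr_pdivlMr// -/(fl k y) intrD mulrDl mul1r => /andP[h1 h2].
    have h0 : 0 <= y - fl k y by rewrite subr_ge0.
    by rewrite ger0_norm// lerBlDl ltW// -/(fl k y).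
  apply/cvgrPdist_le => e e0; near=> k.
  rewrite (le_trans (fly k))// ltW//; near: k.
  exact: (near_infty_natSinv_lt (PosNum e0)).
exact: cf.
Unshelve. all: by end_near. Qed.

End caratheodory.

(** * Gaussian averages in the plane *)

Section gauss_decay.
Context {R : realType}.
Local Notation leb := (@lebesgue_measure R).
Local Notation RR := (measurableTypeR R).
Local Notation g := (@gauss_fun R).
Implicit Types (q K : R -> R) (x s c M : R).

Definition dgauss x : R := - 2 * x * g x.
Definition d2gauss x : R := (4 * x ^+ 2 - 2) * g x.

Lemma is_derive_gauss x : is_derive x 1 g (dgauss x).
Proof.
have d2 : is_derive x 1 (fun x : R => - x ^+ 2) (- (2 * x)).
  have dxx := is_derive_mul (is_derive_id x 1) (is_derive_id x 1).
  by apply: (is_derive_eq (is_deriveN dxx)); ring.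
have d3 := @is_derive1_comp _ expR (fun x => - x ^+ 2) x _ _ (is_derive_expR _) d2.
apply: (is_derive_eq d3).
by rewrite /dgauss /gauss_fun; ring.
Qed.

Lemma is_derive_dgauss x : is_derive x 1 dgauss (d2gauss x).
Proof.
have d1 : is_derive x 1 (fun x : R => - 2 * x) (-2).
  by apply: (is_derive_eq (is_deriveZ (-2) (is_derive_id x 1))); rewrite /GRing.scale/= mulr1.
apply: (is_derive_eq (is_derive_mul d1 (is_derive_gauss x))).
by rewrite /d2gauss /dgauss; ring.
Qed.

Lemma continuous_d2gauss : continuous d2gauss.
Proof.
have c2 : continuous (fun x : R => 4 * x ^+ 2 - 2).
  by move=> x; apply: cvgB; [apply: cvgM; [exact: cvg_cst|exact: exprn_continuous]|exact: cvg_cst].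
by move=> x; apply: cvgM; [exact: c2|exact: continuous_gauss_fun].
Qed.

Lemma continuous_dgauss : continuous dgauss.
Proof. exact: is_derive_continuous is_derive_dgauss. Qed.

(** With [y = x ^+ 2], [expR y >= (1 + y / 3) ^+ 3], and [27 * (1 + y / 3) ^+ 3 = (3 + y) ^+ 3]
    exceeds [(1 + y) ^+ 3]. The cube leaves room for the polynomial factors of the derivatives. *)
Lemma gauss_fun_rho3 x : g x <= 27 * rho x ^+ 3.
Proof.
have e0 : 1 + x ^+ 2 / 3 <= expR (x ^+ 2 / 3) by exact: expR_ge1Dx.
have e3 : (1 + x ^+ 2 / 3) ^+ 3 <= expR (x ^+ 2).
  have -> : expR (x ^+ 2) = expR (x ^+ 2 / 3) ^+ 3.
    by rewrite -expRM_natr; congr expR; field.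
  by rewrite lerXn2r// nnegrE ?expR_ge0// addr_ge0// divr_ge0// sqr_ge0.
rewrite /gauss_fun expRN rhoE exprVn ler_pdivlMr ?exprn_gt0//; last first.
  by rewrite ltr_pwDl// sqr_ge0.
rewrite ler_pdivrMl ?expR_gt0//.
have x0 : 0 <= x ^+ 2 by exact: sqr_ge0.
move: x0 e3; move: (x ^+ 2) => y y0 e3.
have -> : (1 + y) ^+ 3 = 27 * (1 + y / 3) ^+ 3 - (26 + 24 * y + 6 * y ^+ 2) by field.
have y20 : 0 <= y ^+ 2 by exact: sqr_ge0.
by lra.
Qed.

(** The constant is [6 * 27]: both [g x] and [x ^+ 2 * g x] are at most [27 * rho x], and the worst
    case [d2gauss] is bounded by [(4 * x ^+ 2 + 2) * g x]. *)
Lemma gauss_dom x : [/\ `|g x| <= 162 * rho x, `|dgauss x| <= 162 * rho x &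
  `|d2gauss x| <= 162 * rho x].
Proof.
have r0 := rho_ge0 x; have r1 := rho_le1 x; have g3 := gauss_fun_rho3 x.
have g0 := gauss_fun_ge0 x.
have xr : x ^+ 2 * rho x <= 1 by rewrite -(oneDsqrK x) mulrDl mul1r lerDr.
have r32 : rho x ^+ 3 <= rho x ^+ 2 by rewrite exprS ler_piMl// sqr_ge0.
have r21 : rho x ^+ 2 <= rho x by rewrite expr2 ler_piMl.
have xg : x ^+ 2 * g x <= 27 * rho x.
  rewrite (@le_trans _ _ (x ^+ 2 * (27 * rho x ^+ 3)))// ?ler_wpM2l ?sqr_ge0//.
  have : x ^+ 2 * rho x * rho x ^+ 2 <= rho x ^+ 2 by rewrite ler_piMl// sqr_ge0.
  by rewrite (exprSr (rho x)) exprS => h; nra.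
have ax : 2 * `|x| <= 1 + x ^+ 2.
  by rewrite -(real_normK (num_real x)); have := sqr_ge0 (`|x| - 1); nra.
rewrite !normrM !(ger0_norm g0); split.
- lra.
- rewrite normrN (ger0_norm (ler0n _ 2)).
  have : 2 * `|x| * g x <= (1 + x ^+ 2) * g x by rewrite ler_wpM2r.
  by rewrite mulrDl mul1r; lra.
- have : `|4 * x ^+ 2 - 2| * g x <= (4 * x ^+ 2 + 2) * g x.
    rewrite ler_wpM2r// (le_trans (ler_normB _ _))// !ger0_norm// mulr_ge0//.
    exact: sqr_ge0.
  by lra.
Qed.

Lemma measurable_cont K : continuous K -> measurable_fun [set: RR] K.
Proof. by move=> cK; apply: continuous_measurable_fun. Qed.

Lemma continuous_affine c s : continuous (fun a : R => s + c * a).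
Proof. by move=> a; apply: cvgD; [exact: cvg_cst|apply: cvgM; [exact: cvg_cst|exact: cvg_id]]. Qed.

Lemma continuous_mul_affine q K c s : continuous q -> continuous K ->
  continuous (fun a => q a * K (s + c * a)).
Proof.
move=> cq cK a; apply: cvgM; first exact: cq.
by apply: (@continuous_comp _ _ _ (fun a => s + c * a) K); [exact: continuous_affine|exact: cK].
Qed.

Lemma dom_mul_affine q K (C M : R) c s : (forall a, `|q a| <= C * rho a) ->
  (forall x, `|K x| <= M) -> forall a, `|q a * K (s + c * a)| <= C * M * rho a.
Proof.
move=> qC KM a; rewrite normrM (le_trans (ler_pM _ _ (qC a) (KM _)))//.
by rewrite mulrAC.
Qed.

Lemma integrable_mul_affine q K (C M : R) c s : continuous q -> continuous K ->
  (forall a, `|q a| <= C * rho a) -> (forall x, `|K x| <= M) ->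
  leb.-integrable setT (EFin \o (fun a => q a * K (s + c * a))).
Proof.
move=> cq cK qC KM; apply: (@dom_rho_integrable _ _ (C * M)); last exact: dom_mul_affine.
by apply: measurable_cont; exact: continuous_mul_affine.
Qed.

Lemma ibp (q q' K K' : R -> R) (C M : R) c s :
  (forall x, is_derive x 1 q (q' x)) -> (forall x, is_derive x 1 K (K' x)) ->
  continuous q' -> continuous K' ->
  (forall a, `|q a| <= C * rho a) -> (forall a, `|q' a| <= C * rho a) ->
  (forall x, `|K x| <= M) -> (forall x, `|K' x| <= M) ->
  c * \int[leb]_a (q a * K' (s + c * a)) = - \int[leb]_a (q' a * K (s + c * a)).
Proof.
move=> dq dK cq' cK' qC q'C KM K'M.
have cq := is_derive_continuous dq; have cK := is_derive_continuous dK.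
have i1 := integrable_mul_affine c s cq cK' qC K'M.
have i2 := integrable_mul_affine c s cq' cK q'C KM.
apply/eqP; rewrite -addr_eq0 addrC; apply/eqP.
rewrite -RintegralZl// -RintegralD//; last exact: integrableZ_fin.
apply: (@Rintegral_derive0 _ (fun a => q a * K (s + c * a)) _ (C * M + `|c| * (C * M)) (C * M)).
- move=> a; apply: (is_derive_eq (is_derive_mul (dq a) (is_derive_affine (dK _)))).
  ring.
- move=> a; apply: cvgD; first exact: (continuous_mul_affine cq' cK).
  by apply: cvgM; [exact: cvg_cst|exact: (continuous_mul_affine cq cK')].
- move=> a; rewrite (le_trans (ler_normD _ _))// mulrDl lerD//.
    exact: dom_mul_affine.
  by rewrite normrM -mulrA ler_wpM2l//; exact: dom_mul_affine.
- exact: dom_mul_affine.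
Qed.

(* Two integrations by parts move [c ^+ 2] onto the second derivative of the
   Gaussian, at the price of two antiderivatives of [K0]. *)
Lemma gauss_trick (K0 K1 K2 : R -> R) M c s :
  (forall x, is_derive x 1 K1 (K0 x)) -> (forall x, is_derive x 1 K2 (K1 x)) ->
  continuous K0 -> (forall x, `|K0 x| <= M) -> (forall x, `|K1 x| <= M) ->
  (forall x, `|K2 x| <= M) ->
  (1 + c ^+ 2) * \int[leb]_a (g a * K0 (s + c * a)) =
  \int[leb]_a (g a * K0 (s + c * a)) + \int[leb]_a (d2gauss a * K2 (s + c * a)).
Proof.
move=> d1 d2 cK0 M0 M1 M2.
have cK1 := is_derive_continuous d1.
rewrite mulrDl mul1r; congr (_ + _); rewrite expr2 -mulrA.
rewrite (@ibp _ _ _ _ 162 M _ _ is_derive_gauss d1 continuous_dgauss cK0)//; try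
  by move=> a; have [] := gauss_dom a.
rewrite mulrN (@ibp _ _ _ _ 162 M _ _ is_derive_dgauss d2 continuous_d2gauss cK1)//; try
  by move=> a; have [] := gauss_dom a.
by rewrite opprK.
Qed.

End gauss_decay.

Ltac mfun := repeat first
  [ by [] | exact: measurable_cst | exact: measurable_id
  | exact: measurable_fst | exact: measurable_snd
  | apply: measurable_funD | apply: measurable_funM | apply: measurableT_comp => // ].

(** * Plane waves integrated against Gaussians and their derivatives *)

Section plane_gauss.
Context {R : realType}.
Local Notation leb := (@lebesgue_measure R).
Local Notation RR := (measurableTypeR R).
Local Notation plane := (@lebesgue_plane R).
Local Notation g := (@gauss_fun R).
Implicit Types (q K : R -> R) (x s c M : R).

(** For [p = q = g] this is the Gaussian average [Psi] or [S] of the overview; other weights occur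
    because integrating by parts differentiates the Gaussians. *)
Definition pint (p q K : R -> R) (s c d : R) : R :=
  \int[plane]_y (p y.1 * q y.2 * K (s + c * y.1 + d * y.2)).

Section pint_props.
Variables (p q K : R -> R) (s c d C M : R).
Hypotheses (cp : continuous p) (cq : continuous q) (cK : continuous K).
Hypotheses (pC : forall a, `|p a| <= C * rho a) (qC : forall a, `|q a| <= C * rho a).
Hypothesis KM : forall a, `|K a| <= M.

Lemma measurable_pint :
  measurable_fun setT (fun y : RR * RR => p y.1 * q y.2 * K (s + c * y.1 + d * y.2)).
Proof.
apply: measurable_funM.
  apply: measurable_funM.
    by apply: (measurableT_comp (measurable_cont cp)).
  by apply: (measurableT_comp (measurable_cont cq)).
by apply: (measurableT_comp (measurable_cont cK)); mfun.
Qed.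

Lemma pint_dom (y : RR * RR) :
  `|p y.1 * q y.2 * K (s + c * y.1 + d * y.2)| <= C ^+ 2 * M * rho2 y.
Proof.
rewrite !normrM (le_trans (ler_pM _ _ (ler_pM _ _ (pC _) (qC _)) (KM _)))//.
by rewrite /rho2 le_eqVlt; apply/orP; left; apply/eqP; ring.
Qed.

Lemma pintE1 : pint p q K s c d =
  \int[leb]_b (q b * \int[leb]_a (p a * K (s + d * b + c * a))).
Proof.
rewrite /pint (plane_fubini2 measurable_pint pint_dom); apply: eq_Rintegral => b _.
rewrite -RintegralZl//; last exact: integrable_mul_affine pC KM.
by apply: eq_Rintegral => a _ /=; rewrite (addrAC s (c * a)) mulrCA mulrA.
Qed.

Lemma pintE2 : pint p q K s c d =
  \int[leb]_a (p a * \int[leb]_b (q b * K (s + c * a + d * b))).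
Proof.
rewrite /pint (plane_fubini1 measurable_pint pint_dom); apply: eq_Rintegral => a _.
rewrite -RintegralZl//; last exact: integrable_mul_affine qC KM.
by apply: eq_Rintegral => b _ /=; rewrite mulrA.
Qed.

Lemma pint_bound : `|pint p q K s c d| <= C ^+ 2 * M * pi ^+ 2.
Proof.
rewrite -plane_rho2 -RintegralZl//; last exact: rho2_integrable.
apply: (le_dom_Rintegral measurable_pint) pint_dom.
by apply: integrableZ_fin; exact: rho2_integrable.
Qed.

Lemma integrable_pintE1 : leb.-integrable setT
  (EFin \o (fun b => q b * \int[leb]_a (p a * K (s + d * b + c * a)))).
Proof.
apply: (@dom_rho_integrable _ _ (C * (C * M * pi))).
  apply: measurable_funM; first exact: measurable_cont.
  apply: (measurable_Rintegral leb
    (F := fun y : RR * RR => p y.2 * K (s + d * y.1 + c * y.2))).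
  apply: measurable_funM; first by apply: (measurableT_comp (measurable_cont cp)).
  by apply: (measurableT_comp (measurable_cont cK)); mfun.
move=> b; rewrite normrM mulrAC; apply: ler_pM => //.
apply: dom_rho_integral; last exact: dom_mul_affine.
by apply: measurable_cont; exact: continuous_mul_affine.
Qed.

Lemma integrable_pintE2 : leb.-integrable setT
  (EFin \o (fun a => p a * \int[leb]_b (q b * K (s + c * a + d * b)))).
Proof.
apply: (@dom_rho_integrable _ _ (C * (C * M * pi))).
  apply: measurable_funM; first exact: measurable_cont.
  apply: (measurable_Rintegral leb
    (F := fun y : RR * RR => q y.2 * K (s + c * y.1 + d * y.2))).
  apply: measurable_funM; first by apply: (measurableT_comp (measurable_cont cq)).
  by apply: (measurableT_comp (measurable_cont cK)); mfun.
move=> b; rewrite normrM mulrAC; apply: ler_pM => //.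
apply: dom_rho_integral; last exact: dom_mul_affine.
by apply: measurable_cont; exact: continuous_mul_affine.
Qed.

End pint_props.

Section trick.
Variables (q K0 K1 K2 : R -> R) (s c d M : R).
Hypotheses (cq : continuous q) (qC : forall a, `|q a| <= 162 * rho a).
Hypotheses (d1 : forall x, is_derive x 1 K1 (K0 x)) (d2 : forall x, is_derive x 1 K2 (K1 x)).
Hypotheses (cK0 : continuous K0) (M0 : forall x, `|K0 x| <= M)
  (M1 : forall x, `|K1 x| <= M) (M2 : forall x, `|K2 x| <= M).

Let cg := @continuous_gauss_fun R.
Let cg2 := @continuous_d2gauss R.
Let gC (a : R) : `|g a| <= 162 * rho a. Proof. by have [] := gauss_dom a. Qed.
Let g2C (a : R) : `|d2gauss a| <= 162 * rho a. Proof. by have [] := gauss_dom a. Qed.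
Let cK2 := is_derive_continuous d2.

Lemma pint_trick1 :
  (1 + c ^+ 2) * pint g q K0 s c d = pint g q K0 s c d + pint d2gauss q K2 s c d.
Proof.
rewrite (pintE1 s c d cg cq cK0 gC qC M0) (pintE1 s c d cg2 cq cK2 g2C qC M2).
have i0 := integrable_pintE1 s c d cg cq cK0 gC qC M0.
have i2 := integrable_pintE1 s c d cg2 cq cK2 g2C qC M2.
apply: (etrans (esym (RintegralZl _ _ i0))); first exact: measurableT.
apply: etrans (RintegralD _ i0 i2); last exact: measurableT.
apply: eq_Rintegral => b _.
by rewrite mulrCA (gauss_trick _ _ d1 d2 cK0 M0 M1 M2) mulrDr.
Qed.

Lemma pint_trick2 :
  (1 + d ^+ 2) * pint q g K0 s c d = pint q g K0 s c d + pint q d2gauss K2 s c d.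
Proof.
rewrite (pintE2 s c d cq cg cK0 qC gC M0) (pintE2 s c d cq cg2 cK2 qC g2C M2).
have i0 := integrable_pintE2 s c d cq cg cK0 qC gC M0.
have i2 := integrable_pintE2 s c d cq cg2 cK2 qC g2C M2.
apply: (etrans (esym (RintegralZl _ _ i0))); first exact: measurableT.
apply: etrans (RintegralD _ i0 i2); last exact: measurableT.
apply: eq_Rintegral => b _.
by rewrite mulrCA (gauss_trick _ _ d1 d2 cK0 M0 M1 M2) mulrDr.
Qed.

End trick.

(** [pint_decay] ends with four integrals, each at most [162 ^+ 2 * pi ^+ 2] times the bound on the
    [J i]. *)
Definition gconst : R := 4 * (162 ^+ 2 * pi ^+ 2).

(** Each of the factors [1 + c ^+ 2] and [1 + d ^+ 2] is absorbed at the price of two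
    antiderivatives, which is why bounds up to [J 4] are required. *)
Lemma pint_decay (J : nat -> R -> R) M s c d :
  (forall i x, is_derive x 1 (J i.+1) (J i x)) -> continuous (J 0%N) ->
  (forall i x, (i <= 4)%N -> `|J i x| <= M) ->
  `|pint g g (J 0%N) s c d| <= gconst * M * (rho c * rho d).
Proof.
move=> dJ cJ JM.
have cJi i : continuous (J i) by case: i => [//|i]; exact: is_derive_continuous (dJ i).
have cg := @continuous_gauss_fun R.
have cg2 := @continuous_d2gauss R.
have gC (a : R) : `|g a| <= 162 * rho a by have [] := gauss_dom a.
have g2C (a : R) : `|d2gauss a| <= 162 * rho a by have [] := gauss_dom a.
have E : (1 + d ^+ 2) * ((1 + c ^+ 2) * pint g g (J 0%N) s c d) =
    pint g g (J 0%N) s c d + pint g d2gauss (J 2%N) s c d +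
    (pint d2gauss g (J 2%N) s c d + pint d2gauss d2gauss (J 4%N) s c d).
  rewrite (@pint_trick1 g _ _ _ _ _ _ M cg gC (dJ 0%N) (dJ 1%N))//; try by move=> x; exact: JM.
  rewrite mulrDr (@pint_trick2 g _ _ _ _ _ _ M cg gC (dJ 0%N) (dJ 1%N))//;
    try by move=> x; exact: JM.
  by rewrite (@pint_trick2 d2gauss _ _ _ _ _ _ M cg2 g2C (dJ 2%N) (dJ 3%N))//;
    move=> x; exact: JM.
have B : `|(1 + d ^+ 2) * ((1 + c ^+ 2) * pint g g (J 0%N) s c d)| <= gconst * M.
  rewrite E (le_trans (ler_normD _ _))//.
  have b1 := pint_bound s c d cg cg (cJi 0%N) gC gC (fun x => JM 0%N x isT).
  have b2 := pint_bound s c d cg cg2 (cJi 2%N) gC g2C (fun x => JM 2%N x isT).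
  have b3 := pint_bound s c d cg2 cg (cJi 2%N) g2C gC (fun x => JM 2%N x isT).
  have b4 := pint_bound s c d cg2 cg2 (cJi 4%N) g2C g2C (fun x => JM 4%N x isT).
  rewrite (le_trans (lerD (ler_normD _ _) (ler_normD _ _)))//.
  by rewrite (le_trans (lerD (lerD b1 b2) (lerD b3 b4)))// /gconst; lra.
move: B; rewrite !normrM !(ger0_norm (ltW (oneDsqr_gt0 _))) mulrA => B.
rewrite -ler_pdivrMr ?mulr_gt0 ?rho_gt0//; apply: le_trans B.
by rewrite invfM /rho !invrK mulrC (mulrC (oneDsqr c)).
Qed.

End plane_gauss.

(** * Derivatives of Gaussian averages along rays *)

Section ray.
Context {R : realType}.
Local Notation leb := (@lebesgue_measure R).
Local Notation RR := (measurableTypeR R).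
Local Notation plane := (@lebesgue_plane R).
Local Notation g := (@gauss_fun R).
Implicit Types (q K : R -> R) (x s c M : R).

Let cg := @continuous_gauss_fun R.
Let cdg := @continuous_dgauss R.
Let gC (a : R) : `|g a| <= 162 * rho a. Proof. by have [] := gauss_dom a. Qed.
Let dgC (a : R) : `|dgauss a| <= 162 * rho a. Proof. by have [] := gauss_dom a. Qed.

Lemma pint00 K s : pint g g K s 0 0 = pi * K s.
Proof.
rewrite /pint; under eq_Rintegral do rewrite !mul0r !addr0 -mulrA.
pose F (y : RR * RR) := g y.1 * (g y.2 * K s).
have ig : leb.-integrable setT (EFin \o (fun b => g b * K s)).
  by apply: integrableZr_fin; exact: integrableT_gauss.
have igg : \int[leb]_a g a = Num.sqrt pi.
  by rewrite /Rintegral integralT_gauss.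
have mF : measurable_fun setT F.
  apply: measurable_funM; first by apply: (measurableT_comp (measurable_cont cg)).
  apply: measurable_funM => //.
  by apply: (measurableT_comp (measurable_cont cg)).
rewrite (@plane_fubini1 _ F (162 ^+ 2 * `|K s|) mF); last first.
  move=> y; rewrite /F !normrM mulrA.
  rewrite (le_trans (ler_pM _ _ (ler_pM _ _ (gC _) (gC _)) (lexx _)))//.
  by rewrite /rho2 le_eqVlt; apply/orP; left; apply/eqP; ring.
rewrite (_ : (fun _ => _) = fun a => g a * (Num.sqrt pi * K s)); last first.
  apply/funext => a; rewrite /F/= RintegralZl//.
  by rewrite (RintegralZr (K s) _ integrableT_gauss) ?igg.
rewrite (RintegralZr _ _ integrableT_gauss)// igg mulrA -expr2 sqr_sqrtr//.
exact: pi_ge0.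
Qed.

Lemma pint_dgauss1 (K K' : R -> R) M s c d :
  (forall x, is_derive x 1 K (K' x)) -> continuous K' ->
  (forall x, `|K x| <= M) -> (forall x, `|K' x| <= M) ->
  pint dgauss g K s c d = - c * pint g g K' s c d.
Proof.
move=> dK cK' KM K'M; have cK := is_derive_continuous dK.
rewrite (pintE1 s c d cdg cg cK dgC gC KM) (pintE1 s c d cg cg cK' gC gC K'M).
have i0 := integrable_pintE1 s c d cg cg cK' gC gC K'M.
rewrite -(RintegralZl _ _ i0)//; apply: eq_Rintegral => b _.
rewrite mulrCA mulNr (ibp _ _ (@is_derive_gauss R) dK cdg cK' gC dgC KM K'M).
by rewrite opprK.
Qed.

Lemma pint_dgauss2 (K K' : R -> R) M s c d :
  (forall x, is_derive x 1 K (K' x)) -> continuous K' ->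
  (forall x, `|K x| <= M) -> (forall x, `|K' x| <= M) ->
  pint g dgauss K s c d = - d * pint g g K' s c d.
Proof.
move=> dK cK' KM K'M; have cK := is_derive_continuous dK.
rewrite (pintE2 s c d cg cdg cK gC dgC KM) (pintE2 s c d cg cg cK' gC gC K'M).
have i0 := integrable_pintE2 s c d cg cg cK' gC gC K'M.
rewrite -(RintegralZl _ _ i0)//; apply: eq_Rintegral => b _.
rewrite mulrCA mulNr (ibp _ _ (@is_derive_gauss R) dK cdg cK' gC dgC KM K'M).
by rewrite opprK.
Qed.

(** Differentiating the argument of [K] brings down [c * y.1 + d * y.2], absorbed by the Gaussians
    through [y * g y = - dgauss y / 2]. In this form [pint_dgauss1] and [pint_dgauss2] can trade the
    derivative of a Gaussian for one more derivative of [K]. *)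
Lemma is_derive_pint_ray (K K' : R -> R) M s c d x :
  (forall x, is_derive x 1 K (K' x)) -> continuous K' ->
  (forall x, `|K x| <= M) -> (forall x, `|K' x| <= M) ->
  is_derive x 1 (fun x => pint g g K s (c * x) (d * x))
    (- (c / 2) * pint dgauss g K' s (c * x) (d * x)
     - (d / 2) * pint g dgauss K' s (c * x) (d * x)).
Proof.
move=> dK cK' KM K'M; have cK := is_derive_continuous dK.
pose F1 x (y : RR * RR) := dgauss y.1 * g y.2 * K' (s + c * x * y.1 + d * x * y.2).
pose F2 x (y : RR * RR) := g y.1 * dgauss y.2 * K' (s + c * x * y.1 + d * x * y.2).
pose f' x y := - (c / 2) * F1 x y - (d / 2) * F2 x y.
have i0 : plane.-integrable setT (EFin \o (fun y => 162 ^+ 2 * M * rho2 y)).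
  by apply: integrableZ_fin; exact: rho2_integrable.
have iF1 x' : plane.-integrable setT (EFin \o F1 x').
  exact: (dom_integrable (measurable_pint _ _ _ cdg cg cK') i0 (pint_dom _ _ _ dgC gC K'M)).
have iF2 x' : plane.-integrable setT (EFin \o F2 x').
  exact: (dom_integrable (measurable_pint _ _ _ cg cdg cK') i0 (pint_dom _ _ _ gC dgC K'M)).
have -> : - (c / 2) * pint dgauss g K' s (c * x) (d * x)
     - (d / 2) * pint g dgauss K' s (c * x) (d * x) = \int[plane]_y f' x y.
  rewrite /f' /pint -/(F1 x) -/(F2 x) -(RintegralZl _ _ (iF1 x))// -(RintegralZl _ _ (iF2 x))//.
  by rewrite -RintegralB//; exact: integrableZ_fin.
apply: (@is_derive_Rintegral _ _ _ plane _ f'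
   (fun y => (`|c / 2| + `|d / 2|) * (162 ^+ 2 * M * rho2 y))).
- by move=> x'; exact: measurable_pint.
- move=> x'; exists (fun y => 162 ^+ 2 * M * rho2 y) => // y; exact: pint_dom.
- move=> x' y.
  have dl : is_derive (s + (c * y.1 + d * y.2) * x') 1 K
     (K' (s + c * x' * y.1 + d * x' * y.2)).
    have -> : s + c * x' * y.1 + d * x' * y.2 = s + (c * y.1 + d * y.2) * x' by ring.
    exact: dK.
  have h := is_deriveZ (g y.1 * g y.2) (is_derive_affine dl).
  have -> : (fun x => g y.1 * g y.2 * K (s + c * x * y.1 + d * x * y.2)) =
     (g y.1 * g y.2) \*: (fun x => K (s + (c * y.1 + d * y.2) * x)).
    by apply/funext => z /=; rewrite /GRing.scale/=; congr (_ * K _); ring.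
  by apply: (is_derive_eq h); rewrite /f' /F1 /F2 /dgauss /GRing.scale/=; field.
- by apply: integrableZ_fin; exact: i0.
- move=> x' y _; rewrite /f' (le_trans (ler_normB _ _))// mulrDl lerD//.
    by rewrite normrM normrN ler_wpM2l//; exact: pint_dom.
  by rewrite normrM ler_wpM2l//; exact: pint_dom.
Qed.

End ray.

(** * The plane integral of a Gaussian average, ray by ray *)

Section ray_integral.
Context {R : realType}.
Local Notation leb := (@lebesgue_measure R).
Local Notation RR := (measurableTypeR R).
Local Notation plane := (@lebesgue_plane R).
Local Notation g := (@gauss_fun R).
Implicit Types (q K : R -> R) (x s c M : R).

Let cg := @continuous_gauss_fun R.

Lemma eq_integral_off0 (f h : R -> \bar R) :
  measurable_fun [set: RR] f -> measurable_fun [set: RR] h ->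
  (forall x, x != 0 -> f x = h x) -> (\int[leb]_x f x = \int[leb]_x h x)%E.
Proof.
move=> mf mh fh; apply: ae_eq_integral => //.
exists [set 0]; split => //; first exact: lebesgue_measure_set1.
move=> x /= h0; apply: contrapT => x0; apply: h0 => _.
by rewrite fh//; apply/eqP.
Qed.

(* The index counts antiderivatives: [J i] is the derivative of [J i.+1]. *)
Variables (J : nat -> R -> R) (s M : R).
Hypotheses (dJ : forall i x, is_derive x 1 (J i.+1) (J i x)) (cJ : continuous (J 0%N)).
Hypothesis JM : forall i x, (i <= 7)%N -> `|J i x| <= M.

Let cJi i : continuous (J i).
Proof. by case: i => [//|i]; exact: is_derive_continuous (@dJ i). Qed.

Let B := @gconst R * M.
Let B0 : 0 <= B.
Proof.
apply: mulr_ge0; last exact: le_trans (normr_ge0 _) (@JM 0%N 0 isT).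
by apply: mulr_ge0 => //; apply: mulr_ge0; [exact: exprn_ge0|exact/exprn_ge0/pi_ge0].
Qed.

Let Bpi x : 0 <= B * pi * rho x.
Proof. exact: (mulr_ge0 (mulr_ge0 B0 (pi_ge0 R)) (rho_ge0 x)). Qed.

Let Psi c d := pint g g (J 1%N) s c d.

Let Psi_dom c d : `|Psi c d| <= B * (rho c * rho d).
Proof.
apply: (@pint_decay _ (fun i => J i.+1)) => [|i x i4].
- exact: cJi.
- by apply: JM; exact: (@leq_trans 5).
Qed.

(** The factor [1] makes this an instance of [is_derive_pint_ray]. *)
Let S v x := pint g g (J 3%N) s (1 * x) (v * x).

(** Decay costs four antiderivatives beyond [J 3]; this is the origin of the index bound [7]. *)
Let S_dom v x : `|S v x| <= B * (rho x * rho (v * x)).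
Proof.
rewrite /S mul1r.
apply: (@pint_decay _ (fun i => J i.+3)) => [|i z i4].
- exact: cJi.
- by apply: JM; exact: (@leq_trans 7).
Qed.

Let dS v x : is_derive x 1 (S v) (2^-1 * (1 + v ^+ 2) * (x * Psi x (v * x))).
Proof.
have J3 y : `|J 3%N y| <= M by exact: JM.
have J2 y : `|J 2%N y| <= M by exact: JM.
have J1 y : `|J 1%N y| <= M by exact: JM.
have h := is_derive_pint_ray s 1 v x (@dJ 2%N) (@cJi 2%N) J3 J2.
apply: (is_derive_eq (h : is_derive x 1 (S v) _)).
rewrite (pint_dgauss1 s _ _ (@dJ 1%N) (@cJi 1%N) J2 J1).
rewrite (pint_dgauss2 s _ _ (@dJ 1%N) (@cJi 1%N) J2 J1).
by rewrite (mul1r x) -/(Psi x (v * x)); field.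
Qed.

(** Continuity is deduced from differentiability along the ray, at the price of the extra derivative
    [J 0]. *)
Let cPsi v : continuous (fun x => Psi x (v * x)).
Proof.
have J1 y : `|J 1%N y| <= M by exact: JM.
have J0 y : `|J 0%N y| <= M by exact: JM.
have := is_derive_continuous (fun x => is_derive_pint_ray s 1 v x (@dJ 0%N) cJ J1 J0).
by under [X in continuous X -> _]eq_fun do rewrite mul1r.
Qed.

Let mPsi : measurable_fun setT (fun w : RR * RR => Psi w.1 w.2).
Proof.
apply: (measurable_Rintegral plane (F := fun p : (RR * RR) * (RR * RR) =>
  g p.2.1 * g p.2.2 * J 1%N (s + p.1.1 * p.2.1 + p.1.2 * p.2.2))).
have m21 : measurable_fun setT (fun p : (RR * RR) * (RR * RR) => p.2.1).
  exact: (measurableT_comp measurable_fst measurable_snd).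
have m22 : measurable_fun setT (fun p : (RR * RR) * (RR * RR) => p.2.2).
  exact: (measurableT_comp measurable_snd measurable_snd).
have m11 : measurable_fun setT (fun p : (RR * RR) * (RR * RR) => p.1.1).
  exact: (measurableT_comp measurable_fst measurable_fst).
have m12 : measurable_fun setT (fun p : (RR * RR) * (RR * RR) => p.1.2).
  exact: (measurableT_comp measurable_snd measurable_fst).
apply: measurable_funM.
  by apply: measurable_funM; [exact: (measurableT_comp (measurable_cont cg) m21)
                             |exact: (measurableT_comp (measurable_cont cg) m22)].
apply: (measurableT_comp (measurable_cont (@cJi 1%N))).
by apply: measurable_funD; [apply: measurable_funD => //|]; apply: measurable_funM.
Qed.

(* The integrand in the coordinates [(c, d) = (c, c * v)]. *)
Let F c v := `|c| * Psi c (c * v).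

(** The Jacobian [|c|] is paid for by the second decay factor: [|x| * rho (v * x)] is at most
    [|v|^-1]. This estimate breaks down for [v = 0], a null set of rays. *)
Let F_ray v : v != 0 -> leb.-integrable setT (EFin \o F ^~ v) /\
  \int[leb]_c F c v = - 4 * pi * J 3%N s * rho v.
Proof.
move=> v0; pose S' x := 2^-1 * (1 + v ^+ 2) * (x * Psi x (v * x)).
have xr x : `|x| * rho (v * x) <= `|v|^-1.
  rewrite -ler_pdivlMr ?rho_gt0// invrK ler_pdivlMl ?normr_gt0// /oneDsqr.
  rewrite exprMn -(real_normK (num_real v)) -(real_normK (num_real x)).
  by rewrite -exprMn; have := sqr_ge0 (`|v| * `|x| - 1); nra.
have xP x : `|x * Psi x (v * x)| <= `|v|^-1 * B * rho x.
  rewrite normrM (le_trans (ler_wpM2l _ (Psi_dom _ _)))//.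
  have -> : `|x| * (B * (rho x * rho (v * x))) = (`|x| * rho (v * x)) * (B * rho x) by ring.
  by rewrite -[leRHS]mulrA ler_wpM2r// mulr_ge0// rho_ge0.
have cxP : continuous (fun x => x * Psi x (v * x)).
  by move=> x; apply: cvgM; [exact: cvg_id|exact: cPsi].
have [] := @FTC_sg _ (S v) S' (2^-1 * (1 + v ^+ 2) * (`|v|^-1 * B)) B (dS v).
- by move=> x; apply: cvgM; [exact: cvg_cst|exact: cxP].
- move=> x; rewrite /S' normrM ger0_norm ?mulr_ge0 ?addr_ge0 ?sqr_ge0//.
  by rewrite -[leRHS]mulrA ler_wpM2l// mulr_ge0 ?addr_ge0 ?sqr_ge0.
- move=> x; rewrite (le_trans (S_dom _ _))// ler_wpM2l//.
  by rewrite ler_piMr ?rho_ge0 ?rho_le1.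
have -> : S v 0 = pi * J 3%N s by rewrite /S !mulr0 pint00.
move=> h1 h2.
have iF : leb.-integrable setT (EFin \o F ^~ v).
  apply: (@dom_rho_integrable _ _ (`|v|^-1 * B)) => [|x].
    apply: measurable_cont => x; apply: cvgM; first exact: norm_continuous.
    by under [X in X @ _ --> _]eq_fun do rewrite mulrC; rewrite mulrC; exact: cPsi.
  by rewrite /F (mulrC x v) normrM normr_id -normrM.
split => //; rewrite Rintegral_split//.
have v10 : 1 + v ^+ 2 != 0 by have := oneDsqr_gt0 v; rewrite lt0r => /andP[].
have iS' : leb.-integrable setT (EFin \o (fun x => x * Psi x (v * x))).
  by apply: dom_rho_integrable xP; apply: measurable_cont.
have -> : \int[leb]_(x in `[0, +oo[) F x v = 2 * rho v * \int[leb]_(x in `[0, +oo[) S' x.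
  rewrite -RintegralZl//; last first.
    by apply: (@integrableS _ _ _ _ setT) => //; exact: (integrableZ_fin _ iS').
  apply: eq_Rintegral => x; rewrite inE/= in_itv/= andbT => x0.
  by rewrite /F /S' ger0_norm// (mulrC x v) rhoE; field.
have -> : \int[leb]_(x in `[0, +oo[) F (- x) v = - (2 * rho v) * \int[leb]_(x in `[0, +oo[) S' (- x).
  rewrite -RintegralZl//; last first.
    apply: (@integrableS _ _ _ _ setT) => //.
    have := integrable_affine 0 (_ : -1 != 0) (integrableZ_fin (2^-1 * (1 + v ^+ 2)) iS').
    rewrite oppr_eq0 oner_eq0 => /(_ isT).
    by under eq_fun do rewrite addr0 mulN1r.
  apply: eq_Rintegral => x; rewrite inE/= in_itv/= andbT => x0.
  by rewrite /F /S' normrN ger0_norm// (mulrC (- x) v) rhoE; field.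
rewrite h1 h2; ring.
Qed.

(** The substitution [d = c * v] undoes the Jacobian. The bound of [F_ray] blows up as [v] tends to
    [0], so integrability of [F] on the plane is obtained from these partial integrals rather than
    from a product majorant. *)
Let F_dom c : leb.-integrable setT (EFin \o F c) /\
  (\int[leb]_v `|(F c v)%:E| <= (B * pi * rho c)%:E)%E.
Proof.
have mP : measurable_fun [set: RR] (Psi c).
  exact: (measurableT_comp mPsi (pair1_measurable c)).
have PD x : `|Psi c x| <= (B * rho c) * rho x by rewrite -mulrA.
have iP := dom_rho_integrable mP PD.
have [->|c0] := eqVneq c 0.
  have F0 v : F 0 v = 0 by rewrite /F normr0 mul0r.
  split.
    apply: (@dom_rho_integrable _ _ 0) => [|x]; last by rewrite F0 normr0 mul0r.
    by rewrite (_ : F 0 = cst 0)//; apply/funext => x; rewrite F0.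
  under eq_integral do rewrite F0 abse0.
  by rewrite integral0 lee_fin.
have iF : leb.-integrable setT (EFin \o F c).
  have := integrableZ_fin `|c| (integrable_affine 0 c0 iP).
  by under eq_fun do rewrite addr0.
split => //.
have -> : (\int[leb]_v `|(F c v)%:E| = \int[leb]_x `|(Psi c x)%:E|)%E.
  rewrite [RHS](ge0_integral_affine 0 c0)//; last first.
    by apply: measurableT_comp => //; exact/measurable_EFinP.
  rewrite -ge0_integralZl//; last first.
    apply: measurableT_comp => //; apply/measurable_EFinP.
    by have /measurable_int/measurable_EFinP := integrable_affine 0 c0 iP.
  by apply: eq_integral => v _; rewrite addr0 /F abse_EFin normrM normr_id EFinM.
have iPn := integrable_norm iP.
rewrite -(fineK (integrable_fin_num measurableT iPn)) lee_fin.
have -> : B * pi * rho c = B * rho c * pi by rewrite mulrAC.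
apply: le_trans (ler_norm _) _.
apply: (@dom_rho_integral _ (fun x => `|Psi c x|)) => [|x].
  exact: measurableT_comp.
by rewrite normr_id.
Qed.

Lemma plane_gauss_ray :
  \int[plane]_w pint g g (J 1%N) s w.1 w.2 = - 4 * pi ^+ 2 * J 3%N s.
Proof.
have mF : measurable_fun setT (fun w : RR * RR => F w.1 w.2).
  apply: measurable_funM; first exact: measurableT_comp.
  have mh : measurable_fun setT (fun w : RR * RR => (w.1, w.1 * w.2) : RR * RR).
    have mm : measurable_fun setT (fun w : RR * RR => w.1 * w.2 : R).
      exact: measurable_funM.
    by apply/measurable_fun_pairP; split; [exact: measurable_fst|exact: mm].
  exact: (measurableT_comp mPsi mh).
have iF : (leb \x leb)%E.-integrable setT (EFin \o (fun w : RR * RR => F w.1 w.2)).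
  apply/integrable12ltyP; first exact/measurable_EFinP.
  apply: (@le_lt_trans _ _ (\int[leb]_c (B * pi * rho c)%:E)%E).
    apply: ge0_le_integral => //.
    - by move=> x _; exact: integral_ge0.
    - apply: (measurable_fun_fubini_tonelli_F (m2 := leb)
        (abse \o (EFin \o (fun w : RR * RR => F w.1 w.2)))) => //.
        by apply/measurableT_comp => //; exact/measurable_EFinP.
      by move=> w; rewrite lee_fin.
    - apply/measurable_EFinP; apply: measurable_funM => //; exact: measurable_rho.
    - by move=> c _; exact: (F_dom c).2.
  have /integrable_fin_num := @integrable_rhoC R (B * pi).
  by move=> /(_ measurableT); rewrite ge0_fin_numE// integral_ge0// => x _;
    rewrite lee_fin.
have m1 : measurable_fun [set: RR] (fun c => \int[leb]_d Psi c d).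
  exact: (measurable_Rintegral leb mPsi).
have m2 : measurable_fun [set: RR] (fun c => \int[leb]_v F c v).
  exact: (measurable_Rintegral leb mF).
have -> : \int[plane]_w pint g g (J 1%N) s w.1 w.2 = \int[leb]_c \int[leb]_d Psi c d.
  apply: (plane_fubini1 mPsi (C := B)) => w; exact: Psi_dom.
have -> : \int[leb]_c \int[leb]_d Psi c d = \int[leb]_c \int[leb]_v F c v.
  (* The substitution [d = c * v] degenerates at the single point [c = 0]. *)
  congr fine; apply: eq_integral_off0 => [||c c0]; [exact/measurable_EFinP..|congr _%:E].
  have iP : leb.-integrable setT (EFin \o Psi c).
    apply: (@dom_rho_integrable _ _ (B * rho c)) => [|x]; last by rewrite -mulrA.
    exact: (measurableT_comp mPsi (pair1_measurable c)).
  rewrite (Rintegral_affine 0 c0 iP).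
  apply: (etrans (esym (RintegralZl _ _ (integrable_affine 0 c0 iP)))); first exact: measurableT.
  by apply: eq_Rintegral => v _; rewrite addr0.
transitivity (fine (\int[leb]_c \int[leb]_v (F c v)%:E)%E).
  congr fine; apply: eq_integral => c _.
  by rewrite fineK//; exact: integrable_fin_num (F_dom c).1.
(* With the order exchanged, the inner integral runs along the ray of slope [v], where [F_ray]
   evaluates it; the remaining [rho v] contributes the second factor [pi]. *)
rewrite (Fubini iF).
transitivity (\int[leb]_v (- 4 * pi * J 3%N s * rho v)).
  congr fine; apply: eq_integral_off0.
  - exact: (measurable_fubini_G iF).
  - by apply/measurable_EFinP/measurable_funM => //; exact: measurable_rho.
  - move=> v /F_ray[i1 <-]; rewrite fineK//; exact: integrable_fin_num i1.
rewrite RintegralZl//; last exact: rho_integrable.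
by rewrite rho_integral; ring.
Qed.

End ray_integral.

(** * Affine substitutions in the plane *)

Section plane_change_of_variables.
Context {R : realType}.
Local Notation leb := (@lebesgue_measure R).
Local Notation RR := (measurableTypeR R).
Local Notation plane := (@lebesgue_plane R).
Variables (al be a0 b0 : R).
Hypotheses (al0 : al != 0) (be0 : be != 0).

Definition plane_aff (y : RR * RR) : RR * RR := (al * y.1 + a0, be * y.2 + b0).

Lemma measurable_plane_aff : measurable_fun setT plane_aff.
Proof.
have m1 : measurable_fun setT (fun w : RR * RR => al * w.1 + a0 : R).
  by apply: measurable_funD => //; exact: measurable_funM.
have m2 : measurable_fun setT (fun w : RR * RR => be * w.2 + b0 : R).
  by apply: measurable_funD => //; exact: measurable_funM.
by apply/measurable_fun_pairP; split; [exact: m1|exact: m2].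
Qed.

Lemma ge0_integral_plane_aff (F : RR * RR -> \bar R) : measurable_fun setT F ->
  (forall x, 0 <= F x)%E ->
  (\int[plane]_y F y = (`|al| * `|be|)%:E * \int[plane]_y F (plane_aff y))%E.
Proof.
move=> mF F0.
have mFa : measurable_fun setT (F \o plane_aff).
  exact: measurableT_comp mF measurable_plane_aff.
have Fa0 x : (0 <= (F \o plane_aff) x)%E by exact: F0.
rewrite [LHS](fubini_tonelli1 (m1 := leb) (m2 := leb) _ mF F0).
rewrite [X in (_ * X)%E](fubini_tonelli1 (m1 := leb) (m2 := leb) _ mFa Fa0).
have mFF := measurable_fun_fubini_tonelli_F (m2 := leb) _ mF F0.
have mFaF := measurable_fun_fubini_tonelli_F (m2 := leb) _ mFa Fa0.
rewrite (ge0_integral_affine a0 al0 mFF); last by move=> x; exact: integral_ge0.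
rewrite EFinM -muleA; congr (_ * _)%E.
rewrite -ge0_integralZl//; last by move=> x _; exact: integral_ge0.
apply: eq_integral => x _; rewrite /fubini_F (ge0_integral_affine b0 be0)//.
exact: (measurableT_comp mF (pair1_measurable _)).
Qed.

(** Integrability is assumed after the substitution because that is where the Gaussian estimates
    provide it. *)
Lemma Rintegral_plane_aff (F : RR * RR -> R) : measurable_fun setT F ->
  plane.-integrable setT (EFin \o (F \o plane_aff)) ->
  \int[plane]_y F y = `|al| * `|be| * \int[plane]_y F (plane_aff y).
Proof.
move=> mF iF.
have mE : measurable_fun setT (EFin \o F) by exact/measurable_EFinP.
have fp := integrable_fin_num measurableT (integrable_funepos measurableT iF).
have fm := integrable_fin_num measurableT (integrable_funeneg measurableT iF).
have EP : (\int[plane]_x (EFin \o F)^\+ x =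
    (`|al| * `|be|)%:E * \int[plane]_x (EFin \o (F \o plane_aff))^\+ x)%E.
  rewrite (ge0_integral_plane_aff (measurable_funepos mE))//.
  by congr (_ * _)%E; apply: eq_integral => x _; rewrite !funeposE.
have EN : (\int[plane]_x (EFin \o F)^\- x =
    (`|al| * `|be|)%:E * \int[plane]_x (EFin \o (F \o plane_aff))^\- x)%E.
  rewrite (ge0_integral_plane_aff (measurable_funeneg mE))//.
  by congr (_ * _)%E; apply: eq_integral => x _; rewrite !funenegE.
rewrite /Rintegral !integral_EFinE EP EN.
rewrite -muleBr//; last first.
  by apply: fin_num_adde_defl; rewrite fin_numN; exact: fm.
rewrite fineM//; first by rewrite fin_numB; apply/andP; split; [exact: fp|exact: fm].
Qed.

End plane_change_of_variables.

(** * Inversion in one complex coordinate *)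

Section base_inversion.
Context {R : realType}.
Local Notation leb := (@lebesgue_measure R).
Local Notation RR := (measurableTypeR R).
Local Notation plane := (@lebesgue_plane R).
Local Notation g := (@gauss_fun R).

Let cg := @continuous_gauss_fun R.
Let gC (a : R) : `|g a| <= 162 * rho a. Proof. by have [] := gauss_dom a. Qed.
Let g_ge0 (a : R) : 0 <= g a := gauss_fun_ge0 a.

Lemma plane_swap (F : RR * RR -> R) C : measurable_fun setT F ->
  (forall x, `|F x| <= C * rho2 x) -> \int[plane]_x F (x.2, x.1) = \int[plane]_x F x.
Proof.
move=> mF FC; rewrite (plane_fubini2 mF FC).
rewrite (@plane_fubini1 _ (fun x => F (x.2, x.1)) C)//.
  apply: (measurableT_comp mF).
  by apply/measurable_fun_pairP; split; [exact: measurable_snd|exact: measurable_fst].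
by move=> x; rewrite (le_trans (FC _))// /rho2/= (mulrC (rho x.2)).
Qed.

(* As above, [J i] is the [x]-derivative of [J i.+1]: the integrated function is
   [J 1] and the recovered one is its second antiderivative [J 3]; [J 0] only
   serves to make [J 1] differentiable. *)
Variables (J : nat -> R -> R -> R -> R) (zeta : RR * RR) (t C D M : R).
Hypothesis dJ : forall i u v (x : R), is_derive x 1 (J i.+1 u v) (J i u v x).
Hypothesis cJ : forall u v, continuous (J 0%N u v).
Hypothesis JM : forall i u v x, (i <= 7)%N -> `|J i u v x| <= M.
Hypothesis mH : measurable_fun setT (fun p : (RR * RR) * RR => J 1%N p.1.1 p.1.2 p.2).
Hypothesis HC : forall u v x, `|J 1%N u v x| <= C * rho2 (u, v).
Hypothesis Hcont : forall x (u v : nat -> R), u k @[k --> \oo] --> zeta.1 ->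
  v k @[k --> \oo] --> zeta.2 ->
  J 1%N (u k) (v k) x @[k --> \oo] --> J 1%N zeta.1 zeta.2 x.

Let phase (y x : RR * RR) : R :=
  t - 2^-1 * (y.2 * (x.1 - zeta.1) - y.1 * (x.2 - zeta.2)).
Let phi (y : RR * RR) := \int[plane]_x J 1%N x.1 x.2 (phase y x).
Hypothesis phiD : forall y, `|phi y| <= D * rho2 y.

Let gam (k : nat) (y : RR * RR) : R := g (k.+1%:R^-1 * y.1) * g (k.+1%:R^-1 * y.2).

Let gam_le1 k y : `|gam k y| <= 1.
Proof. by rewrite ger0_norm ?mulr_ge0// mulr_ile1 ?gauss_fun_le1. Qed.

Let mgam k : measurable_fun setT (gam k).
Proof.
by apply: measurable_funM; apply: (measurableT_comp (measurable_cont cg));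
  apply: measurable_funM.
Qed.

Let gam_integrable k : plane.-integrable setT (EFin \o gam k).
Proof.
have k0 : (k.+1%:R^-1 : R) != 0 by rewrite invr_eq0.
have ig := integrable_affine 0 k0 (@integrableT_gauss R).
apply: (dom_integrable_prod (m1 := leb) (m2 := leb) ig ig (mgam k)) => x y.
by rewrite !addr0 ger0_norm// mulr_ge0.
Qed.

Let m11 : measurable_fun setT (fun p : (RR * RR) * (RR * RR) => p.1.1).
Proof. exact: (measurableT_comp measurable_fst measurable_fst). Qed.
Let m12 : measurable_fun setT (fun p : (RR * RR) * (RR * RR) => p.1.2).
Proof. exact: (measurableT_comp measurable_snd measurable_fst). Qed.
Let m21 : measurable_fun setT (fun p : (RR * RR) * (RR * RR) => p.2.1).
Proof. exact: (measurableT_comp measurable_fst measurable_snd). Qed.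
Let m22 : measurable_fun setT (fun p : (RR * RR) * (RR * RR) => p.2.2).
Proof. exact: (measurableT_comp measurable_snd measurable_snd). Qed.

Let mJ1 (u v s : (RR * RR) * (RR * RR) -> R) :
  measurable_fun setT u -> measurable_fun setT v -> measurable_fun setT s ->
  measurable_fun setT (fun p => J 1%N (u p) (v p) (s p)).
Proof.
move=> mu mv ms.
have m : measurable_fun setT (fun p => ((u p, v p), s p) : (RR * RR) * RR).
  apply/measurable_fun_pairP; split; last exact: ms.
  by apply/measurable_fun_pairP; split; [exact: mu|exact: mv].
exact: (measurableT_comp mH m).
Qed.

Let mphase : measurable_fun setT (fun p : (RR * RR) * (RR * RR) => phase p.1 p.2).
Proof.
apply: measurable_funB => //; apply: measurable_funM => //.
by apply: measurable_funB; apply: measurable_funM => //; exact: measurable_funB.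
Qed.

Let mJph : measurable_fun setT
  (fun p : (RR * RR) * (RR * RR) => J 1%N p.2.1 p.2.2 (phase p.1 p.2)).
Proof. exact: mJ1. Qed.

Let Theta k (x : RR * RR) := \int[plane]_y (gam k y * J 1%N x.1 x.2 (phase y x)).
(* [Theta k] after the substitutions [y -> k.+1 * y] and
   [x = zeta + 2 / k.+1 * (- w.1, w.2)]. *)
Let Xi k (w : RR * RR) :=
  pint g g (J 1%N (zeta.1 - 2 / k.+1%:R * w.1) (zeta.2 + 2 / k.+1%:R * w.2)) t w.2 w.1.

Let cJi i u v : continuous (J i u v).
Proof. by case: i => [//|i]; exact: is_derive_continuous (@dJ i u v). Qed.

Let JM' i u v x : (i <= 4)%N -> `|J i.+1 u v x| <= M.
Proof. by move=> i4; apply: JM; exact: (@leq_trans 5). Qed.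

Let step1 k : \int[plane]_y (gam k y * phi y) = \int[plane]_x Theta k x.
Proof.
have iC : plane.-integrable setT (EFin \o (fun x => C * rho2 x)).
  by apply: integrableZ_fin; exact: rho2_integrable.
have mF : measurable_fun setT (fun p : (RR * RR) * (RR * RR) =>
    gam k p.1 * J 1%N p.2.1 p.2.2 (phase p.1 p.2)).
  apply: measurable_funM => //.
  exact: (measurableT_comp (mgam k) measurable_fst).
apply: (etrans _ (dom_Rfubini (gam_integrable k) iC mF _)); last first.
  move=> y x; rewrite normrM ger0_norm ?mulr_ge0//=.
  by rewrite ler_wpM2l ?mulr_ge0// (le_trans (HC _ _ _))// -surjective_pairing.
apply: eq_Rintegral => y _.
have iJ : plane.-integrable setT (EFin \o (fun x => J 1%N x.1 x.2 (phase y x))).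
  apply: (dom_integrable _ iC) => [|x].
    exact: (measurableT_comp mJph (pair1_measurable y)).
  by rewrite (le_trans (HC _ _ _))// -surjective_pairing.
exact: (esym (RintegralZl (gam k y) measurableT iJ)).
Qed.

(** The scale [K] of [y] and the scale [2 / K] of [x] cancel against the factor [2^-1] of the phase,
    which becomes [t + w.2 * y.1 + w.1 * y.2]. The sign of the first scale and the exchange of [w.1]
    and [w.2] absorb the antisymmetry of the form. *)
Let Theta_aff k w :
  Theta k (plane_aff (- (2 / k.+1%:R)) (2 / k.+1%:R) zeta.1 zeta.2 w) = k.+1%:R ^+ 2 * Xi k w.
Proof.
pose K : R := k.+1%:R; rewrite -/K.
have K0 : K != 0 by rewrite pnatr_eq0.
pose x := plane_aff (- (2 / K)) (2 / K) zeta.1 zeta.2 w; rewrite -/x.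
pose G y := gam k y * J 1%N x.1 x.2 (phase y x).
have mG : measurable_fun setT G.
  apply: measurable_funM => //; exact: (measurableT_comp mJph (pair2_measurable x)).
have GE y : G (plane_aff K K 0 0 y) = g y.1 * g y.2 *
    J 1%N (zeta.1 - 2 / K * w.1) (zeta.2 + 2 / K * w.2) (t + w.2 * y.1 + w.1 * y.2).
  rewrite /G /gam /phase /x /plane_aff/= !addr0 -/K !(mulrA K^-1) mulVf// !mul1r.
  rewrite mulNr (addrC (- _)) (addrC (2 / K * w.2)).
  by congr (_ * J _ _ _ _); field.
have iG : plane.-integrable setT (EFin \o (G \o plane_aff K K 0 0)).
  have i0 : plane.-integrable setT (EFin \o (fun y => 162 ^+ 2 * M * rho2 y)).
    by apply: integrableZ_fin; exact: rho2_integrable.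
  apply: (dom_integrable _ i0).
    exact: (measurableT_comp mG (measurable_plane_aff _ _ _ _)).
  move=> y; rewrite [X in `|X|]GE; apply: pint_dom => // z.
  exact: (@JM' 0%N).
have E := Rintegral_plane_aff K0 K0 mG iG.
apply: (etrans E); rewrite normr_nat -expr2; congr (_ * _).
by apply: eq_Rintegral => y _; exact: GE.
Qed.

Let mTheta k : measurable_fun setT (Theta k).
Proof.
apply: (measurable_Rintegral plane (F := fun p : (RR * RR) * (RR * RR) =>
  gam k p.2 * J 1%N p.1.1 p.1.2 (phase p.2 p.1))).
apply: measurable_funM; first exact: (measurableT_comp (mgam k) measurable_snd).
apply: mJ1 => //.
have ms : measurable_fun setT (fun p : (RR * RR) * (RR * RR) => (p.2, p.1)).
  by apply/measurable_fun_pairP; split; [exact: measurable_snd|exact: measurable_fst].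
exact: (measurableT_comp mphase ms).
Qed.

Let Xi_dom k w : `|Xi k w| <= @gconst R * M * rho2 w.
Proof.
rewrite /rho2 (mulrC (rho w.1)).
apply: (@pint_decay _ (fun i => J i.+1 (zeta.1 - 2 / k.+1%:R * w.1)
  (zeta.2 + 2 / k.+1%:R * w.2))) => [|i x i4]; first exact: cJi.
exact: JM'.
Qed.

Let mXi k : measurable_fun setT (Xi k).
Proof.
have K0 : (k.+1%:R ^+ 2 : R) != 0 by rewrite expf_neq0// pnatr_eq0.
have -> : Xi k = fun w => (k.+1%:R ^+ 2)^-1 *
    Theta k (plane_aff (- (2 / k.+1%:R)) (2 / k.+1%:R) zeta.1 zeta.2 w).
  by apply/funext => w; rewrite Theta_aff mulrA mulVf// mul1r.
apply: measurable_funM => //.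
exact: (measurableT_comp (mTheta k) (measurable_plane_aff _ _ _ _)).
Qed.

Let iXi k : plane.-integrable setT (EFin \o Xi k).
Proof.
apply: (dom_integrable (mXi k) _ (Xi_dom k)).
by apply: integrableZ_fin; exact: rho2_integrable.
Qed.

Let step2 k : \int[plane]_x Theta k x = 4 * \int[plane]_w Xi k w.
Proof.
have K0 : (k.+1%:R : R) != 0 by rewrite pnatr_eq0.
have a0 : - (2 / k.+1%:R) != 0 :> R by rewrite oppr_eq0 mulf_neq0// invr_eq0.
have b0 : 2 / k.+1%:R != 0 :> R by rewrite mulf_neq0// invr_eq0.
have TE : Theta k \o plane_aff (- (2 / k.+1%:R)) (2 / k.+1%:R) zeta.1 zeta.2 =
    fun w => k.+1%:R ^+ 2 * Xi k w.
  by apply/funext => w; exact: Theta_aff.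
have iT : plane.-integrable setT (EFin \o
    (Theta k \o plane_aff (- (2 / k.+1%:R)) (2 / k.+1%:R) zeta.1 zeta.2)).
  by rewrite TE; apply: integrableZ_fin; exact: iXi.
apply: (etrans (Rintegral_plane_aff a0 b0 (mTheta k) iT)).
have -> : \int[plane]_w Theta k (plane_aff (- (2 / k.+1%:R)) (2 / k.+1%:R) zeta.1 zeta.2 w) =
    k.+1%:R ^+ 2 * \int[plane]_w Xi k w.
  apply: (etrans _ (RintegralZl _ _ (iXi k))); last exact: measurableT.
  by apply: eq_Rintegral => w _; exact: Theta_aff.
(* The Jacobian [(2 / k.+1%:R) ^+ 2] of [x] meets the factor [k.+1%:R ^+ 2] from [y], leaving
   [4]. *)
by rewrite normrN ger0_norm//; field.
Qed.

(** After rescaling, [k] survives only in the base point of [J 1], which tends to [zeta]. *)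
Let Xi_cvg w : Xi k w @[k --> \oo] --> pint g g (J 1%N zeta.1 zeta.2) t w.2 w.1.
Proof.
have i0 : plane.-integrable setT (EFin \o (fun y => 162 ^+ 2 * M * rho2 y)).
  by apply: integrableZ_fin; exact: rho2_integrable.
have JM1 u v x : `|J 1%N u v x| <= M by exact: (@JM' 0%N).
apply: (Rdominated_cvg _ _ i0) => [k||k y|y].
- exact: (measurable_pint _ _ _ cg cg (@cJi 1%N _ _)).
- exact: (measurable_pint _ _ _ cg cg (@cJi 1%N _ _)).
- exact: (pint_dom _ _ _ gC gC (JM1 _ _)).
apply: cvgM; first exact: cvg_cst.
have c0 : 2 / k.+1%:R @[k --> \oo] --> (0 : R).
  rewrite -[X in _ --> X](mulr0 2); apply: cvgM; first exact: cvg_cst.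
  exact: cvg_harmonic.
apply: Hcont.
  rewrite -[X in _ --> X]subr0 -(mul0r w.1).
  by apply: cvgB; [exact: cvg_cst|apply: cvgM => //; exact: cvg_cst].
rewrite -[X in _ --> X]addr0 -(mul0r w.2).
by apply: cvgD; [exact: cvg_cst|apply: cvgM => //; exact: cvg_cst].
Qed.

Let lim1 : \int[plane]_y (gam k y * phi y) @[k --> \oo] --> \int[plane]_y phi y.
Proof.
have mphi : measurable_fun setT phi.
  exact: (measurable_Rintegral plane mJph).
have iD : plane.-integrable setT (EFin \o (fun y => D * rho2 y)).
  by apply: integrableZ_fin; exact: rho2_integrable.
apply: (Rdominated_cvg _ _ iD) => [k||k y|y].
- exact: measurable_funM.
- exact: mphi.
- by rewrite normrM (le_trans _ (phiD y))// ler_piMl.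
rewrite -[X in _ --> X]mul1r; apply: cvgM; last exact: cvg_cst.
have gc (a : R) : g (k.+1%:R^-1 * a) @[k --> \oo] --> (1 : R).
  have g0 : g 0 = 1 by rewrite /gauss_fun expr0n/= oppr0 expR0.
  have h : k.+1%:R^-1 * a @[k --> \oo] --> (0 : R).
    rewrite -[X in _ --> X](mul0r a); apply: cvgM; last exact: cvg_cst.
    exact: cvg_harmonic.
  by rewrite -[X in _ --> X]g0; exact: (continuous_cvg _ (@cg 0) h).
by rewrite -[X in _ --> X]mul1r; apply: cvgM; exact: gc.
Qed.

Lemma base_inversion :
  \int[plane]_y \int[plane]_x J 1%N x.1 x.2 (phase y x) =
  - 16 * pi ^+ 2 * J 3%N zeta.1 zeta.2 t.
Proof.
have mX : measurable_fun setT (fun w : RR * RR => pint g g (J 1%N zeta.1 zeta.2) t w.1 w.2).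
  apply: (measurable_Rintegral plane (F := fun p : (RR * RR) * (RR * RR) =>
    g p.2.1 * g p.2.2 * J 1%N zeta.1 zeta.2 (t + p.1.1 * p.2.1 + p.1.2 * p.2.2))).
  apply: measurable_funM.
    by apply: measurable_funM; [exact: (measurableT_comp (measurable_cont cg) m21)
                               |exact: (measurableT_comp (measurable_cont cg) m22)].
  apply: mJ1 => //.
  by apply: measurable_funD; [apply: measurable_funD => //|]; apply: measurable_funM.
have XD w : `|pint g g (J 1%N zeta.1 zeta.2) t w.1 w.2| <= @gconst R * M * rho2 w.
  apply: (@pint_decay _ (fun i => J i.+1 zeta.1 zeta.2)) => [|i x i4]; first exact: cJi.
  exact: JM'.
have lim2 : \int[plane]_w Xi k w @[k --> \oo] -->
    \int[plane]_w pint g g (J 1%N zeta.1 zeta.2) t w.2 w.1.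
  have iD : plane.-integrable setT (EFin \o (fun y => @gconst R * M * rho2 y)).
    by apply: integrableZ_fin; exact: rho2_integrable.
  apply: (Rdominated_cvg mXi _ iD Xi_dom Xi_cvg).
  have ms : measurable_fun setT (fun p : RR * RR => (p.2, p.1)).
    by apply/measurable_fun_pairP; split; [exact: measurable_snd|exact: measurable_fst].
  exact: (measurableT_comp mX ms).
have lim3 : \int[plane]_y (gam k y * phi y) @[k --> \oo] -->
    4 * \int[plane]_w pint g g (J 1%N zeta.1 zeta.2) t w.2 w.1.
  under eq_cvg do rewrite step1 step2.
  by apply: cvgM; [exact: cvg_cst|exact: lim2].
have -> := cvg_unique _ lim1 lim3; last by [].
rewrite (plane_swap mX XD).
rewrite (@plane_gauss_ray _ (fun i => J i zeta.1 zeta.2) t M); first by ring.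
- exact: cJ.
- by move=> i x i7; exact: JM.
Qed.

End base_inversion.

(** * Functions with Radon transforms of rapid decay *)

Section good_class.
Context {R : realType}.
Local Notation leb := (@lebesgue_measure R).
Local Notation RR := (measurableTypeR R).

Definition is_dt n (g g' : W R n -> R -> R) :=
  forall w (t : R), is_derive t 1 (g w) (g' w t).

(** The chain rule along slanted lines: under the Radon transform the time argument moves with each
    coordinate, so these are the lines of integration by parts. The slope [c = 0] gives the partial
    derivative. *)
Definition slope_derive n (j : bool * 'I_n) (g gj gt : W R n -> R -> R) :=
  forall w (c t s : R), is_derive s 1 (fun s => g (upd w j s) (t + c * s))
    (gj (upd w j s) (t + c * s) + c * gt (upd w j s) (t + c * s)).

(* [good] is the largest class of functions dominated by [rhoW] and closed under
   the derivatives in [t] and in the coordinates and under some [t]-antiderivative,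
   i.e. the union of all post-fixed points [P] of [good_step]. *)
Record good_step n (P : (W R n -> R -> R) -> Prop) (g : W R n -> R -> R) : Prop := {
  good_step_bound : exists C, forall w t, `|g w t| <= C * rhoW w;
  good_step_derive : exists2 gt, P gt & is_dt g gt /\
    forall j, exists2 gj, P gj & slope_derive j g gj gt;
  good_step_anti : exists2 G, P G & is_dt G g }.

Definition good n (g : W R n -> R -> R) : Prop :=
  exists2 P : (W R n -> R -> R) -> Prop, (forall h, P h -> good_step P h) & P g.

Lemma good_stepS n (P Q : (W R n -> R -> R) -> Prop) g :
  (forall h, P h -> Q h) -> good_step P g -> good_step Q g.
Proof.
move=> PQ [b [gt Pgt [dt dj]] [G PG dG]]; split=> //.
- exists gt; first exact: PQ.
  by split=> // j; have [gj Pgj h] := dj j; exists gj => //; exact: PQ.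
- by exists G => //; exact: PQ.
Qed.

Lemma goodP n (g : W R n -> R -> R) : good g -> good_step (@good n) g.
Proof. by move=> [P hP Pg]; apply: good_stepS (hP _ Pg) => h Ph; exists P. Qed.

Lemma is_dt_unique n (g g1 g2 : W R n -> R -> R) : is_dt g g1 -> is_dt g g2 -> g1 = g2.
Proof.
move=> d1 d2; apply/funext => w; apply/funext => t.
by have := d1 w t => h1; have := d2 w t => h2;
  rewrite -(@derive_val _ _ _ _ _ _ _ h1) (@derive_val _ _ _ _ _ _ _ h2).
Qed.

Lemma good_bound n (g : W R n -> R -> R) : good g ->
  exists2 C, 0 <= C & forall w t, `|g w t| <= C * rhoW w.
Proof.
move=> /goodP[[C gC] _ _]; exists `|C| => // w t.
by rewrite (le_trans (gC w t))// ler_wpM2r ?rhoW_ge0// ler_norm.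
Qed.

Lemma good_dt n (g : W R n -> R -> R) : good g -> exists2 gt, good gt & is_dt g gt.
Proof. by move=> /goodP[_ [gt ggt [dt _]] _]; exists gt. Qed.

Lemma good_anti n (g : W R n -> R -> R) : good g -> exists2 G, good G & is_dt G g.
Proof. by move=> /goodP[]. Qed.

Lemma good_slope n (g gt : W R n -> R -> R) j : good g -> is_dt g gt ->
  exists2 gj, good gj & slope_derive j g gj gt.
Proof.
move=> /goodP[_ [gt' ggt [dt dj]] _] dgt; rewrite (is_dt_unique dgt dt).
exact: dj.
Qed.

(** By coinduction: the combinations of good functions with coefficient [a] form a post-fixed point
    of [good_step]. *)
Lemma good_lin n (f g : W R n -> R -> R) a : good f -> good g ->
  good (fun w t => f w t + a * g w t).
Proof.
move=> gf gg.
exists (fun h => exists f' g', [/\ good f', good g' & h = fun w t => f' w t + a * g' w t]);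
  last by exists f, g.
move=> _ {f g gf gg} [f [g [gf gg ->]]].
have dlin (f1 g1 : R -> R) (s df dg : R) : is_derive s 1 f1 df -> is_derive s 1 g1 dg ->
    is_derive s 1 (fun s => f1 s + a * g1 s) (df + a * dg).
  by move=> h1 h2; exact: (is_deriveD h1 (is_deriveZ a h2)).
split.
- have [C C0 fC] := good_bound gf; have [D D0 gD] := good_bound gg.
  exists (C + `|a| * D) => w t; rewrite (le_trans (ler_normD _ _))// mulrDl lerD//.
  by rewrite normrM -mulrA ler_wpM2l.
- have [ft gft dft] := good_dt gf; have [gt ggt dgt] := good_dt gg.
  exists (fun w t => ft w t + a * gt w t); first by exists ft, gt.
  split=> [w t|j]; first by apply: dlin; [exact: dft|exact: dgt].
  have [fj gfj dfj] := good_slope j gf dft; have [gj ggj dgj] := good_slope j gg dgt.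
  exists (fun w t => fj w t + a * gj w t); first by exists fj, gj.
  move=> w c t s.
  by apply: (is_derive_eq (dlin _ _ _ _ _ (dfj w c t s) (dgj w c t s))); ring.
- have [F gF dF] := good_anti gf; have [G gG dG] := good_anti gg.
  exists (fun w t => F w t + a * G w t); first by exists F, G.
  by move=> w t; apply: dlin; [exact: dF|exact: dG].
Qed.

Lemma good_pcons n (h : W R n.+1 -> R -> R) x : good h ->
  good (fun w t => h (pcons x w) t).
Proof.
move=> gh.
exists (fun k => exists2 h', good h' & k = fun w t => h' (pcons x w) t);
  last by exists h.
move=> _ {h gh} [h gh ->]; split.
- have [C C0 hC] := good_bound gh; exists C => w t.
  rewrite (le_trans (hC _ _))// ler_wpM2l// rhoW_pcons ler_piMl ?rhoW_ge0//.
  exact: rho2_le1.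
- have [ht ght dht] := good_dt gh; exists (fun w t => ht (pcons x w) t); first by exists ht.
  split=> [w t|[b i]]; first exact: dht.
  have [hj ghj dhj] := good_slope (b, lift ord0 i) gh dht.
  exists (fun w t => hj (pcons x w) t); first by exists hj.
  move=> w c t s; have := dhj (pcons x w) c t s; rewrite upd_pconsS.
  by under [X in is_derive _ _ X]eq_fun do rewrite upd_pconsS.
- have [H gH dH] := good_anti gh; exists (fun w t => H (pcons x w) t); first by exists H.
  by move=> w t; exact: dH.
Qed.

Lemma good_cont_t n (g : W R n -> R -> R) w : good g -> continuous (g w).
Proof. by move=> /good_dt[gt _ dt]; exact: is_derive_continuous (dt w). Qed.

Lemma good_cont_slope n (g : W R n -> R -> R) w j c t : good g ->
  continuous (fun s => g (upd w j s) (t + c * s)).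
Proof.
move=> gg; have [gt _ dt] := good_dt gg; have [gj _ dj] := good_slope j gg dt.
exact: is_derive_continuous (dj w c t).
Qed.

Lemma good_cont_crd n (g : W R n -> R -> R) w j t : good g ->
  continuous (fun s => g (upd w j s) t).
Proof.
move=> gg; have := @good_cont_slope _ _ w j 0 t gg.
by under [X in continuous X -> _]eq_fun do rewrite mul0r addr0.
Qed.

(* Separate continuity in the coordinates suffices for joint measurability. *)
Lemma measurable_sep_cont d (X : measurableType d) n (f : X * n.-tuple RR -> R) :
  (forall w, measurable_fun setT (fun x => f (x, w))) ->
  (forall x w j, continuous (fun s => f (x, updT w j s))) -> measurable_fun setT f.
Proof.
elim: n d X f => [|n IHn] d X f mf cf.
  have -> : f = (fun x => f (x, [tuple])) \o fst.
    by apply/funext => -[x w]/=; rewrite (tuple0 w).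
  exact: measurableT_comp.
pose F (p : (X * RR) * n.-tuple RR) : R := f (p.1.1, Rn_cons (p.1.2, p.2)).
have mF : measurable_fun setT F.
  apply: IHn => [w|[x y] w j].
    apply: measurable_caratheodory => [y|x]; first exact: (mf (Rn_cons (y, w))).
    have -> : (fun y => F ((x, y), w)) =
        (fun s => f (x, updT (Rn_cons (0 : RR, w)) ord0 s)).
      apply/funext => s; rewrite /F/=; congr (f (x, _)); apply: eq_from_tnth => k.
      rewrite tnth_updT; case: (unliftP ord0 k) => [i|] ->; first by
        rewrite eq_sym (negPf (neq_lift _ _)) !tnthS.
      by rewrite tnth0 eqxx.
    exact: cf.
  have -> : (fun s => F ((x, y), updT w j s)) =
      (fun s => f (x, updT (Rn_cons (y, w)) (lift ord0 j) s)).
    apply/funext => s; rewrite /F/=; congr (f (x, _)); apply: eq_from_tnth => k.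
    rewrite tnth_updT; case: (unliftP ord0 k) => [i|] ->.
      by rewrite !tnthS tnth_updT (inj_eq lift_inj).
    by rewrite !tnth0 (negPf (neq_lift _ _)).
  exact: cf.
have mu : measurable_fun setT (fun p : X * n.+1.-tuple RR =>
    ((p.1, tnth p.2 ord0), [tuple of behead p.2]) : (X * RR) * n.-tuple RR).
  apply/measurable_fun_pairP; split.
    apply/measurable_fun_pairP; split; first exact: measurable_fst.
    exact: (measurableT_comp (measurable_tnth ord0) measurable_snd).
  have mb : measurable_fun setT
    (fun u : n.+1.-tuple RR => [tuple of behead u] : n.-tuple RR).
    exact: measurable_behead.
  exact: (measurableT_comp mb measurable_snd).
have -> : f = F \o (fun p : X * n.+1.-tuple RR =>
    ((p.1, tnth p.2 ord0), [tuple of behead p.2])).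
  apply/funext => -[x w]; rewrite /F/=; congr (f (x, _)).
  by case/tupleP: w => y w; apply: val_inj.
exact: (measurableT_comp mF mu).
Qed.

Lemma good_measurable n (g : W R n -> R -> R) : good g ->
  measurable_fun setT (fun p : W R n * RR => g p.1 p.2).
Proof.
move=> gg.
have m1 (w2 : n.-tuple RR) :
    measurable_fun setT (fun p : RR * n.-tuple RR => g (p.2, w2) p.1).
  apply: measurable_sep_cont => [w|t w j].
    exact: (measurable_cont (@good_cont_t _ _ (w, w2) gg)).
  exact: (@good_cont_crd _ _ (w, w2) (false, j) t gg).
have m2 : measurable_fun setT (fun p : (RR * n.-tuple RR) * n.-tuple RR =>
    g (p.1.2, p.2) p.1.1).
  apply: measurable_sep_cont => [w|[t w] w' j]; first exact: m1.
  exact: (@good_cont_crd _ _ (w, w') (true, j) t gg).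
have mu : measurable_fun setT (fun p : W R n * RR =>
    ((p.2, p.1.1), p.1.2) : (RR * n.-tuple RR) * n.-tuple RR).
  apply/measurable_fun_pairP; split.
    apply/measurable_fun_pairP; split; first exact: measurable_snd.
    exact: (measurableT_comp measurable_fst measurable_fst).
  exact: (measurableT_comp measurable_snd measurable_fst).
have -> : (fun p : W R n * RR => g p.1 p.2) = (fun p : (RR * n.-tuple RR) * n.-tuple RR =>
    g (p.1.2, p.2) p.1.1) \o (fun p : W R n * RR => ((p.2, p.1.1), p.1.2)).
  by apply/funext => -[[w1 w2] t].
exact: (measurableT_comp m2 mu).
Qed.

Lemma rhoW_le n (w : W R n) j : rhoW w <= rho (crd w j).
Proof.
have r01 k : 0 <= rho (crd w k) <= 1 by rewrite rho_ge0 rho_le1.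
case: j => b i; rewrite /rhoW (bigD1 i)//=.
rewrite (@le_trans _ _ (rho (crd w (false, i)) * rho (crd w (true, i))))//.
  rewrite ler_piMr ?mulr_ge0 ?rho_ge0//; apply: prodr_ile1 => k _.
  by rewrite mulr_ge0 ?rho_ge0// mulr_ile1 ?rho_ge0 ?rho_le1.
by case: b; [rewrite ler_piMl|rewrite ler_piMr]; rewrite ?rho_ge0 ?rho_le1.
Qed.

Lemma rhoW_upd n (w : W R n) j s : rhoW (upd w j s) <= rho s.
Proof. by rewrite (le_trans (rhoW_le _ j))// crd_upd eqxx. Qed.

Lemma good_slope_dom n (g : W R n -> R -> R) C w j c t :
  0 <= C -> (forall w t, `|g w t| <= C * rhoW w) ->
  forall s, `|g (upd w j s) (t + c * s)| <= C * rho s.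
Proof. by move=> C0 gC s; rewrite (le_trans (gC _ _))// ler_wpM2l// rhoW_upd. Qed.

Lemma good_slope_integrable n (g : W R n -> R -> R) w j c t : good g ->
  leb.-integrable setT (EFin \o (fun s => g (upd w j s) (t + c * s))).
Proof.
move=> gg; have [C C0 gC] := good_bound gg.
apply: (dom_rho_integrable _ (good_slope_dom w j c t C0 gC)).
by apply: measurable_cont; exact: good_cont_slope.
Qed.

Lemma slope_ibp n (G Gj g : W R n -> R -> R) j w c t : good G -> good Gj -> good g ->
  slope_derive j G Gj g ->
  \int[leb]_s Gj (upd w j s) (t + c * s) = - c * \int[leb]_s g (upd w j s) (t + c * s).
Proof.
move=> gG gGj gg dG.
have i1 := good_slope_integrable w j c t gGj.
have i2 := good_slope_integrable w j c t gg.
have [C C0 GC] := good_bound gG; have [D D0 GD] := good_bound gGj.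
have [E E0 gE] := good_bound gg.
apply/eqP; rewrite mulNr -addr_eq0 -RintegralZl// -RintegralD//; last exact: integrableZ_fin.
apply/eqP; apply: (@Rintegral_derive0 _ (fun s => G (upd w j s) (t + c * s)) _
  (D + `|c| * E) C (dG w c t)).
- move=> s; apply: cvgD; first exact: good_cont_slope.
  by apply: cvgM; [exact: cvg_cst|exact: good_cont_slope].
- move=> s; rewrite (le_trans (ler_normD _ _))// mulrDl lerD//.
    exact: good_slope_dom.
  by rewrite normrM -mulrA ler_wpM2l//; exact: good_slope_dom.
- exact: good_slope_dom.
Qed.

(* Integrating by parts along the slope [t - c * s / 2] trades a factor [c] for a
   [t]-antiderivative and an [s]-derivative, so a factor [1 + c ^+ 2] is absorbed. *)
Lemma good_trick n (g : W R n -> R -> R) j : good g -> exists2 h, good h &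
  forall w c t, (1 + c ^+ 2) * \int[leb]_s g (upd w j s) (t - 2^-1 * (c * s)) =
    \int[leb]_s h (upd w j s) (t - 2^-1 * (c * s)).
Proof.
move=> gg; have [G gG dG] := good_anti gg; have [Gj gGj dGj] := good_slope j gG dG.
have [H gH dH] := good_anti gGj; have [Hj gHj dHj] := good_slope j gH dH.
(* Each of the two integrations by parts has slope [- c / 2] and yields [c / 2]; the factor [4]
   restores [c ^+ 2]. *)
exists (fun w t => g w t + 4 * Hj w t); first exact: good_lin.
move=> w c t.
have E (k : W R n -> R -> R) : (fun s => k (upd w j s) (t - 2^-1 * (c * s))) =
    (fun s => k (upd w j s) (t + (- (2^-1 * c)) * s)).
  by apply/funext => s; rewrite mulNr mulrA.
rewrite (E g) (E (fun w t => g w t + 4 * Hj w t)).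
have iH := good_slope_integrable w j (- (2^-1 * c)) t gHj.
have ig := good_slope_integrable w j (- (2^-1 * c)) t gg.
rewrite RintegralD ?RintegralZl//; last exact: (integrableZ_fin 4 iH).
rewrite (slope_ibp w _ t gH gHj gGj dHj) (slope_ibp w _ t gG gGj gg dGj).
by field.
Qed.

End good_class.

(** * The Radon transform and its inversion *)

Section radon.
Context {R : realType}.
Local Notation leb := (@lebesgue_measure R).
Local Notation RR := (measurableTypeR R).
Local Notation Cn := (lebesgue_Cn R).

Lemma is_derive_shift (f : R -> R) (x a d : R) : is_derive (x - a) 1 f d ->
  is_derive x 1 (fun x => f (x - a)) d.
Proof.
have -> : x - a = - a + 1 * x by rewrite mul1r addrC.
move=> /is_derive_affine; rewrite mul1r.
suff -> : (fun x => f (- a + 1 * x)) = (fun x => f (x - a)) by [].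
by apply/funext => y; rewrite mul1r addrC.
Qed.

(* [omega z w] is the imaginary part of the Hermitian product of [z] and [w], and
   [RT] the real-valued Heisenberg Radon transform. *)
Definition omega n (z w : W R n) : R := \sum_(i < n)
  (crd z (true, i) * crd w (false, i) - crd z (false, i) * crd w (true, i)).

(* [dualc z j] is the coefficient of the coordinate [crd w j] in [omega z w]. *)
Definition dualc n (z : W R n) (j : bool * 'I_n) : R :=
  if j.1 then - crd z (false, j.2) else crd z (true, j.2).

Definition RT n (g : W R n -> R -> R) (z : W R n) (t : R) : R :=
  \int[Cn n]_w g w (t - 2^-1 * omega z w).

Lemma omega_upd n (z w : W R n) j s :
  omega z (upd w j s) = omega z w - dualc z j * crd w j + dualc z j * s.
Proof.
case: j => b i; rewrite /omega (bigD1 i)//= [in RHS](bigD1 i)//= !crd_upd !xpair_eqE eqxx.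
have -> : \sum_(k < n | k != i) (crd z (true, k) * crd (upd w (b, i) s) (false, k)
    - crd z (false, k) * crd (upd w (b, i) s) (true, k)) =
  \sum_(k < n | k != i) (crd z (true, k) * crd w (false, k)
    - crd z (false, k) * crd w (true, k)).
  by apply: eq_bigr => k ki; rewrite !crd_upd !xpair_eqE (negPf ki) !andbF.
by case: b; rewrite /dualc/=; ring.
Qed.

Lemma omega_pcons n x y (z w : W R n) : omega (pcons y z) (pcons x w) =
  y.2 * x.1 - y.1 * x.2 + omega z w.
Proof.
rewrite /omega big_ord_recl !crd_pcons0; congr (_ + _).
by apply: eq_bigr => i _; rewrite !crd_pconsS.
Qed.

Lemma measurable_omega n :
  measurable_fun setT (fun p : W R n * W R n => omega p.1 p.2).
Proof.
apply: measurable_sum => i; apply: measurable_funB; apply: measurable_funM.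
- exact: (measurableT_comp (measurable_crd _) measurable_fst).
- exact: (measurableT_comp (measurable_crd _) measurable_snd).
- exact: (measurableT_comp (measurable_crd _) measurable_fst).
- exact: (measurableT_comp (measurable_crd _) measurable_snd).
Qed.

Lemma measurable_good_comp d (X : measurableType d) n (g : W R n -> R -> R)
    (u : X -> W R n) (s : X -> R) : good g -> measurable_fun setT u ->
  measurable_fun setT s -> measurable_fun setT (fun x => g (u x) (s x)).
Proof.
move=> gg mu ms; have m : measurable_fun setT (fun x => (u x, s x) : W R n * RR).
  by apply/measurable_fun_pairP; split; [exact: mu|exact: ms].
exact: (measurableT_comp (good_measurable gg) m).
Qed.

Lemma measurable_RT_integrand n (g : W R n -> R -> R) z t : good g ->
  measurable_fun setT (fun w => g w (t - 2^-1 * omega z w)).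
Proof.
move=> gg; apply: measurable_good_comp => //.
apply: measurable_funB => //; apply: measurable_funM => //.
exact: (measurableT_comp (@measurable_omega n) (pair1_measurable z)).
Qed.

Lemma RT_integrable n (g : W R n -> R -> R) z t : good g ->
  (Cn n).-integrable setT (EFin \o (fun w => g w (t - 2^-1 * omega z w))).
Proof.
move=> gg; have [C C0 gC] := good_bound gg.
apply: (dom_integrable (measurable_RT_integrand z t gg) (integrable_rhoWC n C)) => w.
exact: gC.
Qed.

Lemma measurable_RT n (g : W R n -> R -> R) : good g ->
  measurable_fun setT (fun p : W R n * RR => RT g p.1 p.2).
Proof.
move=> gg; apply: (measurable_Rintegral (Cn n) (F := fun q : (W R n * RR) * W R n =>
  g q.2 (q.1.2 - 2^-1 * omega q.1.1 q.2))).
apply: measurable_good_comp => //.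
apply: measurable_funB; first exact: (measurableT_comp measurable_snd measurable_fst).
apply: measurable_funM => //.
have m : measurable_fun setT (fun q : (W R n * RR) * W R n => (q.1.1, q.2)).
  apply/measurable_fun_pairP; split; last exact: measurable_snd.
  exact: (measurableT_comp measurable_fst measurable_fst).
exact: (measurableT_comp (@measurable_omega n) m).
Qed.

(** Along a line in coordinate [j], [omega z] is affine with slope [dualc z j], so [good_trick]
    applies on every such line and [Cn_vanish] passes to the integral over C^n. *)
Lemma RT_trick n (g : W R n -> R -> R) j : good g -> exists2 h, good h &
  forall z t, (1 + dualc z j ^+ 2) * RT g z t = RT h z t.
Proof.
move=> gg; have [h gh E] := good_trick j gg; exists h => // z t.
have [C C0 gC] := good_bound gg; have [D D0 hD] := good_bound gh.
apply/eqP; rewrite -subr_eq0; apply/eqP.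
have ig := RT_integrable z t gg; have ih := RT_integrable z t gh.
rewrite /RT; apply: (etrans (congr1 (fun x => x - _) (esym (RintegralZl _ measurableT ig)))).
apply: (etrans (esym (RintegralB measurableT (integrableZ_fin _ ig) ih))).
apply: (@Cn_vanish _ _ _ ((1 + dualc z j ^+ 2) * C + D) j).
- apply: measurable_funB; last exact: measurable_RT_integrand.
  by apply: measurable_funM => //; exact: measurable_RT_integrand.
- move=> w; rewrite (le_trans (ler_normB _ _))// [leRHS]mulrDl lerD//.
  by rewrite normrM -mulrA ger0_norm ?(ltW (oneDsqr_gt0 _))// ler_wpM2l// (ltW (oneDsqr_gt0 _)).
move=> w; pose tau := t - 2^-1 * (omega z w - dualc z j * crd w j).
have phE s : t - 2^-1 * omega z (upd w j s) = tau - 2^-1 * (dualc z j * s).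
  by rewrite omega_upd /tau; ring.
have pE (k : W R n -> R -> R) : (fun s => k (upd w j s) (t - 2^-1 * omega z (upd w j s))) =
    (fun s => k (upd w j s) (tau + - (2^-1 * dualc z j) * s)).
  by apply/funext => s; rewrite phE mulNr mulrA.
have jg : leb.-integrable setT
    (EFin \o (fun s => g (upd w j s) (t - 2^-1 * omega z (upd w j s)))).
  by rewrite pE; exact: good_slope_integrable.
have jh : leb.-integrable setT
    (EFin \o (fun s => h (upd w j s) (t - 2^-1 * omega z (upd w j s)))).
  by rewrite pE; exact: good_slope_integrable.
rewrite RintegralB//; last exact: integrableZ_fin.
rewrite RintegralZl//; apply/eqP; rewrite subr_eq0; apply/eqP.
have pE' (k : W R n -> R -> R) :
  \int[leb]_s k (upd w j s) (t - 2^-1 * omega z (upd w j s)) =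
  \int[leb]_s k (upd w j s) (tau - 2^-1 * (dualc z j * s)).
  by apply: eq_Rintegral => s _; rewrite phE.
by rewrite !pE' E.
Qed.

(** Up to sign and order, the [dualc z j] are the coordinates of [z]. *)
Lemma prod_dualc n (z : W R n) :
  (\prod_(j : bool * 'I_n) (1 + dualc z j ^+ 2)) * rhoW z = 1.
Proof.
rewrite (eq_bigr (fun j => 1 + dualc z (j.1, j.2) ^+ 2)); last by move=> [].
rewrite -(pair_bigA _ (fun b i => 1 + dualc z (b, i) ^+ 2)) big_bool /dualc/=.
rewrite -!big_split/= big1// => i _.
by rewrite sqrrN mulrACA !oneDsqrK mulr1.
Qed.

(** One application of [RT_trick] per real coordinate gains exactly [rhoW z]. The second Radon
    transform then converges without a proof that [RT g] is itself [good]. *)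
Lemma RT_bound n (g : W R n -> R -> R) : good g ->
  exists2 C, 0 <= C & forall z t, `|RT g z t| <= C * rhoW z.
Proof.
move=> gg.
have [h gh E] : exists2 h, good h & forall z t,
    (\prod_(j : bool * 'I_n) (1 + dualc z j ^+ 2)) * RT g z t = RT h z t.
  elim: (index_enum _) => [|j s [h gh E]].
    by exists g => // z t; rewrite big_nil mul1r.
  have [k gk E'] := RT_trick j gh; exists k => // z t.
  by rewrite big_cons -mulrA E E'.
have [C C0 hC] := good_bound gh.
exists (C * \int[Cn n]_w rhoW w) => [|z t].
  by rewrite mulr_ge0//; apply: Rintegral_ge0 => w _; exact: rhoW_ge0.
have P0 : 0 < \prod_(j : bool * 'I_n) (1 + dualc z j ^+ 2).
  by apply: prodr_gt0 => j _; exact: oneDsqr_gt0.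
rewrite -(ler_pM2l P0) -(gtr0_norm P0) -normrM E (gtr0_norm P0) mulrCA prod_dualc mulr1.
rewrite -RintegralZl//; last exact: rhoW_integrable.
apply: (le_dom_Rintegral (measurable_RT_integrand z t gh) (integrable_rhoWC n C)) => w.
exact: hC.
Qed.

Lemma is_derive_RT n (g g' : W R n -> R -> R) z (t : R) : good g -> good g' -> is_dt g g' ->
  is_derive t 1 (RT g z) (RT g' z t).
Proof.
move=> gg gg' dg; have [C C0 gC] := good_bound gg; have [D D0 gD] := good_bound gg'.
apply: (@is_derive_Rintegral _ _ _ (Cn n) (fun t w => g w (t - 2^-1 * omega z w))
  (fun t w => g' w (t - 2^-1 * omega z w)) (fun w => D * rhoW w)).
- by move=> s; exact: measurable_RT_integrand.
- move=> s; exists (fun w => C * rhoW w); first exact: integrable_rhoWC.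
  by move=> w; exact: gC.
- by move=> s w; apply: is_derive_shift; exact: dg.
- exact: integrable_rhoWC.
- by move=> s w _; exact: gD.
Qed.

Lemma measurable_RRT_integrand n (g : W R n -> R -> R) z t : good g ->
  measurable_fun setT (fun w => RT g w (t - 2^-1 * omega z w)).
Proof.
move=> gg; have m : measurable_fun setT (fun w => (w, t - 2^-1 * omega z w) : W R n * RR).
  have ms : measurable_fun setT (fun w => t - 2^-1 * omega z w).
    apply: measurable_funB => //; apply: measurable_funM => //.
    exact: (measurableT_comp (@measurable_omega n) (pair1_measurable z)).
  by apply/measurable_fun_pairP; split; [exact: measurable_id|exact: ms].
exact: (measurableT_comp (measurable_RT gg) m).
Qed.

Lemma RRT_integrable n (g : W R n -> R -> R) z t : good g ->
  (Cn n).-integrable setT (EFin \o (fun w => RT g w (t - 2^-1 * omega z w))).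
Proof.
move=> gg; have [C C0 gC] := RT_bound gg.
apply: (dom_integrable (measurable_RRT_integrand z t gg) (integrable_rhoWC n C)) => w.
exact: gC.
Qed.

Lemma is_derive_RRT n (g g' : W R n -> R -> R) z (t : R) : good g -> good g' -> is_dt g g' ->
  is_derive t 1 (RT (RT g) z) (RT (RT g') z t).
Proof.
move=> gg gg' dg; have [C C0 gC] := RT_bound gg; have [D D0 gD] := RT_bound gg'.
apply: (@is_derive_Rintegral _ _ _ (Cn n) (fun t w => RT g w (t - 2^-1 * omega z w))
  (fun t w => RT g' w (t - 2^-1 * omega z w)) (fun w => D * rhoW w)).
- by move=> s; exact: measurable_RRT_integrand.
- move=> s; exists (fun w => C * rhoW w); first exact: integrable_rhoWC.
  by move=> w; exact: gC.
- by move=> s w; apply: is_derive_shift; exact: is_derive_RT.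
- exact: integrable_rhoWC.
- by move=> s w _; exact: gD.
Qed.

End radon.

(** * Inversion by induction on the number of complex coordinates *)

Section head_plane.
Context {R : realType}.
Local Notation leb := (@lebesgue_measure R).
Local Notation RR := (measurableTypeR R).
Local Notation Cn := (lebesgue_Cn R).
Local Notation plane := (@lebesgue_plane R).

(* The Radon transform in the first complex coordinate only. *)
Definition headT n (h : W R n.+1 -> R -> R) (y : RR * RR) (w : W R n) (s : R) : R :=
  \int[plane]_x h (pcons x w) (s - 2^-1 * (y.2 * x.1 - y.1 * x.2)).

Lemma measurable_headT_integrand n (h : W R n.+1 -> R -> R) y w s : good h ->
  measurable_fun setT (fun x : RR * RR => h (pcons x w) (s - 2^-1 * (y.2 * x.1 - y.1 * x.2))).
Proof.
move=> gh; apply: measurable_good_comp => //.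
  exact: (measurableT_comp (measurable_pcons (n := n)) (pair1_measurable w)).
apply: measurable_funB => //; apply: measurable_funM => //.
by apply: measurable_funB; apply: measurable_funM.
Qed.

Lemma good_pcons_dom n (h : W R n.+1 -> R -> R) C :
  (forall w t, `|h w t| <= C * rhoW w) ->
  forall x w t, `|h (pcons x w) t| <= C * rhoW w * rho2 x.
Proof. by move=> hC x w t; rewrite (le_trans (hC _ _))// rhoW_pcons -mulrA (mulrC (rhoW w)). Qed.

Lemma measurable_headT d (X : measurableType d) n (h : W R n.+1 -> R -> R)
    (y : X -> RR * RR) (w : X -> W R n) (s : X -> R) : good h ->
  measurable_fun setT y -> measurable_fun setT w -> measurable_fun setT s ->
  measurable_fun setT (fun x => headT h (y x) (w x) (s x)).
Proof.
move=> gh my mw ms.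
apply: (measurable_Rintegral plane (F := fun p : X * (RR * RR) =>
  h (pcons p.2 (w p.1)) (s p.1 - 2^-1 * ((y p.1).2 * p.2.1 - (y p.1).1 * p.2.2)))).
have my' := measurableT_comp my (@measurable_fst _ _ X (RR * RR)%type).
apply: measurable_good_comp => //.
  have m : measurable_fun setT (fun p : X * (RR * RR) => (w p.1, p.2)).
    apply/measurable_fun_pairP; split; last exact: measurable_snd.
    exact: (measurableT_comp mw measurable_fst).
  exact: (measurableT_comp (measurable_pcons (n := n)) m).
apply: measurable_funB; first exact: (measurableT_comp ms measurable_fst).
apply: measurable_funM => //; apply: measurable_funB; apply: measurable_funM.
- exact: (measurableT_comp measurable_snd my').
- exact: (measurableT_comp measurable_fst measurable_snd).
- exact: (measurableT_comp measurable_fst my').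
- exact: (measurableT_comp measurable_snd measurable_snd).
Qed.

Lemma plane_marginal1 (F : RR * RR -> R) C : measurable_fun setT F ->
  (forall x, `|F x| <= C * rho2 x) ->
  leb.-integrable setT (EFin \o (fun a => \int[leb]_b F (a, b))).
Proof.
move=> mF FC; apply: (@dom_rho_integrable _ _ (C * pi)) => [|a].
  exact: (measurable_Rintegral leb mF).
rewrite mulrAC; apply: dom_rho_integral => [|b]; last by rewrite -mulrA; exact: FC.
exact: (measurableT_comp mF (pair1_measurable a)).
Qed.

Lemma plane_marginal2 (F : RR * RR -> R) C : measurable_fun setT F ->
  (forall x, `|F x| <= C * rho2 x) ->
  leb.-integrable setT (EFin \o (fun b => \int[leb]_a F (a, b))).
Proof.
move=> mF FC; apply: (@plane_marginal1 (fun x => F (x.2, x.1)) C).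
  apply: (measurableT_comp mF).
  by apply/measurable_fun_pairP; split; [exact: measurable_snd|exact: measurable_fst].
by move=> x; rewrite (le_trans (FC _))// /rho2/= (mulrC (rho x.2)).
Qed.

Lemma headT_trick1 n (h : W R n.+1 -> R -> R) : good h -> exists2 k, good k &
  forall y w s, (1 + y.2 ^+ 2) * headT h y w s = headT k y w s.
Proof.
move=> gh; have [k gk E] := good_trick (false, ord0) gh; exists k => // y w s.
have [C C0 hC] := good_bound gh; have [D D0 kD] := good_bound gk.
have mh := measurable_headT_integrand y w s gh.
have mk := measurable_headT_integrand y w s gk.
have hd x := good_pcons_dom hC x w (s - 2^-1 * (y.2 * x.1 - y.1 * x.2)).
have kd x := good_pcons_dom kD x w (s - 2^-1 * (y.2 * x.1 - y.1 * x.2)).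
rewrite /headT (plane_fubini2 mh hd) (plane_fubini2 mk kd).
apply: (etrans (esym (RintegralZl _ measurableT (plane_marginal2 mh hd)))).
apply: eq_Rintegral => b _.
have := E (pcons (0, b) w) y.2 (s + 2^-1 * (y.1 * b)).
have P (f : W R n.+1 -> R -> R) : \int[leb]_a f (upd (pcons (0, b) w) (false, ord0) a)
      (s + 2^-1 * (y.1 * b) - 2^-1 * (y.2 * a)) =
    \int[leb]_a f (pcons (a, b) w) (s - 2^-1 * (y.2 * a - y.1 * b)).
  by apply: eq_Rintegral => a _; rewrite upd_pcons0/=; congr (f _ _); ring.
by rewrite !P.
Qed.

Lemma headT_trick2 n (h : W R n.+1 -> R -> R) : good h -> exists2 k, good k &
  forall y w s, (1 + y.1 ^+ 2) * headT h y w s = headT k y w s.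
Proof.
move=> gh; have [k gk E] := good_trick (true, ord0) gh; exists k => // y w s.
have [C C0 hC] := good_bound gh; have [D D0 kD] := good_bound gk.
have mh := measurable_headT_integrand y w s gh.
have mk := measurable_headT_integrand y w s gk.
have hd x := good_pcons_dom hC x w (s - 2^-1 * (y.2 * x.1 - y.1 * x.2)).
have kd x := good_pcons_dom kD x w (s - 2^-1 * (y.2 * x.1 - y.1 * x.2)).
rewrite /headT (plane_fubini1 mh hd) (plane_fubini1 mk kd).
apply: (etrans (esym (RintegralZl _ measurableT (plane_marginal1 mh hd)))).
apply: eq_Rintegral => a _.
have := E (pcons (a, 0) w) (- y.1) (s - 2^-1 * (y.2 * a)).
have P (f : W R n.+1 -> R -> R) : \int[leb]_b f (upd (pcons (a, 0) w) (true, ord0) b)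
      (s - 2^-1 * (y.2 * a) - 2^-1 * (- y.1 * b)) =
    \int[leb]_b f (pcons (a, b) w) (s - 2^-1 * (y.2 * a - y.1 * b)).
  by apply: eq_Rintegral => b _; rewrite upd_pcons0/=; congr (f _ _); ring.
by rewrite !P sqrrN.
Qed.

(** Decay in [w] is inherited from [h], decay in [y] comes from integrating by parts in both parts
    of [x]. Having both at once is what allows the exchange of integrals in [RRT_inversion]. *)
Lemma headT_bound n (h : W R n.+1 -> R -> R) : good h -> exists2 C, 0 <= C &
  forall y w s, `|headT h y w s| <= C * rhoW w * rho2 y.
Proof.
move=> gh; have [k gk E1] := headT_trick1 gh; have [l gl E2] := headT_trick2 gk.
have [C C0 lC] := good_bound gl.
exists (C * pi ^+ 2) => [|y w s]; first by rewrite mulr_ge0// exprn_ge0// pi_ge0.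
have p0 : 0 < (1 + y.1 ^+ 2) * (1 + y.2 ^+ 2) by rewrite mulr_gt0// oneDsqr_gt0.
have E : (1 + y.1 ^+ 2) * (1 + y.2 ^+ 2) * headT h y w s = headT l y w s.
  by rewrite -mulrA E1 E2.
rewrite -(ler_pM2l p0) -{1}(gtr0_norm p0) -normrM E.
have -> : (1 + y.1 ^+ 2) * (1 + y.2 ^+ 2) * (C * pi ^+ 2 * rhoW w * rho2 y) =
    C * rhoW w * pi ^+ 2 * (((1 + y.1 ^+ 2) * rho y.1) * ((1 + y.2 ^+ 2) * rho y.2)).
  by rewrite /rho2; ring.
rewrite !oneDsqrK !mulr1 -plane_rho2 -RintegralZl//; last exact: rho2_integrable.
apply: (le_dom_Rintegral (measurable_headT_integrand y w s gl)).
  by apply: integrableZ_fin; exact: rho2_integrable.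
by move=> x; exact: good_pcons_dom.
Qed.

Lemma lipschitz_of_bounded_derive (f f' : R -> R) (D : R) : (forall x : R, is_derive x 1 f (f' x)) ->
  (forall x, `|f' x| <= D) -> forall a b, `|f a - f b| <= D * `|a - b|.
Proof.
move=> df fD.
suff h a b : a < b -> `|f a - f b| <= D * `|a - b|.
  move=> a b; have [ab|ba|->] := ltgtP a b; first exact: h.
    by rewrite distrC (distrC a); exact: h.
  by rewrite !subrr normr0 mulr0.
move=> ab; have cf : {within `[a, b], continuous f}.
  by apply: continuous_subspaceT; exact: is_derive_continuous df.
have [c _ E] := @MVT _ f f' _ _ ab (fun x _ => df x) cf.
by rewrite distrC E normrM (distrC a) ler_wpM2r.
Qed.

(** Both parts of the coordinate vary, so separate continuity is too weak; a Lipschitz bound in the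
    real part, uniform in the imaginary part, reduces the claim to continuity in the latter. *)
Lemma good_cvg_head n (h : W R n.+1 -> R -> R) w (y : RR * RR) t (u v : nat -> R) : good h ->
  u k @[k --> \oo] --> y.1 -> v k @[k --> \oo] --> y.2 ->
  h (pcons (u k, v k) w) t @[k --> \oo] --> h (pcons y w) t.
Proof.
case: y => y1 y2 gh /= cu cv.
have [ht _ dt] := good_dt gh; have [hj ghj dj] := good_slope (false, ord0) gh dt.
have [D D0 hD] := good_bound ghj.
have lip a a' b : `|h (pcons (a, b) w) t - h (pcons (a', b) w) t| <= D * `|a - a'|.
  apply: (@lipschitz_of_bounded_derive (fun a => h (pcons (a, b) w) t)
    (fun a => hj (pcons (a, b) w) t) D _ _ a a') => x.
    have := dj (pcons (0, b) w) 0 t x; rewrite mul0r addr0 mul0r addr0 upd_pcons0/=.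
    suff -> : (fun s => h (upd (pcons (0, b) w) (false, ord0) s) (t + 0 * s)) =
      (fun a => h (pcons (a, b) w) t) by [].
    by apply/funext => s; rewrite mul0r addr0 upd_pcons0.
  have /le_trans := hD (pcons (x, b) w) t; apply; rewrite ler_piMr//.
  by rewrite (le_trans (rhoW_le _ (false, ord0)))// rho_le1.
have c2 : h (pcons (y1, v k) w) t @[k --> \oo] --> h (pcons (y1, y2) w) t.
  have cc : continuous (fun b => h (pcons (y1, b) w) t).
    have := @good_cont_crd _ _ _ (pcons (y1, 0) w) (true, ord0) t gh.
    suff -> : (fun s => h (upd (pcons (y1, 0) w) (true, ord0) s) t) =
      (fun b => h (pcons (y1, b) w) t) by [].
    by apply/funext => s; rewrite upd_pcons0.
  exact: (continuous_cvg _ (cc y2) cv).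
have c1 : h (pcons (u k, v k) w) t - h (pcons (y1, v k) w) t @[k --> \oo] --> (0 : R).
  apply: norm_cvg0; apply: (@squeeze_cvgr _ _ _ _ (cst 0) (fun k => D * `|u k - y1|)).
  - by near=> k; rewrite normr_ge0 lip.
  - exact: cvg_cst.
  - rewrite -[X in _ --> X](mulr0 D); apply: cvgM; first exact: cvg_cst.
    by rewrite -[X in _ --> X](normr0 R); apply: cvg_norm; exact/subr_cvg0.
rewrite -[X in _ --> X]add0r.
have -> : (fun k => h (pcons (u k, v k) w) t) = (fun k =>
    (h (pcons (u k, v k) w) t - h (pcons (y1, v k) w) t) + h (pcons (y1, v k) w) t).
  by apply/funext => k; rewrite subrK.
exact: cvgD c1 c2.
Unshelve. all: by end_near. Qed.

Lemma good_chain n (g : W R n -> R -> R) : good g -> exists2 A : nat -> W R n -> R -> R,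
  A 0%N = g & (forall i, good (A i)) /\ forall i, is_dt (A i.+1) (A i).
Proof.
move=> gg.
have nx (k : {k : W R n -> R -> R | good k}) : {l : {k : W R n -> R -> R | good k} |
    is_dt (sval l) (sval k)}.
  by apply: cid; have [G gG dG] := good_anti (svalP k); exists (exist _ G gG).
pose A i := iter i (fun k => sval (nx k)) (exist _ g gg).
exists (fun i => sval (A i)) => //; split=> i; first exact: (svalP (A i)).
exact: (svalP (nx (A i))).
Qed.

Lemma rhoW_le1 n (w : W R n) : rhoW w <= 1.
Proof.
apply: prodr_ile1 => i _.
by rewrite mulr_ge0 ?rho_ge0// mulr_ile1 ?rho_ge0 ?rho_le1.
Qed.

Lemma headT_inversion n (K : nat -> W R n.+1 -> R -> R) zeta w t :
  (forall i, good (K i)) -> (forall i, is_dt (K i) (K i.+1)) ->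
  \int[plane]_y headT (K 2%N) y w (t - 2^-1 * (zeta.2 * y.1 - zeta.1 * y.2)) =
  - 16 * pi ^+ 2 * K 0%N (pcons zeta w) t.
Proof.
move=> gK dK; have [A A0 [gA dA]] := good_chain (gK 0%N).
(* Reindexing by antiderivatives: [L] runs through [K 3], [K 2], [K 1], [K 0] and goes on with
   antiderivatives of [K 0]. Thus [L 1] is the integrated [K 2] and [L 3] the recovered [K 0]. *)
pose L i := if i is i'.+3 then A i' else K (3 - i)%N.
have gL i : good (L i) by case: i => [|[|[|i]]]; rewrite /L.
have dL i : is_dt (L i.+1) (L i).
  by case: i => [|[|[|i]]]; rewrite /L//= ?A0; exact: dK.
have [M M0 LM] : exists2 M, 0 <= M & forall i w t, (i <= 7)%N -> `|L i w t| <= M.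
  elim: 7%N => [|m [M M0 IH]].
    have [C C0 LC] := good_bound (gL 0%N); exists C => // i v s.
    by rewrite leqn0 => /eqP ->; rewrite (le_trans (LC _ _))// ler_piMr// rhoW_le1.
  have [C C0 LC] := good_bound (gL m.+1); exists (M + C) => [|i v s]; first exact: addr_ge0.
  rewrite leq_eqVlt ltnS => /orP[/eqP ->|/IH h]; last by rewrite (le_trans (h _ _))// lerDl.
  by rewrite (le_trans (LC _ _))// (@le_trans _ _ C) ?lerDr// ler_piMr// rhoW_le1.
have [C C0 hC] := good_bound (gL 1%N).
have [D D0 hD] := headT_bound (gL 1%N).
pose J i u v x := L i (pcons (u, v) w) x.
(* The outer and the inner phase combine into a single one centred at [zeta], by antisymmetry of the
   form. *)
have JE y s : \int[plane]_x J 1%N x.1 x.2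
    (s - 2^-1 * (y.2 * (x.1 - zeta.1) - y.1 * (x.2 - zeta.2))) =
    headT (L 1%N) y w (s - 2^-1 * (zeta.2 * y.1 - zeta.1 * y.2)).
  by apply: eq_Rintegral => -[a b] _; congr (L _ _ _); ring.
rewrite (_ : pcons zeta w = pcons (zeta.1, zeta.2) w); last by rewrite -surjective_pairing.
rewrite -A0; apply: (etrans _ (@base_inversion _ J zeta t (C * rhoW w) (D * rhoW w) M
  _ _ _ _ _ _ _)).
- by apply: eq_Rintegral => y _; rewrite JE.
- by move=> i u v x; exact: dL.
- by move=> u v; exact: good_cont_t.
- by move=> i u v x; exact: LM.
- have ms : measurable_fun setT (fun p : (RR * RR) * RR => p.2).
    exact: measurable_snd.
  apply: (measurable_good_comp (gL 1%N) _ ms).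
  have m : measurable_fun setT (fun p : (RR * RR) * RR => (w, (p.1.1, p.1.2))).
    apply/measurable_fun_pairP; split; first exact: measurable_cst.
    apply/measurable_fun_pairP; split.
      exact: (measurableT_comp measurable_fst measurable_fst).
    exact: (measurableT_comp measurable_snd measurable_fst).
  exact: (measurableT_comp (measurable_pcons (n := n)) m).
- by move=> u v x; exact: good_pcons_dom.
- move=> x u v cu cv; rewrite /J -surjective_pairing.
  exact: good_cvg_head.
- by move=> y; rewrite JE; exact: hD.
Qed.

Lemma Rintegral_W0 (F : W R 0 -> R) zeta : \int[Cn 0]_w F w = F zeta.
Proof.
have -> : F = cst (F zeta) by apply/funext => w; rewrite (W0 w zeta).
have C1 : Cn 0 setT = 1%E.
  rewrite -setXTT [LHS](product_measure1E (lebesgue_Rn R 0) (lebesgue_Rn R 0))//.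
  by rewrite /= !diracT mule1.
by rewrite Rintegral_cst//= C1 mulr1.
Qed.

(** The form [omega] is additive over complex coordinates, so the two integrals over the first
    coordinate can be collected and evaluated by [headT_inversion]. They use up two of the
    [2 * n.+1] derivatives and freeze the first coordinate at that of [zeta]; the rest is the
    induction hypothesis. *)
Lemma RRT_inversion n (K : nat -> W R n -> R -> R) zeta t :
  (forall i, good (K i)) -> (forall i, is_dt (K i) (K i.+1)) ->
  RT (RT (K (2 * n)%N)) zeta t = (- 16 * pi ^+ 2) ^+ n * K 0%N zeta t.
Proof.
elim: n K zeta t => [|n IHn] K zeta t gK dK.
  rewrite mul1r muln0 /RT (Rintegral_W0 _ zeta) (Rintegral_W0 _ zeta).
  by rewrite /omega !big_ord0 !mulr0 !subr0.
have -> : (2 * n.+1 = (2 * n).+2)%N by rewrite mulnS.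
pose h := K (2 * n).+2; rewrite -/h.
have gh : good h by exact: gK.
have [y0 [zeta' ->]] := pcons_surj zeta.
have [C C0 RC] := RT_bound gh; have [D D0 hD] := headT_bound gh.
have [E E0 hE] := good_bound gh.
pose k w s := K (2 * n)%N (pcons y0 w) s.
have gk : good k by exact: good_pcons.
pose S z' (y : RR * RR) := t - 2^-1 * (y0.2 * y.1 - y0.1 * y.2) - 2^-1 * omega zeta' z'.
have RE y z' s : RT h (pcons y z') s = \int[Cn n]_w headT h y w (s - 2^-1 * omega z' w).
  rewrite /RT (peel1 (C := E)); last 2 first.
  - exact: measurable_RT_integrand.
  - by move=> w; exact: hE.
  apply: eq_Rintegral => w _; apply: eq_Rintegral => x _.
  by congr (h _ _); rewrite omega_pcons; ring.
rewrite {1}/RT (peel1 (C := C)); last 2 first.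
- exact: measurable_RRT_integrand.
- by move=> w; exact: RC.
have iD : plane.-integrable setT (EFin \o (fun x => D * rho2 x)).
  by apply: integrableZ_fin; exact: rho2_integrable.
transitivity (\int[Cn n]_z' (- 16 * pi ^+ 2 * RT k z' (t - 2^-1 * omega zeta' z'))).
  apply: eq_Rintegral => z' _.
  have -> : \int[plane]_y RT h (pcons y z') (t - 2^-1 * omega (pcons y0 zeta') (pcons y z')) =
      \int[plane]_y \int[Cn n]_w headT h y w (S z' y - 2^-1 * omega z' w).
    apply: eq_Rintegral => y _; rewrite RE; apply: eq_Rintegral => w _.
    by congr (headT _ _ _ _); rewrite omega_pcons /S; ring.
  have mo : measurable_fun setT (fun p : (RR * RR) * W R n => omega z' p.2).
    exact: (measurableT_comp (measurableT_comp (@measurable_omega R n) (pair1_measurable z'))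
      measurable_snd).
  have mF : measurable_fun setT (fun p : (RR * RR) * W R n =>
      headT h p.1 p.2 (S z' p.1 - 2^-1 * omega z' p.2)).
    apply: measurable_headT => //.
    apply: measurable_funB; last exact: measurable_funM.
    apply: measurable_funB => //; apply: measurable_funB => //; apply: measurable_funM => //.
    apply: measurable_funB; apply: measurable_funM => //.
      exact: (measurableT_comp measurable_fst measurable_fst).
    exact: (measurableT_comp measurable_snd measurable_fst).
  have FD y w : `|headT h y w (S z' y - 2^-1 * omega z' w)| <= D * rho2 y * rhoW w.
    by rewrite mulrAC; exact: hD.
  (* The first coordinate [y] of the outer variable is moved inside the integral over the remaining
     coordinates [w] of the inner one. *)
  apply: (etrans (dom_Rfubini iD (@rhoW_integrable R n) mF FD)).
  apply: (etrans _ (RintegralZl _ measurableT (RT_integrable z' _ gk))).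
  apply: eq_Rintegral => w _.
  rewrite -(headT_inversion (K := fun i => K (i + 2 * n)%N) y0 w _ _ _) => [|i|i]; last 2 first.
  - exact: gK.
  - exact: dK.
  by apply: eq_Rintegral => y _; congr (headT _ _ _ _); rewrite /S; ring.
apply: (etrans (RintegralZl _ measurableT (RRT_integrable zeta' t gk))).
rewrite (exprS (- 16 * pi ^+ 2)) -[RHS]mulrA; congr (_ * _).
have gK' i : good (fun w s => K i (pcons y0 w) s) by exact: good_pcons.
have dK' i : is_dt (fun w s => K i (pcons y0 w) s) (fun w s => K i.+1 (pcons y0 w) s).
  by move=> w s; exact: dK.
exact: (IHn (fun i w s => K i (pcons y0 w) s) zeta' t gK' dK').
Qed.

End head_plane.

(** * Schwartz functions with vanishing moments *)

Section rapid_decay.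
Context {R : realType} (n : nat).
Local Notation leb := (@lebesgue_measure R).
Local Notation RR := (measurableTypeR R).
Implicit Types (g : W R n -> R -> R) (w : W R n) (t : R).

(** Writing the half-line as a factor keeps the domain of integration equal to [setT], the setting
    of the domination lemmas. *)
Definition ind0 (r : R) : R := \1_(`[0, +oo[%classic : set R) r.

Lemma measurable_ind0 : measurable_fun [set: RR] ind0.
Proof. by apply: measurable_indic. Qed.

Lemma ind0E r : ind0 r = if 0 <= r then 1 else 0.
Proof.
rewrite /ind0 indicE mem_setE in_itv/= andbT.
by case: (0 <= r).
Qed.

Lemma ind0_01 r : `|ind0 r| <= 1.
Proof. by rewrite ind0E; case: ifP => _; rewrite ?normr1 ?normr0. Qed.

Lemma Rintegral_ind0 (h : R -> R) :
  \int[leb]_r (ind0 r * h r) = \int[leb]_(r in `[0, +oo[) h r.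
Proof.
rewrite [RHS]Rintegral_mkcond; apply: eq_Rintegral => r _.
by rewrite patchE mem_setE in_itv/= andbT ind0E; case: ifP; rewrite ?mul1r ?mul0r.
Qed.

(** Decay in [t] makes the half-line integral [anti] meaningful. Moments of all orders must vanish
    because each antiderivative consumes one: the moment of order [k] of [anti g] is a multiple of
    that of order [k.+1] of [g]. *)
Record rapid g : Prop := {
  rapid_bound : forall M : nat, exists2 C, 0 <= C &
    forall w t, `|g w t| <= C * rhoW w * rho t ^+ M;
  rapid_moment : forall (k : nat) w, \int[leb]_t (g w t * t ^+ k) = 0;
  rapid_cont : forall w, continuous (g w) }.

(** The integral of [g w] over the half-line below [t], reflected so that the domain is fixed and
    [t] can be differentiated under the integral sign. *)
Definition anti g w t : R := \int[leb]_r (ind0 r * g w (t - r)).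

(** A Peetre inequality, from [r ^+ 2 <= 2 * t ^+ 2 + 2 * (t - r) ^+ 2]. *)
Lemma rho_shift t r : rho (t - r) <= 2 * (1 + t ^+ 2) * rho r.
Proof.
rewrite /rho ler_pdivlMr ?oneDsqr_gt0// ler_pdivrMl ?oneDsqr_gt0// /oneDsqr.
have u0 := sqr_ge0 (t - r); have t0 := sqr_ge0 t.
have -> : r ^+ 2 = 2 * t ^+ 2 + 2 * (t - r) ^+ 2 - (t + (t - r)) ^+ 2 by ring.
by have := sqr_ge0 (t + (t - r)); nra.
Qed.

Lemma rapid_shift_dom g C w t r : (forall w t, `|g w t| <= C * rhoW w * rho t ^+ 1) ->
  0 <= C -> `|g w (t - r)| <= C * (2 * (1 + t ^+ 2)) * rho r.
Proof.
move=> gC C0; rewrite (le_trans (gC _ _))// expr1 -[leLHS]mulrA -[leRHS]mulrA ler_wpM2l//.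
by rewrite (le_trans _ (rho_shift t r))// ler_piMl ?rho_ge0// rhoW_le1.
Qed.

Lemma xrho_le1 (t : R) k : `|t| ^+ k * rho t ^+ k <= 1.
Proof.
rewrite -exprMn exprn_ile1 ?mulr_ge0 ?rho_ge0//.
rewrite -(oneDsqrK t) ler_wpM2r ?rho_ge0// -(real_normK (num_real t)).
by have := sqr_ge0 (`|t| - 1); have := normr_ge0 t; nra.
Qed.

Lemma moment_dom g k :
  (forall M : nat, exists2 C, 0 <= C & forall w t, `|g w t| <= C * rhoW w * rho t ^+ M) ->
  exists2 C, 0 <= C & forall w t, `|g w t * t ^+ k| <= C * rho t.
Proof.
move=> /(_ k.+1)[C C0 gC]; exists C => // w t.
rewrite normrM normrX (le_trans (ler_wpM2r _ (gC w t)))// ?exprn_ge0//.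
rewrite exprSr -!mulrA ler_wpM2l//.
have -> : rhoW w * (rho t ^+ k * (rho t * `|t| ^+ k)) =
  rhoW w * (`|t| ^+ k * rho t ^+ k) * rho t by ring.
rewrite ler_piMl ?rho_ge0// mulr_ile1 ?rhoW_ge0 ?rhoW_le1 ?xrho_le1//.
by rewrite mulr_ge0// exprn_ge0// rho_ge0.
Qed.

Lemma is_derive_pow k (x : R) : is_derive x 1 (fun x => x ^+ k) (k%:R * x ^+ k.-1).
Proof.
elim: k => [|k IHk]; first by rewrite mul0r; exact: is_derive_cst.
have := is_derive_mul (is_derive_id x 1) IHk.
have -> : (fun x : R => x * x ^+ k) = (fun x => x ^+ k.+1).
  by apply/funext => y; rewrite exprS.
move=> /is_derive_eq; apply; rewrite mul1r mulrCA.
by case: k {IHk} => [|k]; rewrite ?mul0r ?mulr0 ?addr0 ?expr0 ?mulr1// -exprS /=; rewrite -natr1; ring.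
Qed.

(** Integration by parts lowers the order of the moment by one. For [k = 0] the spurious order
    [k.-1] is harmless, its coefficient being [k%:R]. *)
Lemma moment_derive g gt : rapid g -> is_dt g gt ->
  (forall M : nat, exists2 C, 0 <= C & forall w t, `|gt w t| <= C * rhoW w * rho t ^+ M) ->
  (forall w, continuous (gt w)) -> rapid gt.
Proof.
move=> rg dg gtb cgt; split=> // k w.
have [C C0 gtC] : exists2 C, 0 <= C & forall w t, `|gt w t * t ^+ k| <= C * rho t.
  exact: moment_dom.
have [D D0 gD] := moment_dom k (rapid_bound rg).
have [E E0 gE] := moment_dom k.-1 (rapid_bound rg).
have cX m : continuous (fun t : R => t ^+ m) by exact: exprn_continuous.
have i1 : leb.-integrable setT (EFin \o (fun t => gt w t * t ^+ k)).
  apply: (@dom_rho_integrable _ _ C); last exact: gtC.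
  by apply: measurable_cont => t; apply: cvgM; [exact: cgt|exact: cX].
have i2 : leb.-integrable setT (EFin \o (fun t => g w t * t ^+ k.-1)).
  apply: (@dom_rho_integrable _ _ E); last exact: gE.
  by apply: measurable_cont => t; apply: cvgM; [exact: (rapid_cont rg)|exact: cX].
have : \int[leb]_t (gt w t * t ^+ k + k%:R * (g w t * t ^+ k.-1)) = 0.
  apply: (@Rintegral_derive0 _ (fun t => g w t * t ^+ k) _ (C + k%:R * E) D).
  - by move=> t; apply: (is_derive_eq (is_derive_mul (dg w t) (is_derive_pow k t))); ring.
  - move=> t; apply: cvgD; apply: cvgM; [exact: cgt|exact: cX|exact: cvg_cst|].
    by apply: cvgM; [exact: (rapid_cont rg)|exact: cX].
  - move=> t; rewrite (le_trans (ler_normD _ _))// mulrDl lerD//.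
    by rewrite normrM normr_nat -mulrA ler_wpM2l.
  - exact: gD.
rewrite RintegralD//; last exact: (integrableZ_fin k%:R i2).
by rewrite RintegralZl// (rapid_moment rg) mulr0 addr0.
Qed.

End rapid_decay.

(** * Antiderivatives in t of functions with vanishing moments *)

Section antiderivative.
Context {R : realType} (n : nat).
Local Notation leb := (@lebesgue_measure R).
Local Notation RR := (measurableTypeR R).
Implicit Types (g h : W R n -> R -> R) (w : W R n) (t : R).

Lemma rapid_bound1 g : rapid g -> exists2 C, 0 <= C & forall w t r,
  `|g w (t - r)| <= C * (2 * (1 + t ^+ 2)) * rho r.
Proof.
move=> rg; have [C C0 gC] := rapid_bound rg 1; exists C => // w t r.
exact: rapid_shift_dom.
Qed.

Lemma measurable_shift g w t : (forall w, continuous (g w)) ->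
  measurable_fun [set: RR] (fun r => g w (t - r)).
Proof.
move=> cg; apply: measurable_cont => r.
apply: (@continuous_comp _ _ _ (fun r => t - r) (g w)); last exact: cg.
by apply: cvgB; [exact: cvg_cst|exact: cvg_id].
Qed.

Lemma measurable_anti g w t : (forall w, continuous (g w)) ->
  measurable_fun [set: RR] (fun r => ind0 r * g w (t - r)).
Proof.
move=> cg; apply: measurable_funM; first exact: measurable_ind0.
exact: measurable_shift.
Qed.

Lemma anti_integrable g w t : rapid g ->
  leb.-integrable setT (EFin \o (fun r => ind0 r * g w (t - r))).
Proof.
move=> rg; have [C C0 gC] := rapid_bound1 rg.
apply: (@dom_rho_integrable _ _ (C * (2 * (1 + t ^+ 2)))) => [|r].
  exact: measurable_anti (rapid_cont rg).
by rewrite normrM (le_trans _ (gC w t r))// ler_piMl// ind0_01.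
Qed.

Lemma anti_dt g gt : rapid g -> rapid gt -> is_dt g gt -> anti gt = g.
Proof.
move=> rg rgt dg; apply/funext => w; apply/funext => t; rewrite /anti Rintegral_ind0.
have [C C0 gC] := rapid_bound1 rg; have [D D0 gtD] := rapid_bound1 rgt.
have dS (r : R) : is_derive r 1 (fun r => - g w (t - r)) (gt w (t - r)).
  have d1 : is_derive (t + -1 * r) 1 (g w) (gt w (t - r)) by rewrite mulN1r; exact: dg.
  have := is_deriveN (is_derive_affine d1); rewrite mulN1r opprK.
  suff -> : - (fun x => g w (t + -1 * x)) = (fun r => - g w (t - r)) by [].
  by apply/funext => x; rewrite !fctE mulN1r.
have cS : continuous (fun r => gt w (t - r)).
  move=> r; apply: (@continuous_comp _ _ _ (fun r => t - r) (gt w)); last exact: (rapid_cont rgt).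
  by apply: cvgB; [exact: cvg_cst|exact: cvg_id].
have [-> _] := FTC_sg dS cS (gtD w t) (fun r => eq_ind_r (fun x => x <= _) (gC w t r) (normrN _)).
by rewrite opprK subr0.
Qed.

(** Covers both the [t]-derivative, with [p] constant, and the slanted lines of [slope_derive]. The
    bound [b] keeps the factor of [rho_shift] uniform near [s]. *)
Lemma anti_path g h (p : R -> W R n) (q : R -> R) (b s : R) : rapid g ->
  (forall w, continuous (h w)) ->
  (exists2 C, 0 <= C & forall w t, `|h w t| <= C * rhoW w * rho t ^+ 1) ->
  (forall s', `|s' - s| < 1 -> `|q s'| <= b) ->
  (forall s r : R, is_derive s 1 (fun s => g (p s) (q s - r)) (h (p s) (q s - r))) ->
  is_derive s 1 (fun s => anti g (p s) (q s)) (anti h (p s) (q s)).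
Proof.
move=> rg ch [C C0 hC] qb dgh; have [D D0 gD] := rapid_bound1 rg.
apply: (@is_derive_Rintegral _ _ _ leb (fun s r => ind0 r * g (p s) (q s - r))
  (fun s r => ind0 r * h (p s) (q s - r)) (fun r => C * (2 * (1 + b ^+ 2)) * rho r)).
- by move=> s'; exact: measurable_anti (rapid_cont rg).
- move=> s'; exists (fun r => D * (2 * (1 + q s' ^+ 2)) * rho r).
    exact: integrable_rhoC.
  by move=> r; rewrite normrM (le_trans _ (gD (p s') (q s') r))// ler_piMl// ind0_01.
- exact: integrable_rhoC.
- move=> s' r s's; rewrite normrM (@le_trans _ _ `|h (p s') (q s' - r)|)//.
    by rewrite ler_piMl// ind0_01.
  rewrite (le_trans (rapid_shift_dom _ _ _ hC C0))// ler_wpM2r ?rho_ge0//.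
  rewrite ler_wpM2l// ler_wpM2l// lerD2l -(real_normK (num_real (q s'))).
  by rewrite lerXn2r ?nnegrE ?qb//; exact: le_trans (normr_ge0 _) (qb s' s's).
Qed.

(** Differentiating under the integral yields [anti gt], which [anti_dt] identifies with [g]. *)
Lemma anti_is_dt g gt : rapid g -> rapid gt -> is_dt g gt -> is_dt (anti g) g.
Proof.
move=> rg rgt dg w t; rewrite -[X in is_derive _ _ _ X](_ : anti gt w t = _); last first.
  by rewrite (anti_dt rg rgt dg).
apply: (@anti_path g gt (fun=> w) id (`|t| + 1) t rg (rapid_cont rgt) (rapid_bound rgt 1)).
  by move=> s' h; rewrite -(subrK t s') addrC (le_trans (ler_normD _ _))// lerD2l ltW.
by move=> s r; apply: is_derive_shift; exact: dg.
Qed.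

Lemma anti_slope g gj gt j : rapid g -> rapid gj -> rapid gt -> is_dt g gt ->
  slope_derive j g gj gt -> slope_derive j (anti g) (anti gj) g.
Proof.
move=> rg rgj rgt dg dgj w c t s.
pose h w t := gj w t + c * gt w t.
have E : anti h (upd w j s) (t + c * s) =
    anti gj (upd w j s) (t + c * s) + c * g (upd w j s) (t + c * s).
  rewrite -[X in c * X _ _](anti_dt rg rgt dg) /anti -RintegralZl//; last exact: anti_integrable.
  rewrite -RintegralD//; last 2 first.
  - exact: anti_integrable.
  - by apply: integrableZ_fin; exact: anti_integrable.
  by apply: eq_Rintegral => r _; rewrite /h; ring.
rewrite -E; apply: (@anti_path g h (upd w j) (fun s => t + c * s) (`|t| + `|c| * (`|s| + 1)) s rg).
- move=> v x; apply: cvgD; first exact: (rapid_cont rgj).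
  by apply: cvgM; [exact: cvg_cst|exact: (rapid_cont rgt)].
- have [C C0 hC] := rapid_bound rgj 1; have [D D0 hD] := rapid_bound rgt 1.
  exists (C + `|c| * D) => [|v x]; first by rewrite addr_ge0// mulr_ge0.
  rewrite (le_trans (ler_normD _ _))// -mulrA mulrDl lerD ?mulrA// normrM -!mulrA ler_wpM2l//.
  by rewrite mulrA.
- move=> s' h1; rewrite (le_trans (ler_normD _ _))// lerD2l normrM ler_wpM2l//.
  by rewrite -(subrK s s') addrC (le_trans (ler_normD _ _))// lerD2l ltW.
- move=> s' r; have := dgj w c (t - r) s'; rewrite /h addrAC.
  suff -> : (fun s => g (upd w j s) (t - r + c * s)) =
     (fun s => g (upd w j s) (t + c * s - r)) by [].
  by apply/funext => x; rewrite addrAC.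
Qed.

Lemma Rintegral_reflect f t : leb.-integrable setT (EFin \o f) ->
  \int[leb]_r f (t - r) = \int[leb]_r f r.
Proof.
move=> if_; rewrite [RHS](@Rintegral_affine _ (-1) t) ?oppr_eq0 ?oner_eq0//.
rewrite normrN1 mul1r; apply: eq_Rintegral => r _.
by rewrite mulN1r addrC.
Qed.

Lemma integrable_reflect f t : leb.-integrable setT (EFin \o f) ->
  leb.-integrable setT (EFin \o (fun r => f (t - r))).
Proof.
move=> if_; have h : (-1 : R) != 0 by rewrite oppr_eq0 oner_eq0.
have := integrable_affine t h if_.
by congr integrable; apply/funext => r /=; rewrite mulN1r addrC.
Qed.

(* For [t <= 0] the half-line of integration only meets [|t - r| >= |t|]; for
   [0 < t] the vanishing moment of order 0 replaces it by the other half-line. *)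
Lemma anti_bound g : rapid g -> forall M : nat, exists2 C, 0 <= C &
  forall w t, `|anti g w t| <= C * rhoW w * rho t ^+ M.
Proof.
move=> rg M; have [C C0 gC] := rapid_bound rg M.+1.
exists (C * pi) => [|w t]; first by rewrite mulr_ge0// pi_ge0.
have irt : leb.-integrable setT (EFin \o (fun r => C * rhoW w * rho t ^+ M * rho (t - r))).
  by apply: integrableZ_fin; apply: integrable_reflect; exact: rho_integrable.
have E : \int[leb]_r (C * rhoW w * rho t ^+ M * rho (t - r)) =
    C * pi * rhoW w * rho t ^+ M.
  rewrite RintegralZl//; last by apply: integrable_reflect; exact: rho_integrable.
  by rewrite Rintegral_reflect ?rho_integral; [ring|exact: rho_integrable].
have dom r : t ^+ 2 <= (t - r) ^+ 2 ->
    `|g w (t - r)| <= C * rhoW w * rho t ^+ M * rho (t - r).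
  move=> tr; rewrite (le_trans (gC _ _))// exprSr mulrA ler_wpM2r ?rho_ge0//.
  rewrite ler_wpM2l ?mulr_ge0 ?rhoW_ge0// lerXn2r ?nnegrE ?rho_ge0//.
  by rewrite lef_pV2 ?posrE ?oneDsqr_gt0// lerD2l.
have dom0 : forall r, 0 <= C * rhoW w * rho t ^+ M * rho (t - r).
  by move=> r; rewrite !mulr_ge0 ?rhoW_ge0 ?exprn_ge0 ?rho_ge0.
have [t0|t0] := leP t 0.
  rewrite -E; apply: (le_dom_Rintegral (measurable_anti w t (rapid_cont rg)) irt) => r.
  rewrite ind0E; case: ifP => r0; rewrite ?mul1r ?mul0r ?normr0//; apply: dom.
  by nra.
have ig : leb.-integrable setT (EFin \o g w).
  have [D D0 gD] := rapid_bound rg 1; apply: (@dom_rho_integrable _ _ (D * rhoW w)).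
    by apply: measurable_cont; exact: (rapid_cont rg).
  by move=> x; rewrite (le_trans (gD _ _))// expr1.
have -> : anti g w t = - \int[leb]_r ((1 - ind0 r) * g w (t - r)).
  apply/eqP; rewrite -addr_eq0 -RintegralD//; last 2 first.
  - exact: anti_integrable.
  - have := integrableB measurableT (integrable_reflect t ig) (anti_integrable w t rg).
    by congr integrable; apply/funext => r /=; rewrite -EFinB mulrBl mul1r.
  rewrite (_ : (fun r => _) = fun r => g w (t - r)); last by apply/funext => r; ring.
  rewrite Rintegral_reflect//; apply/eqP; rewrite -[RHS](rapid_moment rg 0 w).
  by apply: eq_Rintegral => r _; rewrite expr0 mulr1.
rewrite normrN -E; apply: (le_dom_Rintegral _ irt) => [|r].
  apply: measurable_funM; last exact: measurable_shift (rapid_cont rg).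
  by apply: measurable_funB => //; exact: measurable_ind0.
rewrite ind0E; case: ifP => r0; rewrite ?subrr ?mul0r ?normr0// subr0 mul1r.
by apply: dom; move/negbT: r0; rewrite -ltNge => r0; nra.
Qed.

Lemma anti_rapid g : rapid g -> is_dt (anti g) g -> rapid (anti g).
Proof.
move=> rg dg; have ab := anti_bound rg; split=> // [k w|w]; last first.
  exact: is_derive_continuous (dg w).
have cA := is_derive_continuous (dg w).
have [C C0 gC] := moment_dom k.+1 (rapid_bound rg).
have [D D0 aD] := moment_dom k.+1 ab; have [E E0 aE] := moment_dom k ab.
have cX m : continuous (fun t : R => t ^+ m) by exact: exprn_continuous.
have i1 : leb.-integrable setT (EFin \o (fun t => g w t * t ^+ k.+1)).
  apply: (@dom_rho_integrable _ _ C); last exact: gC.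
  by apply: measurable_cont => t; apply: cvgM; [exact: (rapid_cont rg)|exact: cX].
have i2 : leb.-integrable setT (EFin \o (fun t => anti g w t * t ^+ k)).
  apply: (@dom_rho_integrable _ _ E); last exact: aE.
  by apply: measurable_cont => t; apply: cvgM; [exact: cA|exact: cX].
have : \int[leb]_t (g w t * t ^+ k.+1 + k.+1%:R * (anti g w t * t ^+ k)) = 0.
  apply: (@Rintegral_derive0 _ (fun t => anti g w t * t ^+ k.+1) _ (C + k.+1%:R * E) D).
  - by move=> t; apply: (is_derive_eq (is_derive_mul (dg w t) (is_derive_pow k.+1 t))) => /=; ring.
  - move=> t; apply: cvgD; apply: cvgM; [exact: (rapid_cont rg)|exact: cX|exact: cvg_cst|].
    by apply: cvgM; [exact: cA|exact: cX].
  - move=> t; rewrite (le_trans (ler_normD _ _))// mulrDl lerD//.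
    by rewrite normrM normr_nat -mulrA ler_wpM2l.
  - exact: aD.
rewrite RintegralD//; last exact: (integrableZ_fin k.+1%:R i2).
rewrite RintegralZl// (rapid_moment rg) add0r => /eqP.
by rewrite mulf_eq0 pnatr_eq0/= => /eqP.
Qed.

End antiderivative.

(** * Schwartz functions with vanishing moments are good *)

Section schwartz_functions.
Context {R : realType} (n : nat).
Local Notation leb := (@lebesgue_measure R).
Local Notation N := (n + n).+1.

Definition ix (j : bool * 'I_n) : 'I_N :=
  lift ord_max (if j.1 then rshift n j.2 else lshift n j.2).

Definition row_of (w : W R n) (t : R) : 'rV[R]_N :=
  \row_i if unlift ord_max i is Some k then
    match fintype.split k with inl j => crd w (false, j) | inr j => crd w (true, j) end
  else t.

Lemma row_of_ix w t j : row_of w t 0 (ix j) = crd w j.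
Proof.
rewrite mxE /ix liftK; case: j => -[] j /=.
  by rewrite (unsplitK (inr j)).
by rewrite (unsplitK (inl j)).
Qed.

Lemma row_of_max w t : row_of w t 0 ord_max = t.
Proof. by rewrite mxE unlift_none. Qed.

Lemma ixP (i : 'I_N) : i = ord_max \/ exists j, i = ix j.
Proof.
case: (unliftP ord_max i) => [k|] ->; last by left.
right; case: (splitP k) => j kj.
  by exists (false, j); congr lift; apply: val_inj.
by exists (true, j); congr lift; apply: val_inj.
Qed.

Lemma ix_inj : injective ix.
Proof.
move=> [b i] [b' i'] /lift_inj; case: b b' => -[] //=.
- by move=> /rshift_inj ->.
- by move=> /eqP; rewrite eq_rlshift.
- by move=> /eqP; rewrite eq_lrshift.
- by move=> /lshift_inj ->.
Qed.

Lemma ix_neq_max j : ix j != ord_max.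
Proof. by rewrite eq_sym neq_lift. Qed.

(** A slanted line is a straight line of row vectors, so [slope_derive] becomes a directional
    derivative and follows from differentiability. *)
Lemma row_of_upd w j s t c : row_of (upd w j s) (t + c * s) =
  row_of (upd w j 0) t + s *: (delta_mx 0 (ix j) + c *: delta_mx 0 ord_max).
Proof.
have E (A B D : 'rV[R]_N) i : (A + s *: (B + c *: D)) 0 i = A 0 i + s * (B 0 i + c * D 0 i).
  by rewrite !mxE.
apply/rowP => i; rewrite E; case: (ixP i) => [|[k]] ->.
  rewrite !row_of_max !(mxE delta_mx_key) !eqxx/= eq_sym (negPf (ix_neq_max j))/=.
  by ring.
rewrite !row_of_ix !crd_upd !(mxE delta_mx_key) eqxx/= (negPf (ix_neq_max k))/=.
by rewrite (inj_eq ix_inj); case: eqP => _ /=; ring.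
Qed.

Lemma row_of_shift w t s : row_of w (t + s) = row_of w t + s *: delta_mx 0 ord_max.
Proof.
have E (A B : 'rV[R]_N) i : (A + s *: B) 0 i = A 0 i + s * B 0 i by rewrite !mxE.
apply/rowP => i; rewrite E; case: (ixP i) => [|[k]] ->.
  by rewrite !row_of_max !(mxE delta_mx_key) !eqxx/= mulr1.
by rewrite !row_of_ix !(mxE delta_mx_key) (negPf (ix_neq_max k))/= mulr0 addr0.
Qed.

Lemma is_derive_line (F : 'rV[R]_N -> R) v d (s : R) : differentiable F (v + s *: d) ->
  is_derive s 1 (fun s => F (v + s *: d)) ('D_d F (v + s *: d)).
Proof.
move=> dF; have df : derivable F (v + s *: d) d by exact: diff_derivable.
have := derivableP df.
have E : (fun h : R => h^-1 *: (((fun s => F (v + s *: d)) \o shift s) (h *: 1) -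
     F (v + s *: d))) = (fun h => h^-1 *: ((F \o shift (v + s *: d)) (h *: d) - F (v + s *: d))).
  apply/funext => h /=; congr (_ *: (F _ - _)).
  by rewrite -[h *: 1]/(h * 1) mulr1 scalerDl addrCA.
move=> [h1 h2]; split; first by rewrite /derivable /= E.
by rewrite /derive /= E.
Qed.

Variable F : 'rV[R]_N -> R.
Hypothesis sF : schwartz F.

Definition Bs s w t := pderivs s F (row_of w t).

Let dF s v : differentiable (pderivs s F) v. Proof. exact: sF.1. Qed.

Lemma Bs_dt s : is_dt (Bs s) (Bs (ord_max :: s)).
Proof.
move=> w t; have := @is_derive_line (pderivs s F) (row_of w 0) (delta_mx 0 ord_max) t
  (dF _ _).
rewrite -row_of_shift add0r.
suff -> : (fun t => pderivs s F (row_of w 0 + t *: delta_mx 0 ord_max)) = Bs s w by [].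
by apply/funext => x; rewrite -row_of_shift add0r.
Qed.

Lemma Bs_slope s j : slope_derive j (Bs s) (Bs (ix j :: s)) (Bs (ord_max :: s)).
Proof.
move=> w c t x; have := @is_derive_line (pderivs s F) (row_of (upd w j 0) t)
  (delta_mx 0 (ix j) + c *: delta_mx 0 ord_max) x (dF _ _).
rewrite -row_of_upd.
have -> : (fun x => pderivs s F (row_of (upd w j 0) t +
    x *: (delta_mx 0 (ix j) + c *: delta_mx 0 ord_max))) =
  (fun x => Bs s (upd w j x) (t + c * x)).
  by apply/funext => y; rewrite -row_of_upd.
move=> /is_derive_eq; apply; rewrite /Bs /= /pderiv !deriveE//.
by rewrite linearD linearZ.
Qed.

Lemma Bs_cont s w : continuous (Bs s w).
Proof. exact: is_derive_continuous (Bs_dt s w). Qed.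

Lemma Bs_bound s (M : nat) : exists2 C, 0 <= C &
  forall w t, `|Bs s w t| <= C * rhoW w * rho t ^+ M.
Proof.
(* The Schwartz condition bounds monomials only, so the weight is built one factor [1 + v 0 k ^+ 2]
   at a time. The exponents are generalised because the term [v 0 k ^+ 2] raises [a k] by two. *)
have key (L : seq 'I_N) : forall a : 'I_N -> nat, exists C, forall v : 'rV[R]_N,
    `|(\prod_(i <- L) (1 + v 0 i ^+ 2)) * ((\prod_(i < N) v 0 i ^+ a i) * pderivs s F v)| <= C.
  elim: L => [|k L IH] a.
    by have [C hC] := sF.2 a s; exists C => v; rewrite big_nil mul1r.
  have [C hC] := IH a; have [D hD] := IH (fun i => if i == k then (a i).+2 else a i).
  exists (C + D) => v; rewrite big_cons mulrDl mul1r mulrDl.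
  rewrite (le_trans (ler_normD _ _))// lerD//.
  suff -> : v 0 k ^+ 2 * (\prod_(i <- L) (1 + v 0 i ^+ 2)) * ((\prod_(i < N) v 0 i ^+ a i) * pderivs s F v)
    = (\prod_(i <- L) (1 + v 0 i ^+ 2)) *
      ((\prod_(i < N) v 0 i ^+ (if i == k then (a i).+2 else a i)) * pderivs s F v) by [].
  rewrite (bigD1 k)//= [in RHS](bigD1 k)//= eqxx.
  have -> : \prod_(i < N | i != k) v 0 i ^+ (if i == k then (a i).+2 else a i) =
      \prod_(i < N | i != k) v 0 i ^+ a i.
    by apply: eq_bigr => i ik; rewrite (negPf ik).
  by rewrite (exprS _ (a k).+1) (exprS _ (a k)); ring.
(* Every coordinate of [w] once and [t] with multiplicity [M]: the product over [L] is the inverse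
   of [rhoW w * rho t ^+ M]. *)
pose L := [seq ix j | j <- index_enum (bool * 'I_n)%type] ++ nseq M ord_max.
have [C hC] := key L (fun=> 0%N).
exists `|C| => // w t.
have p1 : 0 < 1 + t ^+ 2 by exact: oneDsqr_gt0.
have pw : 0 < \prod_(j : bool * 'I_n) (1 + crd w j ^+ 2).
  by apply: prodr_gt0 => j _; exact: oneDsqr_gt0.
have pwr : (\prod_(j : bool * 'I_n) (1 + crd w j ^+ 2)) * rhoW w = 1.
  rewrite (eq_bigr (fun j => 1 + crd w (j.1, j.2) ^+ 2)); last by move=> [].
  rewrite -(pair_bigA _ (fun b i => 1 + crd w (b, i) ^+ 2)) big_bool/=.
  by rewrite -!big_split/= big1// => i _; rewrite (mulrC (rho _)) mulrACA !oneDsqrK mulr1.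
have LE : \prod_(i <- L) (1 + row_of w t 0 i ^+ 2) =
    (\prod_(j : bool * 'I_n) (1 + crd w j ^+ 2)) * (1 + t ^+ 2) ^+ M.
  rewrite big_cat big_map big_nseq/= row_of_max iter_mulr_1; congr (_ * _).
  by apply: eq_bigr => j _; rewrite row_of_ix.
have := hC (row_of w t); rewrite LE.
rewrite (_ : \prod_(i < N) _ = 1); last by apply: big1 => i _; rewrite expr0.
rewrite mul1r normrM ger0_norm; last by rewrite mulr_ge0 ?exprn_ge0// ltW.
move=> h; have p : 0 < (\prod_(j : bool * 'I_n) (1 + crd w j ^+ 2)) * (1 + t ^+ 2) ^+ M.
  by rewrite mulr_gt0// exprn_gt0.
rewrite -(ler_pM2l p) (le_trans h)//.
have -> : (\prod_(j : bool * 'I_n) (1 + crd w j ^+ 2)) * (1 + t ^+ 2) ^+ M *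
    (`|C| * rhoW w * rho t ^+ M) = `|C| *
  ((\prod_(j : bool * 'I_n) (1 + crd w j ^+ 2)) * rhoW w) * ((1 + t ^+ 2) * rho t) ^+ M.
  by rewrite exprMn; ring.
by rewrite pwr oneDsqrK expr1n !mulr1 ler_norm.
Qed.

Hypothesis mF : forall (k : nat) w, \int[leb]_t (F (row_of w t) * t ^+ k) = 0.

(** A [t]-derivative keeps its moments zero by parts. A derivative in [w] commutes with the moment
    integral, which is constantly zero in [w]. *)
Lemma Bs_rapid s : rapid (Bs s).
Proof.
elim: s => [|i s IH]; first by split => //; [exact: Bs_bound|exact: Bs_cont].
case: (ixP i) => [->|[j ->]].
  by apply: (moment_derive IH (Bs_dt s)); [exact: Bs_bound|exact: Bs_cont].
split; [exact: Bs_bound| |exact: Bs_cont] => k w.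
have [C C0 hC] := moment_dom k (Bs_bound s).
have [D D0 hD] := moment_dom k (Bs_bound (ix j :: s)).
have cX : continuous (fun t : R => t ^+ k) by exact: exprn_continuous.
have h : is_derive (crd w j) 1 (fun x => \int[leb]_t (Bs s (upd w j x) t * t ^+ k))
    (\int[leb]_t (Bs (ix j :: s) (upd w j (crd w j)) t * t ^+ k)).
  apply: (@is_derive_Rintegral _ _ _ leb (fun x t => Bs s (upd w j x) t * t ^+ k)
    (fun x t => Bs (ix j :: s) (upd w j x) t * t ^+ k) (fun t => D * rho t)).
  - move=> x; apply: measurable_cont => t; apply: cvgM; [exact: Bs_cont|exact: cX].
  - move=> x; exists (fun t => C * rho t); first exact: integrable_rhoC.
    by move=> t; exact: hC.
  - move=> x t; have := @Bs_slope s j w 0 t x; rewrite !mul0r !addr0 => d1.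
    have d2 : is_derive x 1 (fun x => Bs s (upd w j x) t) (Bs (ix j :: s) (upd w j x) t).
      move: d1; suff -> : (fun s0 => Bs s (upd w j s0) (t + 0 * s0)) =
        (fun x => Bs s (upd w j x) t) by [].
      by apply/funext => y; rewrite mul0r addr0.
    have := is_derive_mul d2 (is_derive_cst (t ^+ k) x 1).
    by move=> /is_derive_eq; apply; rewrite mulr0 addr0.
  - exact: integrable_rhoC.
  - by move=> x t _; exact: hD.
have uw : upd w j (crd w j) = w.
  by apply: eq_crd => i'; rewrite crd_upd; case: eqP => // ->.
rewrite uw in h.
have c0 : (fun x => \int[leb]_t (Bs s (upd w j x) t * t ^+ k)) = cst 0.
  by apply/funext => x; rewrite (rapid_moment IH).
rewrite c0 in h.
have h' := is_derive_cst (0 : R) (crd w j) 1.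
by rewrite -(@derive_val _ _ _ _ _ _ _ h) (@derive_val _ _ _ _ _ _ _ h').
Qed.

(* The [As k s] form a post-fixed point of [good_step]: the [t]-derivative of
   [As k s] is [As k.-1 s] if [0 < k], and [Bs (ord_max :: s)] if [k = 0]. *)
Definition As k s := iter k (@anti R n) (Bs s).

(** The claims are proved together, and for all [s], since the slope derivative at level [k.+1]
    needs [As k (ix j :: s)] to be [rapid]. *)
Lemma As_spec k s : [/\ rapid (As k s),
  exists2 g, rapid g & is_dt (As k s) g /\
    (exists k' s', g = As k' s') /\
    forall j, slope_derive j (As k s) (As k (ix j :: s)) g &
  is_dt (As k.+1 s) (As k s)].
Proof.
elim: k s => [|k IH] s.
  have d := anti_is_dt (Bs_rapid s) (Bs_rapid (ord_max :: s)) (Bs_dt s).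
  split; [exact: Bs_rapid| |exact: d].
  exists (Bs (ord_max :: s)); first exact: Bs_rapid.
  split; first exact: Bs_dt.
  by split => [|j]; [exists 0%N, (ord_max :: s)|exact: Bs_slope].
have [r [g rg [dg [_ sg]]] d] := IH s.
have r' : rapid (As k.+1 s) by exact: anti_rapid r d.
split=> //; last exact: (anti_is_dt r' r d).
exists (As k s) => //; split=> //; split=> [|j]; first by exists k, s.
have [rj _ _] := IH (ix j :: s).
exact: (anti_slope r rj rg dg (sg j)).
Qed.

Lemma schwartz_good : good (fun w t => F (row_of w t)).
Proof.
exists (fun g => exists k s, g = As k s); last by exists 0%N, [::].
move=> _ [k [s ->]]; have [r [g rg [dg [[k' [s' gE]] sg]]] d] := As_spec k s.
split.
- have [C _ hC] := rapid_bound r 0; exists C => w t.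
  by rewrite (le_trans (hC w t))// expr0 mulr1.
- exists g; first by exists k', s'.
  by split=> // j; exists (As k (ix j :: s)) => //; exists k, (ix j :: s).
- by exists (As k.+1 s) => //; exists k.+1, s.
Qed.

End schwartz_functions.

(** * Transfer to complex-valued functions on the Heisenberg group *)

Section componentwise.
Context {R : realType} (n : nat).
Local Notation leb := (@lebesgue_measure R).
Local Notation Cn := (lebesgue_Cn R).

Lemma Cn_of_pair_surj (z : 'rV[R[i]]_n) : exists w : W R n, z = Cn_of_pair w.
Proof.
exists ([tuple complex.Re (z 0 j) | j < n], [tuple complex.Im (z 0 j) | j < n]).
by apply/rowP => j; rewrite mxE/= !tnth_mktuple; case: (z 0 j).
Qed.

Lemma heis_of_row_of w t : heis_of_row (row_of w t) = (Cn_of_pair w, t) :> heis R n.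
Proof.
have wE k : widen_ord (leqnSn (n + n)) k = lift ord_max k.
  by apply: ord_inj; rewrite lift_max.
rewrite /heis_of_row row_of_max; congr pair; apply/rowP => j; rewrite [LHS]mxE [RHS]mxE !wE.
by have := row_of_ix w t (false, j); have := row_of_ix w t (true, j);
  rewrite /ix/= => -> ->.
Qed.

Lemma mulcE (a b a' b' : R) :
  (a +i* b) * (a' +i* b') = (a * a' - b * b') +i* (a * b' + b * a') :> R[i].
Proof. by []. Qed.

Lemma mulrcE (x a b : R) : x%:C * (a +i* b) = (x * a) +i* (x * b) :> R[i].
Proof. by rewrite mulcE !mul0r subr0 addr0. Qed.

Lemma Re_mulcr (x : R[i]) (a : R) : complex.Re (x * a%:C) = complex.Re x * a.
Proof. by case: x => x y; rewrite mulrC mulrcE [LHS]/= mulrC. Qed.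

Lemma Im_mulcr (x : R[i]) (a : R) : complex.Im (x * a%:C) = complex.Im x * a.
Proof. by case: x => x y; rewrite mulrC mulrcE [LHS]/= mulrC. Qed.

Lemma Im_hdot (z w : W R n) :
  complex.Im (hdot (Cn_of_pair z) (Cn_of_pair w)) = omega z w.
Proof.
rewrite /hdot (big_morph (@complex.Im R) (id1 := 0) (op1 := +%R)); [|by case=> ? ? []|by []].
apply: eq_bigr => j _; have E (a b a' b' : R) :
    complex.Im ((a +i* b) * ((a' +i* b')^*)%R) = b * a' - a * b'.
  by have -> : ((a' +i* b')^*)%R = a' +i* (- b') :> R[i] by []; rewrite mulcE [LHS]/= mulrN addrC.
by rewrite ![Cn_of_pair _ _ _]mxE E.
Qed.

(** Since [Cn_of_pair] is onto, the pair [(u, v)] determines [F]; the Radon transform and the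
    [t]-derivative act on [u] and [v] separately. *)
Definition has_parts (F : heis R n -> R[i]) (u v : W R n -> R -> R) :=
  forall w t, F (Cn_of_pair w, t) = u w t +i* v w t.

Lemma radon_parts F u v : has_parts F u v -> has_parts (heis_radon F) (RT u) (RT v).
Proof.
move=> Fuv z t; rewrite /heis_radon /Cintegral /RT; congr (_ +i* _);
  by apply: eq_Rintegral => w _; rewrite /= /radon_integrand/= Fuv Im_hdot.
Qed.

Lemma radon_cvg_parts F u v : has_parts F u v ->
  (forall z t, (Cn n).-integrable setT (EFin \o (fun w => u w (t - 2^-1 * omega z w)))) ->
  (forall z t, (Cn n).-integrable setT (EFin \o (fun w => v w (t - 2^-1 * omega z w)))) ->
  heis_radon_cvg F.
Proof.
move=> Fuv iu iv [z t]; have [z' ->] := Cn_of_pair_surj z; split.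
  have := iu z' t; congr integrable; apply/funext => w /=.
  by rewrite /radon_integrand/= Fuv Im_hdot.
have := iv z' t; congr integrable; apply/funext => w /=.
by rewrite /radon_integrand/= Fuv Im_hdot.
Qed.

Lemma derive1n_chain (u : nat -> W R n -> R -> R) w m : (forall k, is_dt (u k) (u k.+1)) ->
  derive1n m (u 0%N w) = u m w.
Proof.
move=> du; elim: m => [//|m IH].
apply/funext => t; rewrite derive1nS IH derive1E; have h := du m w t.
exact: derive_val.
Qed.

Section dlast_parts.
Variables (F : heis R n -> R[i]) (u v : nat -> W R n -> R -> R).
Hypothesis Fuv : has_parts F (u 0%N) (v 0%N).
Hypotheses (du : forall k, is_dt (u k) (u k.+1)) (dv : forall k, is_dt (v k) (v k.+1)).

Let ReE w : @complex.Re R \o (fun t => F (Cn_of_pair w, t)) = u 0%N w.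
Proof. by apply/funext => t /=; rewrite Fuv. Qed.

Let ImE w : @complex.Im R \o (fun t => F (Cn_of_pair w, t)) = v 0%N w.
Proof. by apply/funext => t /=; rewrite Fuv. Qed.

Lemma dlast_parts m : has_parts (dlast m F) (u m) (v m).
Proof. by move=> w t; rewrite /dlast /Cderive1n/= ReE ImE !derive1n_chain. Qed.

Lemma dlast_cvg_parts m : dlast_cvg m F.
Proof.
move=> z k t _; have [w ->] := Cn_of_pair_surj z; rewrite ReE ImE !derive1n_chain//.
by have h1 := du k w t; have h2 := dv k w t; split; exact: ex_derive.
Qed.

End dlast_parts.

Lemma good_dt_chain (g : W R n -> R -> R) : good g -> exists2 A : nat -> W R n -> R -> R,
  A 0%N = g & (forall i, good (A i)) /\ forall i, is_dt (A i) (A i.+1).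
Proof.
move=> gg.
have nx (k : {k : W R n -> R -> R | good k}) : {l : {k : W R n -> R -> R | good k} |
    is_dt (sval k) (sval l)}.
  by apply: cid; have [G gG dG] := good_dt (svalP k); exists (exist _ G gG).
pose A i := iter i (fun k => sval (nx k)) (exist _ g gg).
exists (fun i => sval (A i)) => //; split=> i; first exact: (svalP (A i)).
exact: (svalP (nx (A i))).
Qed.

Lemma heis_Phi_good (f : heis R n -> R[i]) : heis_Phi f -> exists u v,
  [/\ has_parts f u v, good u & good v].
Proof.
move=> [[sRe sIm] mom].
exists (fun w t => complex.Re (f (heis_of_row (row_of w t)))),
  (fun w t => complex.Im (f (heis_of_row (row_of w t)))); split.
- by move=> w t; rewrite heis_of_row_of; case: (f _).
- apply: (schwartz_good sRe) => k w.
  have <- : complex.Re (Cintegral leb (fun t => f (Cn_of_pair w, t) * (t ^+ k)%:C)) = 0.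
    by rewrite mom.
  apply: eq_Rintegral => t _ /=.
  by rewrite heis_of_row_of Re_mulcr.
- apply: (schwartz_good sIm) => k w.
  have <- : complex.Im (Cintegral leb (fun t => f (Cn_of_pair w, t) * (t ^+ k)%:C)) = 0.
    by rewrite mom.
  apply: eq_Rintegral => t _ /=.
  by rewrite heis_of_row_of Im_mulcr.
Qed.

End componentwise.

(** * The three reconstruction formulas *)

Theorem theorem7p5 (R : realType) (n : nat) (n_ge1 : (1 <= n)%N)
    (f : heis R n -> R[i]) (hf : heis_Phi f) :
  let phi := heis_radon f in
  let c : R[i] := (-1) ^+ n * ((4 * pi : R) ^- (2 * n))%:C in
  heis_radon_cvg f /\
  [/\ [/\ heis_radon_cvg phi, dlast_cvg (2 * n) (heis_radon phi) &
          forall p : heis R n, f p = c * dlast (2 * n) (heis_radon phi) p],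
      [/\ dlast_cvg (2 * n) phi, heis_radon_cvg (dlast (2 * n) phi) &
          forall p : heis R n, f p = c * heis_radon (dlast (2 * n) phi) p] &
      [/\ dlast_cvg n phi, heis_radon_cvg (dlast n phi),
          dlast_cvg n (heis_radon (dlast n phi)) &
          forall p : heis R n,
            f p = c * dlast n (heis_radon (dlast n phi)) p]].
Proof.
move=> phi c.
have [u [v [fuv gu gv]]] := heis_Phi_good hf.
have [U U0 [gU dU]] := good_dt_chain gu; have [V V0 [gV dV]] := good_dt_chain gv.
rewrite -U0 -V0 in fuv.
have dRU k : is_dt (RT (U k)) (RT (U k.+1)) by move=> w t; exact: is_derive_RT.
have dRV k : is_dt (RT (V k)) (RT (V k.+1)) by move=> w t; exact: is_derive_RT.
have dRRU k : is_dt (RT (RT (U k))) (RT (RT (U k.+1))) by move=> w t; exact: is_derive_RRT.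
have dRRV k : is_dt (RT (RT (V k))) (RT (RT (V k.+1))) by move=> w t; exact: is_derive_RRT.
have phiE : has_parts phi (RT (U 0%N)) (RT (V 0%N)) := radon_parts fuv.
have RphiE := radon_parts phiE.
have dphiE m := dlast_parts (u := fun k => RT (U k)) (v := fun k => RT (V k)) phiE dRU dRV m.
have RdphiE m := radon_parts (dphiE m).
have cvgR m : heis_radon_cvg (dlast m phi).
  by apply: (radon_cvg_parts (dphiE m)) => z t; exact: RRT_integrable.
(* All three right-hand sides have these parts, wherever the derivatives are placed, so this single
   identity yields every formula. *)
have inv p F : has_parts F (RT (RT (U (2 * n)%N))) (RT (RT (V (2 * n)%N))) -> f p = c * F p.
  case: p => z t FE; have [w ->] := Cn_of_pair_surj z.
  rewrite FE fuv (RRT_inversion w t gU dU) (RRT_inversion w t gV dV).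
  have cE : c = ((-1) ^+ n * (4 * pi) ^- (2 * n))%:C.
    by rewrite /c rmorphM rmorphXn rmorphN rmorph1.
  have E : (-1) ^+ n * (4 * pi) ^- (2 * n) * (- 16 * pi ^+ 2) ^+ n = 1 :> R.
    rewrite exprM -exprVn -!exprMn; have -> : -1 * ((4 * pi) ^+ 2)^-1 * (-16 * pi ^+ 2) = 1 :> R.
      by have := lt0r_neq0 (pi_gt0 R); move: (pi : R) => p p0; field.
    by rewrite expr1n.
  by rewrite cE mulrcE; congr (_ +i* _); rewrite mulrA E mul1r.
split; first by apply: (radon_cvg_parts fuv) => z t; exact: RT_integrable.
split.
- split.
  + by apply: (radon_cvg_parts phiE) => z t; exact: RRT_integrable.
  + exact: (dlast_cvg_parts (u := fun k => RT (RT (U k))) (v := fun k => RT (RT (V k)))).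
  + move=> p; apply: inv.
    exact: (dlast_parts (u := fun k => RT (RT (U k))) (v := fun k => RT (RT (V k)))).
- split; [|exact: cvgR|by move=> p; apply: inv; exact: RdphiE].
  exact: (dlast_cvg_parts (u := fun k => RT (U k)) (v := fun k => RT (V k))).
- split; [|exact: cvgR| |].
  + exact: (dlast_cvg_parts (u := fun k => RT (U k)) (v := fun k => RT (V k))).
  (* The [n] derivatives taken before the second transform shift the chain of derivatives by [n]. *)
  + exact: (dlast_cvg_parts (RdphiE n) (fun k => dRRU (k + n)%N) (fun k => dRRV (k + n)%N)).
  + move=> p; apply: inv; rewrite mul2n -addnn.
    exact: (dlast_parts (RdphiE n) (fun k => dRRU (k + n)%N) (fun k => dRRV (k + n)%N)).
Qed.
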